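(* Let $m$ be a positive integer, $\Omega\subset\mathbb{R}^n$, $n\ge2$, be open, and $u,f:\Omega\to\mathbb{R}$ with $f\in L^\infty_{loc}(\Omega)$. Assume $u\in C^{2m-1,1}(\Omega)$ satisfies $\Delta^m u=f$ a.e. in $\Omega$. Then for every $x\in\Omega$ and every $0<\varepsilon<\mathrm{dist}(x,\partial\Omega)/m$, $$(A_\varepsilon-I)^m[u](x)=\int_{[0,\varepsilon]^m}A_r[f](x)\,\prod_{i=1}^mK_\varepsilon(r_i)\,dr .$$ Equivalently, for almost every $x\in\Omega$ and every $0<\varepsilon<\mathrm{dist}(x,\partial\Omega)/m$, $$(A_\varepsilon-I)^m[u](x)=\varepsilon^{2m}\sum_{l=0}^{m-1}\tilde c_l\,(A_\varepsilon-I)^l[f](x)+R_\varepsilon(x),\qquad(\ast)$$ where $$\tilde c_l=\sum_{\alpha\in\mathcal C(m,m-l)}\ \prod_{i=1}^{m-l}c_{\alpha_i},\qquad c_a=\prod_{j=1}^{a}\frac{1}{(2j)(n+2j)},$$ and $$R_\varepsilon(x)=\int_{[0,\varepsilon]^m}\Big(A_r-\sum_{l=0}^{m-1}b_\varepsilon^{m,m-l}(r)\,(A_\varepsilon-I)^l\Big)[f](x)\,\prod_{i=1}^mK_\varepsilon(r_i)\,dr .$$ In particular: (1) If $f$ is continuous at $x$, then $R_\varepsilon(x)=o(\varepsilon^{2m})$ as $\varepsilon\to0$. If $f\in C(\Omega)$, then $(\ast)$ holds for every $x\in\Omega$ (and every $0<\varepsilon<\mathrm{dist}(x,\partial\Omega)/m$),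 and $R_\varepsilon=o(\varepsilon^{2m})$ as $\varepsilon\to0$ locally uniformly in $\Omega$. (2) If $f$ has modulus of continuity $\omega$, i.e. $|f(x)-f(y)|\le\omega(|x-y|)$ for all $x,y\in\Omega$, where $\omega:[0,\infty)\to[0,\infty)$ is non-decreasing with $\lim_{t\to0^+}\omega(t)=0$, then $$|R_\varepsilon(x)|\le\frac{3^{m-1}-2^{m-1}+1}{\big(2(n+2)\big)^m}\,\omega(m\varepsilon)\,\varepsilon^{2m}\quad\text{for every }0<\varepsilon<\mathrm{dist}(x,\partial\Omega)/m.$$ (3) If $f$ is Hölder or Lipschitz continuous in $\Omega$ with exponent $\alpha\in(0,1]$, then $R_\varepsilon=O(\varepsilon^{2m+\alpha})$, i.e. there is a constant $C$ with $|R_\varepsilon(x)|\le C\varepsilon^{2m+\alpha}$ for all $x\in\Omega$ and $0<\varepsilon<\mathrm{dist}(x,\partial\Omega)/m$.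
   Context: $A_s[g](x)=\frac{1}{|B_s(x)|}\int_{B_s(x)}g(y)\,dy$ is the ball average, $I$ the identity, and powers denote iterated composition (with $(A_\varepsilon-I)^0=I$). For $r=(r_1,\dots,r_m)$, $A_r[f]=(A_{r_1}\cdots A_{r_m})[f]$ is the composition of averages and $dr=dr_1\cdots dr_m$. The kernel is $K_\varepsilon(s)=\frac{s}{n}\big(1-(s/\varepsilon)^n\big)$, $0\le s\le\varepsilon$. $C^{k,1}(\Omega)$ denotes the $C^k(\Omega)$ functions whose $k$-th order partial derivatives are locally Lipschitz in $\Omega$. $\Delta^m$ is the $m$-fold iterated Laplacian. If $\Omega=\mathbb{R}^n$, $\mathrm{dist}(x,\partial\Omega)=+\infty$. For integers $1\le k\le m$, $\mathcal C(m,k)$ is the set of compositions of $m$ into $k$ positive parts: ordered tuples $\alpha=(\alpha_1,\dots,\alpha_k)$ of integers $\alpha_i\ge1$ with $\alpha_1+\dots+\alpha_k=m$. Put $\sigma_0=0$ and $\sigma_i=\alpha_1+\dots+\alpha_i$. For $r\in[0,\varepsilon]^m$ define $$b_\varepsilon^{m,k}(r)=\sum_{\alpha\in\mathcal C(m,k)}\ \prod_{i=1}^k\prod_{j=1}^{\alpha_i}\left(\frac{r_{\sigma_{i-1}+j}}{\varepsilon}\right)^{2j-2},$$ with the convention that a zeroth power equals $1$. ''$R_\varepsilon=o(\varepsilon^k)$ as $\varepsilon\to0$ locally uniformly in $\Omega$'' means: for every compact $K\subset\Omega$ and every $\eta>0$ there is $\varepsilon_0>0$ such that $\operatorname{ess\,sup}_{x\in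 K}|R_\varepsilon(x)|\le\eta\,\varepsilon^k$ for all $0<\varepsilon<\varepsilon_0$. *)

(* Defs.v *)
From HB Require Import structures.
From mathcomp Require Import all_boot all_order all_algebra.
From mathcomp Require Import all_classical all_reals all_analysis.
From mathcomp Require Import measurable_realfun ess_sup_inf.

Set Implicit Arguments.
Unset Strict Implicit.
Unset Printing Implicit Defensive.

Import Order.TTheory GRing.Theory Num.Theory.
Import numFieldNormedType.Exports.

Local Open Scope classical_set_scope.
Local Open Scope ring_scope.

(* The sigma-algebra on R^n is the product (equivalently, Borel) one; the
   topology is that of the sup norm of 'rV[R]_n, hence the Euclidean one. *)

Section rV_measurable.
Context {R : realType} (n : nat).

Definition rV_coord (i : 'I_n) (x : 'rV[R]_n) : R := x ord0 i.

Let rV_set0 : g_sigma_preimage rV_coord set0.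
Proof. exact: sigma_algebra0. Qed.

Let rV_setC A : g_sigma_preimage rV_coord A -> g_sigma_preimage rV_coord (~` A).
Proof. exact: sigma_algebraC. Qed.

Let rV_bigcup (F : (set 'rV[R]_n)^nat) :
  (forall i, g_sigma_preimage rV_coord (F i)) ->
  g_sigma_preimage rV_coord (\bigcup_i (F i)).
Proof. exact: sigma_algebra_bigcup. Qed.

HB.instance Definition _ := @isMeasurable.Build default_measure_display
  'rV[R]_n (g_sigma_preimage rV_coord) rV_set0 rV_setC rV_bigcup.

End rV_measurable.

Section lebesgue_rV.
Context {R : realType}.

Lemma measurable_rV_coord n (i : 'I_n) :
  measurable_fun [set: 'rV[R]_n] (rV_coord i).
Proof.
move=> _ Y mY; rewrite setTI; apply: sub_sigma_algebra => /=.
rewrite -bigcup_seq/=; exists i => /=; first by rewrite mem_index_enum.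
by exists Y => //; rewrite setTI.
Qed.

Lemma measurable_fun_rVP d (T : measurableType d) n (f : T -> 'rV[R]_n) :
  (forall i, measurable_fun [set: T] (rV_coord i \o f)) ->
  measurable_fun [set: T] f.
Proof.
move=> mf _ A mA; rewrite setTI; move: A mA.
suff H : g_sigma_preimage (@rV_coord R n) `<=` [set A | measurable (f @^-1` A)].
  by move=> A mA; exact: H.
apply: smallest_sub => /=.
  split => /=; first by rewrite preimage_set0.
    by move=> A mA; rewrite setTD -preimage_setC; exact: measurableC.
  by move=> F mF; rewrite preimage_bigcup; exact: bigcup_measurable.
rewrite -bigcup_seq/= => A [i _ [B mB <-]] /=; rewrite setTI.
by have := mf i measurableT B mB; rewrite setTI.
Qed.

Definition rV_cons n (p : R * 'rV[R]_n) : 'rV[R]_n.+1 :=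
  \row_i (if unlift ord0 i is Some j then p.2 ord0 j else p.1).

Definition rV_uncons n (x : 'rV[R]_n.+1) : R * 'rV[R]_n :=
  (x ord0 ord0, \row_j x ord0 (lift ord0 j)).

Lemma rV_consK n : cancel (@rV_cons n) (@rV_uncons n).
Proof.
move=> [a v]; rewrite /rV_uncons /rV_cons !mxE unlift_none; congr pair.
by apply/rowP => j; rewrite !mxE liftK.
Qed.

Lemma measurable_rV_cons n : measurable_fun [set: R * 'rV[R]_n] (@rV_cons n).
Proof.
apply: measurable_fun_rVP => i; case: (unliftP ord0 i) => [j ->|->].
  rewrite (_ : _ \o _ = rV_coord j \o snd); last first.
    by apply/funext => p /=; rewrite /rV_coord mxE liftK.
  exact: measurableT_comp (@measurable_rV_coord n j) measurable_snd.
rewrite (_ : _ \o _ = fst); first exact: measurable_fst.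
by apply/funext => p /=; rewrite /rV_coord mxE unlift_none.
Qed.

Lemma measurable_rV_uncons n : measurable_fun [set: 'rV[R]_n.+1] (@rV_uncons n).
Proof.
apply: measurable_fun_pair; first exact: (measurable_rV_coord ord0).
apply: measurable_fun_rVP => i.
rewrite (_ : _ \o _ = rV_coord (lift ord0 i)); first exact: measurable_rV_coord.
by apply/funext => p /=; rewrite /rV_coord mxE.
Qed.

(* Lebesgue measure on R^(n+1) as the product of those on R and on R^n *)
Definition lebesgue_rVS n (mu : {sigma_finite_measure set 'rV[R]_n -> \bar R}) :
    set 'rV[R]_n.+1 -> \bar R :=
  pushforward (@lebesgue_measure R \x mu)%E (@rV_cons n).

Section lebesgue_rVS_measure.
Variables (n : nat) (mu : {sigma_finite_measure set 'rV[R]_n -> \bar R}).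

Let lebesgue_rVS0 : lebesgue_rVS mu set0 = 0%E.
Proof. by rewrite /lebesgue_rVS /pushforward preimage_set0 measure0. Qed.

Let lebesgue_rVS_ge0 A : (0 <= lebesgue_rVS mu A)%E.
Proof. by rewrite /lebesgue_rVS /pushforward; exact: measure_ge0. Qed.

Let measurable_preimage A : measurable A -> measurable (@rV_cons n @^-1` A).
Proof.
by move=> mA; rewrite -[X in measurable X]setTI; exact: measurable_rV_cons.
Qed.

Let lebesgue_rVS_sigma_additive : semi_sigma_additive (lebesgue_rVS mu).
Proof.
move=> F mF tF mUF; rewrite /lebesgue_rVS /pushforward preimage_bigcup.
apply: measure_semi_sigma_additive.
- by move=> k; exact: measurable_preimage.
- apply/trivIsetP => /= i j _ _ ij; rewrite -preimage_setI.
  by move/trivIsetP : tF => /(_ _ _ _ _ ij) ->//; rewrite preimage_set0.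
- by rewrite -preimage_bigcup; exact: measurable_preimage.
Qed.

HB.instance Definition _ := isMeasure.Build _ _ _ (lebesgue_rVS mu)
  lebesgue_rVS0 lebesgue_rVS_ge0 lebesgue_rVS_sigma_additive.

Let lebesgue_rVS_sigma_finite : sigma_finite setT (lebesgue_rVS mu).
Proof.
have /sigma_finiteP[F [TF ndF Foo]] := sigma_finiteT (@lebesgue_measure R).
have /sigma_finiteP[G [TG ndG Goo]] := sigma_finiteT mu.
exists (fun k => @rV_uncons n @^-1` (F k `*` G k)).
  rewrite -preimage_bigcup -[LHS](@preimage_setT _ _ (@rV_uncons n)).
  congr (_ @^-1` _); rewrite -setXTT TF TG; apply/seteqP.
  split=> [[x y] [/= [j _ Fjx] [k _ Gky]]|[x y] [k _ [/= Fkx Gky]]]; last first.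
    by split; exists k.
  exists (maxn j k) => //; split.
    by move: x Fjx; exact/subsetPset/ndF/leq_maxl.
  by move: y Gky; exact/subsetPset/ndG/leq_maxr.
move=> k; have [mFk Fkoo] := Foo k; have [mGk Gkoo] := Goo k; split.
  rewrite -[X in measurable X]setTI; apply: measurable_rV_uncons => //.
  exact: measurableX.
rewrite /lebesgue_rVS /pushforward -comp_preimage.
rewrite (_ : _ \o _ = id) ?preimage_id; last first.
  by apply/funext => p /=; rewrite rV_consK.
by rewrite product_measure1E// lte_mul_pinfty// ge0_fin_numE.
Qed.

HB.instance Definition _ := Measure_isSigmaFinite.Build _ _ _ (lebesgue_rVS mu)
  lebesgue_rVS_sigma_finite.

End lebesgue_rVS_measure.

Fixpoint lebesgue_rV n : {sigma_finite_measure set 'rV[R]_n -> \bar R} :=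
  if n is n'.+1 then lebesgue_rVS (lebesgue_rV n') else dirac (0 : 'rV[R]_0).

Lemma lebesgue_rV_box n (A : 'I_n -> set R) : (forall i, measurable (A i)) ->
  lebesgue_rV n [set x | forall i, A i (x ord0 i)] =
  (\prod_(i < n) lebesgue_measure (A i))%E.
Proof.
elim: n A => [|n ih] A mA.
  rewrite big_ord0 /= diracE mem_set//; by move=> [].
have mB : measurable [set x : 'rV[R]_n | forall i, A (lift ord0 i) (x ord0 i)].
  rewrite (_ : mkset _ =
      \big[setI/setT]_(i < n) (rV_coord i @^-1` A (lift ord0 i))).
    apply: bigsetI_measurable => i _; rewrite -[X in measurable X]setTI.
    exact: measurable_rV_coord.
  apply/seteqP; split => [x Ax|x]; rewrite -bigcap_seq/=.
    by move=> i _; exact: Ax.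
  by move=> Ax i; apply: Ax => /=; rewrite mem_index_enum.
rewrite /= /lebesgue_rVS /pushforward big_ord_recl -ih//.
rewrite -product_measure1E; [|exact: mA|exact: mB].
congr (_ _); apply/seteqP; split => [[a v]/= Av|[a v]/= [Aa Av] i].
  split => [|j]; first by have := Av ord0; rewrite mxE unlift_none.
  by have := Av (lift ord0 j); rewrite mxE liftK.
by rewrite mxE; case: unliftP => [j ->|->].
Qed.

End lebesgue_rV.

Arguments lebesgue_rV : clear implicits.
Notation lebesgue_Rn n := (lebesgue_rV _ n).

Section euclidean.
Context {R : realType} {n : nat}.
Implicit Types (x y : 'rV[R]_n) (Om : set 'rV[R]_n) (g : 'rV[R]_n -> R).

(* the norm `|x| of 'rV[R]_n is the sup norm *)
Definition enorm x : R := Num.sqrt (\sum_i x ord0 i ^+ 2).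

Definition eball x (s : R) : set 'rV[R]_n := [set y | enorm (y - x) < s].

Definition boundary Om : set 'rV[R]_n := closure Om `\` Om°.

(* equals +oo when the boundary is empty *)
Definition dist_boundary Om x : \bar R :=
  ereal_inf [set (enorm (x - y))%:E | y in boundary Om].

Definition partial (i : 'I_n) g : 'rV[R]_n -> R := 'D_(delta_mx ord0 i) g.

Definition partials (s : seq 'I_n) g : 'rV[R]_n -> R := foldr partial g s.

Definition laplacian g : 'rV[R]_n -> R :=
  fun x => \sum_(i < n) partial i (partial i g) x.

Definition Ck Om (k : nat) g : Prop := forall x, Om x ->
  forall s : seq 'I_n,
    ((size s < k)%N -> forall i, derivable (partials s g) x (delta_mx ord0 i)) /\
    ((size s <= k)%N -> {for x, continuous (partials s g)}).

Definition locally_lipschitz Om g : Prop := forall x, Om x ->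
  exists2 L : R, 0 <= L & exists2 U, nbhs x U &
    forall y z, U y -> U z -> `|g y - g z| <= L * enorm (y - z).

Definition Ck1 Om (k : nat) g : Prop :=
  Ck Om k g /\ forall s : seq 'I_n, size s = k -> locally_lipschitz Om (partials s g).

(* [Delta^m g] exists at [x], and its value there is [a]. When [g] is of class
   C^(2m-1) around [x], only the last of the 2m derivatives may fail to exist. *)
Definition is_polylaplacian (m : nat) g x (a : R) : Prop :=
  (forall i, derivable (partial i (iter m.-1 laplacian g)) x (delta_mx ord0 i)) /\
  iter m laplacian g x = a.

Definition lebesgue_measurable_on Om g : Prop := forall B : set R,
  measurable B -> completed_algebra_gen (lebesgue_Rn n) (Om `&` g @^-1` B).

Definition Linfty_loc Om g : Prop :=
  lebesgue_measurable_on Om g /\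
  forall K : set 'rV[R]_n, compact K -> K `<=` Om ->
    exists M : R, {ae lebesgue_Rn n, forall x, K x -> `|g x| <= M}.

Definition ball_avg (s : R) g : 'rV[R]_n -> R := fun x =>
  (fine (lebesgue_Rn n (eball x s)))^-1 *
  \int[lebesgue_Rn n]_(y in eball x s) g y.

(* (A_s - I)^l *)
Definition avg_sub_pow (s : R) (l : nat) g : 'rV[R]_n -> R :=
  iter l (fun h y => ball_avg s h y - h y) g.

End euclidean.

Section expansion.
Context {R : realType}.

Definition entries m (r : 'rV[R]_m) : seq R := [seq r ord0 i | i <- enum 'I_m].

(* A_(r_1) (A_(r_2) (... A_(r_m) g)) *)
Definition multi_avg n m (r : 'rV[R]_m) (g : 'rV[R]_n -> R) : 'rV[R]_n -> R :=
  foldr ball_avg g (entries r).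

Definition cube m (eps : R) : set 'rV[R]_m :=
  [set r | forall i, 0 <= r ord0 i <= eps].
Arguments cube m eps _ : clear implicits.

Definition kern (n : nat) (eps s : R) : R := s / n%:R * (1 - (s / eps) ^+ n).

Definition compositions (m k : nat) : {set {ffun 'I_k -> 'I_m.+1}} :=
  [set a : {ffun 'I_k -> 'I_m.+1} |
    [forall i, (0 < a i)%N] && ((\sum_i a i)%N == m)]%SET.

(* sigma_(i-1), for the part of (1-based) index i *)
Definition part_offset m k (a : {ffun 'I_k -> 'I_m.+1}) (i : 'I_k) : nat :=
  (\sum_(j < k | (j < i)%N) a j)%N.

(* [entries r] and [j] are indexed from 0: the exponent 2j - 2 becomes 2 * j *)
Definition bcoef m (k : nat) (eps : R) (r : 'rV[R]_m) : R :=
  \sum_(a in compositions m k) \prod_(i < k) \prod_(j < a i)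
    ((entries r)`_(part_offset a i + j) / eps) ^+ (2 * j).

Definition ccoef (n a : nat) : R :=
  \prod_(1 <= j < a.+1) (((2 * j) * (n + 2 * j))%N%:R)^-1.

Definition ctilde (n m l : nat) : R :=
  \sum_(a in compositions m (m - l)) \prod_(i < m - l) ccoef n (a i).

Definition remainder n m (f : 'rV[R]_n -> R) (eps : R) (x : 'rV[R]_n) : R :=
  \int[lebesgue_Rn m]_(r in cube m eps)
    ((multi_avg r f x -
      \sum_(l < m) bcoef (m - l) eps r * avg_sub_pow eps l f x) *
     \prod_(i < m) kern n eps (r ord0 i)).

Definition little_o_loc_unif n (Om : set 'rV[R]_n) (k : nat)
    (Rem : R -> 'rV[R]_n -> R) : Prop :=
  forall K : set 'rV[R]_n, compact K -> K `<=` Om ->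
  forall eta : R, 0 < eta -> exists2 eps0 : R, 0 < eps0 &
  forall eps : R, 0 < eps < eps0 ->
    (ess_sup (lebesgue_Rn n) (fun x => `|(Rem eps \_ K) x|%:E)
      <= (eta * eps ^+ k)%:E)%E.

End expansion.

Arguments cube {R} m eps _.

(* Main.v *)
(* Write J g = int_0^eps K(t) A_t g dt. For v of class C^{1,1} near a closed ball
   of radius eps, A_eps v - v = J (Delta v): integrate grad v along the rays of
   the ball, then integrate by parts on each ball of radius r against
   (r^2 - |y|^2) / 2 = int_{|y|}^r s ds and exchange the integrals. Since Delta v
   exists only a.e., the integration by parts is done on the difference quotients
   of grad v, which are bounded by Lipschitz continuity and pass to the limit by
   dominated convergence. As A_eps commutes with J, the identities for
   u, Delta u, ..., Delta^(m-1) u compose to (A_eps - I)^m u = J^m f, and Fubini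
   turns J^m into the integral over the cube.

   The expansion then holds at every point by linearity, because the moments
   int_0^eps (t/eps)^(2j) K(t) dt = eps^2 / ((2j+2)(n+2j+2)) integrate
   b^{m,k} to eps^(2m) times the sum defining c~_(m-k). For the remainder, if f
   oscillates by at most eta on the relevant ball, then A_r f - f is bounded by
   eta, (A_eps - I)^l f by 2^(l-1) eta, and |b^{m,k}| by the number
   C(m-1, k-1) of compositions; finally 2^(l-1) <= 2^l - 1 and the binomial
   theorem give the constant 3^(m-1) - 2^(m-1) + 1. *)
Require Import Defs.
From HB Require Import structures.
From mathcomp Require Import all_boot all_order all_algebra.
From mathcomp Require Import all_classical all_reals all_analysis.
From mathcomp Require Import measurable_realfun ess_sup_inf zify ring lra.

Set Implicit Arguments.
Unset Strict Implicit.
Unset Printing Implicit Defensive.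

Import Order.TTheory GRing.Theory Num.Theory.
Import numFieldNormedType.Exports.

Local Open Scope classical_set_scope.
Local Open Scope ring_scope.

(** * The Euclidean norm on row vectors *)

(** The obstacle is measurability. The datum [f] is only Lebesgue measurable, while Fubini is
    applied to Borel functions. So [f] is replaced by a bounded Borel [g], equal to it a.e. on a
    ball of radius [rho > m eps]; averages do not see the difference. As [(A - I)^l f] also contains
    the point value [f x], the replacement keeps [g x = f x] for the remainder estimate. Likewise
    each iterated Laplacian of [u] is cut off to 0 outside that ball. All functions are then bounded
    and Borel on the whole space, where averages and [J] commute without restriction; locality is
    recovered by tracking dependency balls. The weight [(r^2 - |y|^2) / 2] vanishes on the sphere,
    so that integration by parts has no boundary term and surface measure never appears. Rescaling
    the ball of radius [r] to the unit ball costs [r^(-n-1)], the layers of the weight bring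
    [s^(n+1)], and the integral of [(s / r)^(n+1)] over [s <= r <= eps] is the kernel. The remainder
    is defined by subtraction, so the numbers [(A - I)^l f(x)] cancel in the expansion whatever they
    are; this is why it holds at every point. *)

Section enorm_theory.
Context {R : realType} {n : nat}.
Implicit Types x y z : 'rV[R]_n.

Lemma enorm_ge0 x : 0 <= enorm x.
Proof. exact: sqrtr_ge0. Qed.

Lemma enorm_sqr x : enorm x ^+ 2 = \sum_i x ord0 i ^+ 2.
Proof. by rewrite sqr_sqrtr// sumr_ge0// => i _; rewrite sqr_ge0. Qed.

Lemma enorm0 : enorm (0 : 'rV[R]_n) = 0.
Proof. by rewrite /enorm big1 ?sqrtr0// => i _; rewrite mxE expr0n. Qed.

Lemma enormN x : enorm (- x) = enorm x.
Proof. by congr Num.sqrt; apply: eq_bigr => i _; rewrite mxE sqrrN. Qed.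

Lemma enormB x y : enorm (x - y) = enorm (y - x).
Proof. by rewrite -enormN opprB. Qed.

Lemma enormZ (a : R) x : 0 <= a -> enorm (a *: x) = a * enorm x.
Proof.
move=> a0; apply/eqP; rewrite -(@eqrXn2 _ 2)// ?mulr_ge0 ?enorm_ge0//.
rewrite exprMn !enorm_sqr mulr_sumr; apply/eqP.
by apply: eq_bigr => i _; rewrite mxE exprMn.
Qed.

Lemma enormD x y : enorm (x + y) <= enorm x + enorm y.
Proof.
have CS : (\sum_i x ord0 i * y ord0 i) <= enorm x * enorm y.
  set s := \sum_i _; have [s0|s0] := leP s 0.
    by rewrite (le_trans s0)// mulr_ge0 ?enorm_ge0.
  have [x0|x0] := eqVneq (enorm x) 0.
    suff : s = 0 by move=> s00; rewrite s00 ltxx in s0.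
    have /eqP : \sum_i x ord0 i ^+ 2 = 0 by rewrite -enorm_sqr x0 expr0n.
    rewrite psumr_eq0 => [/allP xi0|i _]; last exact: sqr_ge0.
    apply: big1 => i _; have /implyP/(_ isT) := xi0 i (mem_index_enum i).
    by rewrite sqrf_eq0 => /eqP ->; rewrite mul0r.
  have x_gt0 : 0 < enorm x by rewrite lt_def x0 enorm_ge0.
  (* Cauchy-Schwarz from a sum of squares: expanded, it equals [|x|^2 (|x|^2 |y|^2 - s^2)]. *)
  have : 0 <= \sum_i (s * x ord0 i - enorm x ^+ 2 * y ord0 i) ^+ 2.
    by apply: sumr_ge0 => i _; exact: sqr_ge0.
  rewrite (_ : \sum_i _ = \sum_i (s ^+ 2 * x ord0 i ^+ 2 +
    (enorm x ^+ 2 ^+ 2 * y ord0 i ^+ 2 +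
     - (s * enorm x ^+ 2 * 2) * (x ord0 i * y ord0 i)))); last first.
    by apply: eq_bigr => i _; ring.
  rewrite !big_split/= -!mulr_sumr -!enorm_sqr -/s.
  rewrite (_ : _ + _ = (enorm x)^+2 * ((enorm x * enorm y)^+2 - s ^+ 2)); last by ring.
  rewrite pmulr_rge0 ?exprn_gt0// subr_ge0 ler_pXn2r ?nnegrE ?(ltW s0)//.
  by rewrite mulr_ge0 ?enorm_ge0.
rewrite -(@ler_pXn2r _ 2) ?nnegrE ?addr_ge0 ?enorm_ge0//.
rewrite enorm_sqr (_ : \sum_i _ = \sum_i (x ord0 i ^+ 2 +
    (y ord0 i ^+ 2 + 2 * (x ord0 i * y ord0 i)))); last first.
  by apply: eq_bigr => i _; rewrite mxE; ring.
rewrite !big_split/= -mulr_sumr -!enorm_sqr.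
by move: CS; set s := \sum_i _; nra.
Qed.

Lemma enorm_tri x y z : enorm (x - z) <= enorm (x - y) + enorm (y - z).
Proof. by rewrite (le_trans _ (enormD _ _))// addrA subrK. Qed.

Lemma enorm_coord x i : `|x ord0 i| <= enorm x.
Proof.
rewrite -(@ler_pXn2r _ 2) ?nnegrE ?enorm_ge0// enorm_sqr real_normK ?num_real//.
by rewrite (bigD1 i)//= lerDl sumr_ge0// => j _; exact: sqr_ge0.
Qed.

Lemma coord_norm x i : `|x ord0 i| <= `|x|.
Proof.
rewrite [leRHS]/Num.norm/= mx_normrE.
by apply: (le_bigmax_cond _ (fun i => `|x i.1 i.2|) (j := (ord0, i))).
Qed.

Lemma enorm_le_norm x : enorm x <= n%:R * `|x|.
Proof.
rewrite -(@ler_pXn2r _ 2) ?nnegrE ?enorm_ge0 ?mulr_ge0// enorm_sqr.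
rewrite (@le_trans _ _ (\sum_(i < n) `|x| ^+ 2))//.
  apply: ler_sum => i _; rewrite -[leLHS]real_normK ?num_real//.
  by rewrite ler_pXn2r ?nnegrE// coord_norm.
rewrite sumr_const card_ord -[leLHS]mulr_natl exprMn.
rewrite ler_wpM2r ?exprn_ge0// -natrX ler_nat.
by case: (n) => // k; rewrite leq_pmulr.
Qed.

Lemma norm_le_enorm x : `|x| <= enorm x.
Proof.
rewrite [leLHS]/Num.norm/= mx_normrE; apply: bigmax_le; first exact: enorm_ge0.
by move=> [i j] _/=; rewrite ord1 enorm_coord.
Qed.

Lemma enorm_sub_le x y : `|enorm x - enorm y| <= enorm (x - y).
Proof.
have := enorm_tri x y 0; have := enorm_tri y x 0.
rewrite !subr0 [enorm (y - x)]enormB ler_norml => yx xy.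
by apply/andP; split; lra.
Qed.

Lemma near_enorm x (e : R) : 0 < e -> \forall y \near x, enorm (y - x) < e.
Proof.
(* The [+ 1] keeps the denominator positive in dimension 0. *)
move=> e0; have d0 : 0 < e / (n%:R + 1) by rewrite divr_gt0// ltr_wpDl.
apply: filterS (nbhsx_ballx x _ d0) => y; rewrite -ball_normE/= => xy.
rewrite enormB (le_lt_trans (enorm_le_norm _))//.
apply: (@le_lt_trans _ _ (n%:R * (e / (n%:R + 1)))).
  by rewrite ler_wpM2l// ltW.
rewrite mulrA ltr_pdivrMr ?ltr_wpDl// mulrDr mulr1 mulrC.
by rewrite ltrDl.
Qed.

Lemma enorm_sub_continuous x : continuous (fun y : 'rV[R]_n => enorm (y - x)).
Proof.
move=> y; apply/(cvgrPdist_lt (FF := nbhs_filter y)) => e e0.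
apply: filterS (near_enorm y e0) => z zy.
rewrite (le_lt_trans (enorm_sub_le _ _))// opprB addrA subrK enormB//.
Qed.

Lemma nbhs_eball x (A : set 'rV[R]_n) : nbhs x A ->
  exists2 e : R, 0 < e & eball x e `<=` A.
Proof.
move=> /nbhs_ballP[e/= e0 eA]; exists e => // y yx; apply: eA.
rewrite -ball_normE/= distrC; exact: le_lt_trans (norm_le_enorm _) yx.
Qed.

Lemma eball_open x (s : R) : open (eball x s).
Proof.
rewrite /eball; apply: (@open_comp _ _ (fun y => enorm (y - x)) [set r | r < s]).
  by move=> y _; exact: enorm_sub_continuous.
exact: open_lt.
Qed.

Lemma compact_eball x (s : R) : compact [set y | enorm (y - x) <= s].
Proof.
apply: bounded_closed_compact.
  exists (s + `|x|); split; first exact: num_real.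
  move=> M sM y/= yx; rewrite -(subrK x y) (le_trans (ler_normD _ _))//.
  rewrite (le_trans _ (ltW sM))// lerD2r (le_trans (norm_le_enorm _))//.
apply: (@closed_comp _ _ (fun y => enorm (y - x)) [set r | r <= s]).
  by move=> y _; exact: enorm_sub_continuous.
exact: closed_le.
Qed.

Lemma eball_le0 x (s : R) : s <= 0 -> eball x s = set0.
Proof.
move=> s0; apply/seteqP; split => // y; rewrite /eball/= => ys.
by have := le_lt_trans (enorm_ge0 (y - x)) (lt_le_trans ys s0); rewrite ltxx.
Qed.

Lemma subset_eball x y (s t : R) : s + enorm (y - x) <= t ->
  eball y s `<=` eball x t.
Proof.
rewrite /eball => st z/= zy; apply: le_lt_trans (enorm_tri z y x) _.
by apply: lt_le_trans st; rewrite ltrD2r.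
Qed.

End enorm_theory.

(** * Open sets are Borel *)

Section measurable_rV.
Context {R : realType} {n : nat}.

(** The sigma-algebra is generated by coordinates, and an open set is the countable union of the
    boxes [B p], with rational centre and half side [1 / (k + 1)], that it contains. *)
Lemma open_measurable_rV (U : set 'rV[R]_n) : open U -> measurable U.
Proof.
move=> oU.
pose B (p : 'rV[rat]_n * nat) : set 'rV[R]_n :=
  [set y | forall i, `|y ord0 i - ratr (p.1 ord0 i)| < p.2.+1%:R^-1].
pose F p := if `[< B p `<=` U >] then B p else set0.
have mB p : measurable (B p).
  rewrite (_ : B p = \big[setI/setT]_(i < n)
      (rV_coord i @^-1` [set r | `|r - ratr (p.1 ord0 i)| < p.2.+1%:R^-1])); last first.
    apply/seteqP; split => [x Ax|x]; rewrite -bigcap_seq/=.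
      by move=> i _; exact: Ax.
    by move=> Ax i; apply: Ax => /=; rewrite mem_index_enum.
  apply: bigsetI_measurable => i _; rewrite -[X in measurable X]setTI.
  apply: measurable_rV_coord => //.
  rewrite (_ : mkset _ = ball (ratr (p.1 ord0 i) : R) p.2.+1%:R^-1); first exact: measurable_ball.
  by apply/seteqP; split => r/=; rewrite -ball_normE/= distrC.
rewrite (_ : U = \bigcup_p F p).
  apply: countable_bigcupT_measurable; first exact: countableP.
  by move=> p; rewrite /F; case: ifP.
apply/seteqP; split => [x Ux|x [p _]]; last first.
  by rewrite /F; case: asboolP => // BU /BU.
have /nbhs_ballP[e/= e0 eU] := oU x Ux.
have e20 : 0 < e / 2 by rewrite divr_gt0.
have [N _ /(_ N (leqnn N))/= Ne] := near_infty_natSinv_lt (PosNum e20).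
have N0 : 0 < N.+1%:R^-1 :> R by [].
pose t : R := N.+1%:R^-1; rewrite -/t in Ne N0.
have /choice[q xq] i : exists q : rat, `|x ord0 i - ratr q| < t.
  have [q] := @rat_in_itvoo R (x ord0 i - t) (x ord0 i + t) ltac:(by rewrite ltrD2l gtrN).
  by rewrite in_itv/= => /andP[xq qx]; exists q; rewrite ltr_norml; apply/andP; split; lra.
exists (\row_i q i, N) => //; rewrite /F ifT; last first.
  apply/asboolP => y By; apply: eU; split => // i j; rewrite ord1 -ball_normE/=.
  have := By j; have := xq j; rewrite !mxE /= -/t => xj yj.
  rewrite (le_lt_trans (ler_distD (ratr (q j)) _ _))//.
  by rewrite [X in _ + X]distrC [ltRHS]splitr; lra.
by move=> i; rewrite mxE.
Qed.

End measurable_rV.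

(** * Integrals of bounded functions *)

Section Rintegral_tools.
Context d {T : measurableType d} {R : realType}.
Variable mu : {measure set T -> \bar R}.

Lemma bounded_Rintegrable (A : set T) (f : T -> R) (M : R) : measurable A ->
  (mu A < +oo)%E -> measurable_fun A f -> (forall x, A x -> `|f x| <= M) ->
  mu.-integrable A (EFin \o f).
Proof.
move=> mA Aoo mf fM; apply: measurable_bounded_integrable => //.
exists M; split; first exact: num_real.
by move=> x Mx y Ay /=; rewrite (le_trans (fM _ Ay))// ltW.
Qed.

Lemma le_Rintegral_bound (A : set T) (f : T -> R) (M : R) : measurable A ->
  (mu A < +oo)%E -> measurable_fun A f -> (forall x, A x -> `|f x| <= M) ->
  `|\int[mu]_(x in A) f x| <= M * fine (mu A).
Proof.
move=> mA Aoo mf fM; have intf := bounded_Rintegrable mA Aoo mf fM.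
rewrite (le_trans (le_normr_Rintegral mA intf))// -Rintegral_cst//.
apply: le_Rintegral => //; first exact: integrable_norm.
by apply: (bounded_Rintegrable (M := `|M|)).
Qed.

Lemma Rintegral_sum (A : set T) I (s : seq I) (f : I -> T -> R) : measurable A ->
  (forall i, mu.-integrable A (EFin \o f i)) ->
  \int[mu]_(x in A) (\sum_(i <- s) f i x) = \sum_(i <- s) \int[mu]_(x in A) f i x.
Proof.
move=> mA intf; elim: s => [|i s ih].
  rewrite big_nil (@eq_Rintegral _ _ _ _ _ (cst 0)) ?Rintegral_cst ?mul0r//.
  by move=> x _; rewrite big_nil.
rewrite big_cons -ih -RintegralD//; first by apply: eq_Rintegral => x _; rewrite big_cons.
rewrite (_ : EFin \o _ = fun x => (\sum_(i <- s) (EFin \o f i) x)%E).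
  exact: integrable_sum.
by apply/funext => x; rewrite sumEFin.
Qed.

Lemma Rintegral_dominated_cvg (A : set T) (f_ : (T -> R)^nat) (f : T -> R) (M : R) :
  measurable A -> (mu A < +oo)%E -> (forall k, measurable_fun A (f_ k)) ->
  measurable_fun A f -> (forall k x, A x -> `|f_ k x| <= M) ->
  {ae mu, forall x, A x -> f_ ^~ x @ \oo --> f x} ->
  (fun k => \int[mu]_(x in A) f_ k x) @ \oo --> \int[mu]_(x in A) f x.
Proof.
move=> mA Aoo mf_ mf fM cf.
have iM : mu.-integrable A (EFin \o cst M) by apply: (bounded_Rintegrable (M := `|M|)).
have cf' : {ae mu, forall x, A x -> (fun k => (f_ k x)%:E) @ \oo --> (f x)%:E}.
  by apply: filterS cf => x + Ax => /(_ Ax) cfx; apply: cvg_EFin => //; exact: nearW.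
have fM' : {ae mu, forall x k, A x -> (`|(f_ k x)%:E| <= (M)%:E)%E}.
  by apply: aeW => x k Ax; rewrite lee_fin fM.
have [||intf _ cI] := dominated_convergence mA _ _ cf' iM fM'.
- by move=> k; exact/measurable_EFinP.
- exact/measurable_EFinP.
move: cI; rewrite -(fineK (integrable_fin_num mA intf)) => /fine_cvgP[_].
exact.
Qed.

End Rintegral_tools.

(** * Fubini for bounded functions *)

Section Rintegral_product.
Context d1 d2 {T1 : measurableType d1} {T2 : measurableType d2} {R : realType}.
Variable m1 : {sigma_finite_measure set T1 -> \bar R}.
Variable m2 : {sigma_finite_measure set T2 -> \bar R}.

(** Tonelli treats the positive and negative parts separately, and measurability survives their
    difference and [fine]. The domain may vary with [x], as it does for balls with moving centre and
    radius. *)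
Lemma measurable_fun_Rintegral (F : T1 * T2 -> R) (D : set (T1 * T2)) :
  measurable D -> measurable_fun setT F ->
  measurable_fun setT (fun x => \int[m2]_(y in [set y | D (x, y)]) F (x, y)).
Proof.
move=> mD mF; pose G p := (F \_ D p)%:E.
have mG : measurable_fun setT G.
  by apply/measurable_EFinP; rewrite -measurable_restrictT//; exact: measurable_funTS.
rewrite (_ : (fun x => _) = (fun x => fine (\int[m2]_y G (x, y))%E)); last first.
  by apply/funext => x; rewrite Rintegral_mkcond; congr fine.
apply: measurableT_comp; first exact: fine_measurable.
rewrite (_ : (fun x => _) = (fubini_F m2 G^\+ \- fubini_F m2 G^\-)%E); last first.
  apply/funext => x; rewrite [LHS]integralE.
  under eq_integral do rewrite funepos_comp/=.
  by under [X in (_ - X)%E = _]eq_integral do rewrite funeneg_comp/=.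
apply: emeasurable_funB.
  apply: (measurable_fun_fubini_tonelli_F (G ^\+)%E) => //.
  exact: measurable_funepos.
apply: (measurable_fun_fubini_tonelli_F (G ^\-)%E) => //.
exact: measurable_funeneg.
Qed.

Lemma bounded_integrable_prod (F : T1 * T2 -> R) (M : R) (D1 : set T1) (D2 : set T2) :
  measurable D1 -> measurable D2 -> (m1 D1 < +oo)%E -> (m2 D2 < +oo)%E ->
  measurable_fun setT F -> (forall x y, D1 x -> D2 y -> `|F (x, y)| <= M) ->
  (m1 \x m2)%E.-integrable (D1 `*` D2) (EFin \o F).
Proof.
move=> mD1 mD2 D1oo D2oo mF FM; apply: (bounded_Rintegrable (M := M)).
- exact: measurableX.
- suff : ((m1 \x m2)%E (D1 `*` D2) < +oo)%E by [].
  by rewrite product_measure1E// lte_mul_pinfty// ge0_fin_numE.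
- exact: measurable_funTS.
- by move=> [x y] [/= ? ?]; exact: FM.
Qed.

Lemma iterated_RintegralE (F : T1 * T2 -> R) (M : R) (D1 : set T1) (D2 : set T2) :
  measurable D1 -> measurable D2 -> (m1 D1 < +oo)%E -> (m2 D2 < +oo)%E ->
  measurable_fun setT F -> (forall x y, D1 x -> D2 y -> `|F (x, y)| <= M) ->
  \int[m1]_(x in D1) \int[m2]_(y in D2) F (x, y) =
  fine (\int[m1]_x \int[m2]_y ((EFin \o F) \_ (D1 `*` D2)) (x, y))%E.
Proof.
move=> mD1 mD2 D1oo D2oo mF FM.
rewrite Rintegral_mkcond; congr fine; apply: eq_integral => x _.
rewrite patchE; case: ifPn => xD1; last first.
  by rewrite integral0_eq// => y _; rewrite patchE in_setX/= (negbTE xD1).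
rewrite /Rintegral fineK; last first.
  apply: integrable_fin_num => //; apply: (bounded_Rintegrable (M := M)) => //.
    by apply: measurable_funTS; apply: measurableT_comp mF _; exact: pair1_measurable.
  by move=> y D2y; apply: FM => //; exact/set_mem.
rewrite integral_mkcond; apply: eq_integral => y _.
by rewrite !patchE in_setX/= xD1.
Qed.

Lemma Rintegral_prod (F : T1 * T2 -> R) (M : R) (D1 : set T1) (D2 : set T2) :
  measurable D1 -> measurable D2 -> (m1 D1 < +oo)%E -> (m2 D2 < +oo)%E ->
  measurable_fun setT F -> (forall x y, D1 x -> D2 y -> `|F (x, y)| <= M) ->
  \int[(m1 \x m2)%E]_(p in D1 `*` D2) F p =
  \int[m1]_(x in D1) \int[m2]_(y in D2) F (x, y).
Proof.
move=> mD1 mD2 D1oo D2oo mF FM; rewrite (iterated_RintegralE (M := M))//.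
have mD : measurable (D1 `*` D2) by exact: measurableX.
have /(integrable_mkcond _ mD) iF := bounded_integrable_prod mD1 mD2 D1oo D2oo mF FM.
by congr fine; rewrite integral_mkcond -integral12_prod_meas1.
Qed.

End Rintegral_product.

Lemma Rintegral_swap d1 d2 {T1 : measurableType d1} {T2 : measurableType d2}
    {R : realType} (m1 : {sigma_finite_measure set T1 -> \bar R})
    (m2 : {sigma_finite_measure set T2 -> \bar R})
    (F : T1 * T2 -> R) (M : R) (D1 : set T1) (D2 : set T2) :
  measurable D1 -> measurable D2 -> (m1 D1 < +oo)%E -> (m2 D2 < +oo)%E ->
  measurable_fun setT F -> (forall x y, D1 x -> D2 y -> `|F (x, y)| <= M) ->
  \int[m1]_(x in D1) \int[m2]_(y in D2) F (x, y) =
  \int[m2]_(y in D2) \int[m1]_(x in D1) F (x, y).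
Proof.
move=> mD1 mD2 D1oo D2oo mF FM.
have mD : measurable (D1 `*` D2) by exact: measurableX.
have /(integrable_mkcond _ mD) iF := bounded_integrable_prod mD1 mD2 D1oo D2oo mF FM.
rewrite (iterated_RintegralE (M := M))// (Fubini iF).
pose F' (p : T2 * T1) := F (p.2, p.1).
have mF' : measurable_fun setT F'.
  apply: measurableT_comp mF _; apply: measurable_fun_pair.
    exact: measurable_snd.
  exact: measurable_fst.
have F'M y x : D2 y -> D1 x -> `|F' (y, x)| <= M by move=> D2y D1x; exact: FM.
rewrite -[RHS]/(\int[m2]_(y in D2) \int[m1]_(x in D1) F' (y, x)).
rewrite [RHS](iterated_RintegralE mD2 mD1 D2oo D1oo mF' F'M).
apply: (congr1 fine); apply: eq_integral => y _.
apply: eq_integral => x _.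
by rewrite !patchE !in_setX/= andbC.
Qed.

(** * Lebesgue measure of Euclidean balls *)

Section affine_change_of_variables.
Context {R : realType}.
Local Notation lam := (@lebesgue_measure R).

Let measurable_affine1 (a r : R) :
  measurable_fun [set: measurableTypeR R] (fun t : measurableTypeR R => a + r * t : measurableTypeR R).
Proof.
apply: measurable_funD; first exact: measurable_cst.
by apply: measurable_funM; [exact: measurable_cst|exact: measurable_id].
Qed.

(** Lebesgue measure is determined by its values on half-open intervals, and there it agrees with
    [r] times its image under [phi]. *)
Lemma ge0_integral_affine1 (a r : R) (f : R -> \bar R) : 0 < r ->
  measurable_fun setT f -> (forall t, 0 <= f t)%E ->
  (\int[lam]_t f t = r%:E * \int[lam]_t f (a + r * t)%R)%E.
Proof.
move=> r0 mf f0; have r_ge0 := ltW r0.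
pose phi (t : measurableTypeR R) : measurableTypeR R := a + r * t.
pose mu : {measure set (measurableTypeR R) -> \bar R} :=
  pushforward lam phi.
pose nu : {measure set (measurableTypeR R) -> \bar R} := 
  mscale (NngNum r_ge0) (mu (measurable_affine1 a r)).
rewrite (@eq_measure_integral _ _ _ _ nu); last first.
  move=> A mA _; apply: lebesgue_measure_unique => // _ [[x y]] _ <-.
  rewrite /nu /mu/= /mscale/= /pushforward/=.
  rewrite (_ : _ @^-1` _ = `](x - a) / r, (y - a) / r]%classic); last first.
    apply/seteqP; split => t/=; rewrite /phi !in_itv/= ltr_pdivrMr// ler_pdivlMr//;
    by move=> /andP[? ?]; apply/andP; split; lra.
  rewrite !lebesgue_measure_itv/= !lte_fin ltr_pM2r ?invr_gt0// ltrD2r.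
  case: ifP => _; last by rewrite mule0.
  by rewrite -!EFinB -EFinM; congr EFin; field; rewrite gt_eqF.
rewrite ge0_integral_mscale// ge0_integral_pushforward//.
exact: measurable_affine1.
Qed.

Local Notation leb n := (lebesgue_rV R n).

Lemma ge0_integral_rVS n (f : 'rV[R]_n.+1 -> \bar R) : measurable_fun setT f ->
  (forall x, 0 <= f x)%E ->
  (\int[leb n.+1]_x f x = \int[lam]_t \int[leb n]_y f (rV_cons (t, y)))%E.
Proof.
move=> mf f0; rewrite -[LHS]/(\int[pushforward (lam \x leb n)%E (@rV_cons R n)]_x f x)%E.
rewrite ge0_integral_pushforward//; last exact: measurable_rV_cons.
rewrite preimage_setT fubini_tonelli1//.
- exact: measurableT_comp mf (@measurable_rV_cons R n).
- by move=> x; exact: f0.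
Qed.

Lemma measurable_affine n (a : 'rV[R]_n) (r : R) :
  measurable_fun setT (fun x : 'rV[R]_n => a + r *: x).
Proof.
apply: measurable_fun_rVP => i.
rewrite (_ : _ \o _ = fun x => a ord0 i + r * rV_coord i x); last first.
  by apply/funext => x /=; rewrite /rV_coord !mxE.
apply: measurable_funD; first exact: measurable_cst.
by apply: measurable_funM; [exact: measurable_cst|exact: measurable_rV_coord].
Qed.

Lemma ge0_integral_affine n (a : 'rV[R]_n) (r : R) (f : 'rV[R]_n -> \bar R) :
  0 < r -> measurable_fun setT f -> (forall x, 0 <= f x)%E ->
  (\int[leb n]_x f x = (r ^+ n)%:E * \int[leb n]_x f (a + r *: x)%R)%E.
Proof.
elim: n a f => [|n ih] a f r0 mf f0.
  rewrite expr0 mul1e; apply: eq_integral => x _; congr f.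
  by apply/rowP => -[].
have mfc t : measurable_fun setT (fun y => f (rV_cons (t, y))).
  apply: measurableT_comp mf _; apply: measurableT_comp (@measurable_rV_cons R n) _.
  exact: pair1_measurable.
have mfp : measurable_fun setT (f \o @rV_cons R n).
  exact: measurableT_comp mf (@measurable_rV_cons R n).
rewrite ge0_integral_rVS// (@ge0_integral_affine1 (a ord0 ord0) r)//; last 2 first.
  apply: (measurable_fun_fubini_tonelli_F (f \o @rV_cons R n)) => //.
  by move=> x; exact: f0.
  by move=> t; exact: integral_ge0.
pose a' := (rV_uncons a).2.
under eq_integral => t _ do rewrite (ih a')//.
rewrite ge0_integralZl//; last 3 first.
- apply: (@measurable_fun_fubini_tonelli_F _ _ (measurableTypeR R) _ R (leb n)
    (fun p => f (rV_cons (a ord0 ord0 + r * p.1, a' + r *: p.2)))) => //.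
  apply: (measurableT_comp mfp); apply: measurable_fun_pair.
    exact: (measurableT_comp (measurable_affine1 (a ord0 ord0) r) measurable_fst).
  exact: measurableT_comp (measurable_affine _ _) measurable_snd.
- by move=> t _; exact: integral_ge0.
- by rewrite lee_fin exprn_ge0// ltW.
have mfa : measurable_fun setT (fun x : 'rV[R]_n.+1 => f (a + r *: x)).
  exact: measurableT_comp (measurable_affine _ _).
rewrite [in RHS](ge0_integral_rVS mfa); last by move=> x; exact: f0.
rewrite muleA -EFinM -exprS.
congr (_ * integral _ _ _)%E; apply/funext => t.
apply: eq_integral => y _.
congr f; apply/rowP => i; rewrite !mxE.
by case: unliftP => [j ->|->]//=; rewrite !mxE.
Qed.

Lemma Rintegral_affine n (a : 'rV[R]_n) (r : R) (f : 'rV[R]_n -> R) (D : set 'rV[R]_n) :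
  0 < r -> measurable D -> measurable_fun setT f ->
  \int[leb n]_(x in D) f x =
  r ^+ n * \int[leb n]_(x in [set x | D (a + r *: x)]) f (a + r *: x).
Proof.
move=> r0 mD mf; rewrite Rintegral_mkcond [in RHS]Rintegral_mkcond /Rintegral.
have mfD : measurable_fun setT (EFin \o (f \_ D)).
  by apply/measurable_EFinP; rewrite -measurable_restrictT//; exact: measurable_funTS.
rewrite [in LHS]integralE [in RHS]integralE.
rewrite (ge0_integral_affine a r0)//; last exact: measurable_funepos.
rewrite [X in (_ - X)%E](ge0_integral_affine a r0)//; last exact: measurable_funeneg.
(* Integrability is not assumed, so infinite values must be covered: a positive factor preserves
   them, and [fine] sends them to 0 on both sides. *)
have fineZB k (u v : \bar R) : 0 < k -> fine (k%:E * u - k%:E * v) = k * fine (u - v).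
  move=> k0; have ky : (k%:E * +oo = +oo)%E by rewrite mulry gtr0_sg// mul1e.
  have kNy : (k%:E * -oo = -oo)%E by rewrite mulrNy gtr0_sg// mul1e.
  case: u v => [u| |] [v| |]; rewrite ?ky ?kNy; last 8 first.
  1-8: exact/esym/mulr0.
  by rewrite -!EFinM -!EFinB /= mulrBr.
rewrite fineZB ?exprn_gt0//.
have patchA x : (f \_ D) (a + r *: x) = ((fun x => f (a + r *: x)) \_ [set x | D (a + r *: x)]) x.
  by rewrite !patchE; congr (if _ then _ else _); apply/idP/idP; rewrite !inE.
congr (_ * fine (_ - _)); apply: eq_integral => x _.
  by rewrite !funeposE patchA.
by rewrite !funenegE patchA.
Qed.

End affine_change_of_variables.

Section lebesgue_balls.
Context {R : realType} {n : nat}.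
Local Notation leb := (lebesgue_rV R n).
Implicit Types (x y : 'rV[R]_n) (s r : R).

Lemma measurable_rV_box (A : 'I_n -> set R) : (forall i, measurable (A i)) ->
  measurable [set y : 'rV[R]_n | forall i, A i (y ord0 i)].
Proof.
move=> mA; rewrite (_ : mkset _ = \big[setI/setT]_(i < n) (rV_coord i @^-1` A i)).
  apply: bigsetI_measurable => i _; rewrite -[X in measurable X]setTI.
  exact: measurable_rV_coord.
apply/seteqP; split => [y Ay|y]; rewrite -bigcap_seq/=.
  by move=> i _; exact: Ay.
by move=> Ay i; apply: Ay => /=; rewrite mem_index_enum.
Qed.

Definition ball_volume : R := fine (leb (eball 0 1)).

Lemma measurable_eball x s : measurable (eball x s).
Proof. by apply: open_measurable_rV; exact: eball_open. Qed.

Lemma lebesgue_eball_lty x s : (leb (eball x s) < +oo)%E.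
Proof.
pose A i : set R := `](x ord0 i - s), (x ord0 i + s)[%classic.
have mA : measurable [set y : 'rV[R]_n | forall i, A i (y ord0 i)].
  by apply: measurable_rV_box => i; exact: measurable_itv.
apply: (@le_lt_trans _ _ (leb [set y | forall i, A i (y ord0 i)])).
  apply: le_measure; rewrite ?inE//; first exact: measurable_eball.
  move=> y; rewrite /eball/= => yx i; rewrite /A/= in_itv/=.
  have := le_lt_trans (enorm_coord (y - x) i) yx.
  by rewrite !mxE ltr_norml => /andP[? ?]; apply/andP; split; lra.
rewrite lebesgue_rV_box; last by move=> i; exact: measurable_itv.
suff [c ->] : exists c : R, (\prod_(i < n) lebesgue_measure (A i))%E = c%:E by rewrite ltry.
elim/big_ind : _ => [|_ _ [c ->] [c' ->]|i _]; first by exists 1.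
  by exists (c * c').
rewrite /A lebesgue_measure_itv/=; case: ifP => _; last by exists 0.
by rewrite -EFinB; eexists.
Qed.

Lemma preimage_eball_affine x s r : 0 < s ->
  [set y | eball x r (x + s *: y)] = eball 0 (r / s).
Proof.
move=> s0; rewrite /eball; apply/eq_set => y.
by rewrite /= subr0 addrAC subrr add0r enormZ ?ltW// ltr_pdivlMr// mulrC.
Qed.

Lemma lebesgue_eball x s : 0 < s -> leb (eball x s) = (s ^+ n * ball_volume)%:E.
Proof.
move=> s0; rewrite -[LHS]fineK ?ge0_fin_numE ?lebesgue_eball_lty//; congr EFin.
rewrite -[LHS]mul1r -Rintegral_cst; last exact: measurable_eball.
rewrite (@Rintegral_affine _ _ x s (cst 1))//; last exact: measurable_eball.
rewrite preimage_eball_affine// divff ?gt_eqF//= Rintegral_cst ?mul1r//.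
exact: measurable_eball.
Qed.

Lemma ball_volume_gt0 : 0 < ball_volume.
Proof.
(* The cube of half side [1 / (n + 1)] lies in the unit ball, because [enorm] is at most [n] times
   the sup norm. *)
pose e : R := (n.+1%:R)^-1; have e0 : 0 < e by rewrite invr_gt0.
pose A (i : 'I_n) : set R := `](- e), e[%classic.
have AB : [set y : 'rV[R]_n | forall i, A i (y ord0 i)] `<=` eball 0 1.
  move=> y Ay; rewrite /eball/= subr0 (le_lt_trans (enorm_le_norm _))//.
  apply: (@le_lt_trans _ _ (n%:R * e)).
    rewrite ler_wpM2l// [leLHS]/Num.norm/= mx_normrE.
    apply: bigmax_le => [|[i j] _]; first exact: ltW.
    by rewrite ord1/= ler_norml; have := Ay j; rewrite /A/= in_itv/= => /andP[/ltW-> /ltW->].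
  by rewrite /e ltr_pdivrMr// mul1r ltr_nat.
have mA : measurable [set y : 'rV[R]_n | forall i, A i (y ord0 i)].
  by apply: measurable_rV_box => i; exact: measurable_itv.
rewrite fine_gt0// lebesgue_eball_lty andbT.
apply: (@lt_le_trans _ _ (leb [set y | forall i, A i (y ord0 i)])); last first.
  by apply: le_measure; rewrite ?inE//; exact: measurable_eball.
rewrite lebesgue_rV_box; last by move=> i; exact: measurable_itv.
elim/big_ind : _ => //; first by move=> u v; exact: mule_gt0.
move=> i _; rewrite /A lebesgue_measure_itv/= lte_fin gtrN//.
by rewrite -EFinB lte_fin opprK addr_gt0.
Qed.

Lemma measurable_sphere x s : measurable [set y | enorm (y - x) = s].
Proof.
rewrite -[mkset _]setCK; apply: measurableC; apply: open_measurable_rV.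
apply: closed_openC; apply: (@closed_comp _ _ (fun y => enorm (y - x)) [set r | r = s]).
  by move=> y _; exact: enorm_sub_continuous.
exact: closed_eq.
Qed.

(** The sphere lies in the ball of radius [s + d] and misses that of radius [s]; the difference of
    the two volumes tends to 0 with [d]. [0 < n] excludes the single point of R^0, a sphere of
    radius 0 and mass 1. *)
Lemma lebesgue_sphere x s : (0 < n)%N -> leb [set y | enorm (y - x) = s] = 0.
Proof.
move=> n0; set S := [set y | _].
have mS : measurable S by exact: measurable_sphere.
have [s0|s0] := ltP s 0.
  rewrite (_ : S = set0) ?measure0//; apply/seteqP; split => // y; rewrite /S/= => ys.
  by have := enorm_ge0 (y - x); rewrite ys leNgt s0.
have Sle d : 0 < d -> (leb S <= (((s + d) ^+ n - s ^+ n) * ball_volume)%:E)%E.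
  move=> d0; have sd0 : 0 < s + d by rewrite ltr_wpDl.
  have S0 : leb (eball x s) = (s ^+ n * ball_volume)%:E.
    move: s0; rewrite le_eqVlt => /predU1P[<-|]; last exact: lebesgue_eball.
    by rewrite eball_le0// measure0 expr0n (gtn_eqF n0) mul0r.
  rewrite mulrBl EFinB -(lebesgue_eball x sd0) -S0 leeBrDr; last first.
    by rewrite S0.
  rewrite -measureU; [|exact: mS|exact: measurable_eball|].
    apply: le_measure; rewrite ?inE; [|exact: measurable_eball|].
      by apply: measurableU => //; exact: measurable_eball.
    move=> y []; rewrite /S /eball/= => ys; first by rewrite ys ltrDl.
    by rewrite (lt_trans ys)// ltrDl.
  by apply/seteqP; split => // y [ys]; rewrite /eball/= (ys : enorm (y - x) = s) ltxx.
apply/eqP; rewrite eq_le measure_ge0 andbT; apply/lee_addgt0Pr => e e0.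
rewrite add0e.
have /cvgrPdist_lt/(_ e e0) :
    ((s + d) ^+ n - s ^+ n) * ball_volume @[d --> 0^'+] --> ((s + 0) ^+ n - s ^+ n) * ball_volume.
  apply: cvg_at_right_filter; apply: cvgMl; apply: cvgB; last exact: cvg_cst.
  apply: (@continuous_comp _ _ _ (fun d => s + d) (fun d => d ^+ n)).
    by apply: cvgD; [exact: cvg_cst|exact: cvg_id].
  exact: exprn_continuous.
rewrite addr0 subrr mul0r => H.
have [d [d0 dH]] : exists d, 0 < d /\ `|0 - ((s + d) ^+ n - s ^+ n) * ball_volume| < e.
  by near (0:R)^'+ => d; exists d; split; near: d; [exact: nbhs_right_gt|exact: H].
rewrite (le_trans (Sle d d0))// lee_fin (le_trans (ler_norm _))//.
by rewrite -normrN -sub0r ltW.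
Unshelve. all: by end_near. Qed.

Lemma ball_avgE s (g : 'rV[R]_n -> R) x : 0 < s ->
  ball_avg s g x = (s ^+ n * ball_volume)^-1 * \int[leb]_(y in eball x s) g y.
Proof. by move=> s0; rewrite /ball_avg lebesgue_eball. Qed.

Lemma ball_avg_scale s (g : 'rV[R]_n -> R) x : 0 < s -> measurable_fun setT g ->
  ball_avg s g x = ball_volume^-1 * \int[leb]_(y in eball 0 1) g (x + s *: y).
Proof.
move=> s0 mg; rewrite ball_avgE// (Rintegral_affine x s0)//; last first.
  exact: measurable_eball.
rewrite preimage_eball_affine// divff ?gt_eqF// invfM mulrA; congr (_ * _).
by rewrite mulrAC mulVf ?mul1r// expf_neq0// gt_eqF.
Qed.

End lebesgue_balls.
Arguments ball_volume : clear implicits.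

(** * Ball averages *)

Section ball_averages.
Context {R : realType} {n : nat}.
Local Notation leb := (lebesgue_rV R n).
Implicit Types (x y : 'rV[R]_n) (s t : R) (g h : 'rV[R]_n -> R).

Lemma measurable_enorm : measurable_fun setT (@enorm R n).
Proof.
apply: (measurableT_comp (continuous_measurable_fun (@sqrt_continuous R))
  (g := fun x : 'rV[R]_n => \sum_i x ord0 i ^+ 2)).
apply: measurable_sum => i; apply: measurable_funX.
exact: measurable_rV_coord.
Qed.

Lemma measurable_rVD d (T : measurableType d) (a b : T -> 'rV[R]_n) :
  measurable_fun setT a -> measurable_fun setT b ->
  measurable_fun setT (fun z => a z + b z).
Proof.
move=> ma mb; apply: measurable_fun_rVP => i.
rewrite (_ : _ \o _ = fun z => rV_coord i (a z) + rV_coord i (b z)); last first.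
  by apply/funext => z; rewrite /rV_coord /= mxE.
by apply: measurable_funD; apply: measurableT_comp => //; exact: measurable_rV_coord.
Qed.

Lemma measurable_rVN d (T : measurableType d) (a : T -> 'rV[R]_n) :
  measurable_fun setT a -> measurable_fun setT (fun z => - a z).
Proof.
move=> ma; apply: measurable_fun_rVP => i.
rewrite (_ : _ \o _ = fun z => - rV_coord i (a z)); last first.
  by apply/funext => z; rewrite /rV_coord /= mxE.
by apply: measurableT_comp => //; apply: measurableT_comp => //; exact: measurable_rV_coord.
Qed.

(** Radius and integrand both depend on a parameter: this serves [kavg], whose parameter is the
    radius, and [multi_avg], whose parameter is the vector of radii. *)
Lemma measurable_ball_avg d (T : measurableType d) (s : T -> R)
    (h : T * 'rV[R]_n -> R) : measurable_fun setT s -> measurable_fun setT h ->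
  measurable_fun setT (fun p : T * 'rV[R]_n => ball_avg (s p.1) (fun y => h (p.1, y)) p.2).
Proof.
move=> ms mh.
pose D : set ((T * 'rV[R]_n) * 'rV[R]_n) := [set q | enorm (q.2 - q.1.2) < s q.1.1].
have mD : measurable D.
  rewrite -[D]setTI; apply: measurable_fun_ltr => //.
    apply: measurableT_comp; first exact: measurable_enorm.
    apply: measurable_rVD; first exact: measurable_snd.
    by apply: measurable_rVN; exact: measurableT_comp measurable_snd measurable_fst.
  by apply: measurableT_comp => //; exact: measurableT_comp measurable_fst measurable_fst.
apply: measurable_funM; last first.
  apply: (measurable_fun_Rintegral leb mD (F := fun q => h (q.1.1, q.2))).
  apply: measurableT_comp mh _; apply: measurable_fun_pair; last exact: measurable_snd.
  exact: measurableT_comp measurable_fst measurable_fst.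
(* The volume is the integral of 1 over a section of [D], and its inverse is the power [-1], so
   [measurable_powR] applies. *)
have -> : (fun p : T * 'rV[R]_n => (fine (leb (eball p.2 (s p.1))))^-1) =
    (fun p => (\int[leb]_(y in [set y | D (p, y)]) 1) `^ (-1)).
  apply/funext => p; rewrite Rintegral_cst ?mul1r; last first.
    exact: (measurable_eball p.2 (s p.1)).
  by rewrite powR_inv1// fine_ge0.
apply: (measurableT_comp (measurable_powR _)).
by apply: (measurable_fun_Rintegral leb mD (F := fun q => 1)).
Qed.

Lemma measurable_ball_avg_fix s g : measurable_fun setT g ->
  measurable_fun setT (ball_avg s g).
Proof.
move=> mg.
have mp : measurable_fun setT (fun x : 'rV[R]_n => (0 : R, x)).
  exact: measurable_fun_pair.
apply: (measurableT_comp (@measurable_ball_avg _ R (fun=> s) (fun p => g p.2) _ _) mp).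
  exact: measurable_cst.
exact: measurableT_comp mg measurable_snd.
Qed.

(** By convention an average over the empty ball is 0, not the value at the centre. Radius 0 does
    occur in the cube, but [kern] vanishes there. *)
Lemma ball_avg_le0 s g x : s <= 0 -> ball_avg s g x = 0.
Proof. by move=> s0; rewrite /ball_avg eball_le0// Rintegral_set0 mulr0. Qed.

Lemma eq_ball_avg s g h x : (forall y, enorm (y - x) < s -> g y = h y) ->
  ball_avg s g x = ball_avg s h x.
Proof.
move=> gh; rewrite /ball_avg; congr (_ * _); apply: eq_Rintegral => y.
by rewrite inE => /gh.
Qed.

Lemma ball_integrable s g x M : measurable_fun setT g ->
  (forall y, enorm (y - x) < s -> `|g y| <= M) ->
  leb.-integrable (eball x s) (EFin \o g).
Proof.
move=> mg gM; apply: (bounded_Rintegrable (M := M)) => //.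
- exact: measurable_eball.
- exact: lebesgue_eball_lty.
- exact: measurable_funTS.
Qed.

Lemma ball_avg_bound s g x M : 0 <= M -> measurable_fun setT g ->
  (forall y, enorm (y - x) < s -> `|g y| <= M) -> `|ball_avg s g x| <= M.
Proof.
move=> M0 mg gM; have [s0|s0] := leP s 0; first by rewrite ball_avg_le0// normr0.
have V0 : 0 < s ^+ n * ball_volume R n by rewrite mulr_gt0 ?exprn_gt0 ?ball_volume_gt0.
rewrite ball_avgE// normrM gtr0_norm ?invr_gt0// mulrC ler_pdivrMr//.
rewrite (_ : s ^+ n * _ = fine (leb (eball x s))); last by rewrite lebesgue_eball.
apply: le_Rintegral_bound => //.
- exact: measurable_eball.
- exact: lebesgue_eball_lty.
- exact: measurable_funTS.
Qed.

Lemma ball_avg_cst s (c : R) x : 0 < s -> ball_avg s (cst c) x = c.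
Proof.
move=> s0; rewrite /ball_avg Rintegral_cst/=; last exact: measurable_eball.
rewrite lebesgue_eball//= mulrCA mulVf ?mulr1// gt_eqF//.
by rewrite mulr_gt0 ?exprn_gt0 ?ball_volume_gt0.
Qed.

Lemma ball_avgB s g h x M : measurable_fun setT g -> measurable_fun setT h ->
  (forall y, enorm (y - x) < s -> `|g y| <= M) ->
  (forall y, enorm (y - x) < s -> `|h y| <= M) ->
  ball_avg s (fun y => g y - h y) x = ball_avg s g x - ball_avg s h x.
Proof.
move=> mg mh gM hM; rewrite /ball_avg RintegralB ?mulrBr//.
- exact: measurable_eball.
- exact: ball_integrable gM.
- exact: ball_integrable hM.
Qed.

Lemma ball_avgZ s (c : R) g x M : measurable_fun setT g ->
  (forall y, enorm (y - x) < s -> `|g y| <= M) ->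
  ball_avg s (fun y => c * g y) x = c * ball_avg s g x.
Proof.
move=> mg gM; rewrite /ball_avg RintegralZl; first exact: mulrCA.
  exact: measurable_eball.
exact: ball_integrable gM.
Qed.

Lemma ball_avg_Rintegral d (T : measurableType d)
    (mu : {sigma_finite_measure set T -> \bar R}) (D : set T)
    (H : T * 'rV[R]_n -> R) M s x : measurable D -> (mu D < +oo)%E ->
  measurable_fun setT H -> (forall z y, D z -> `|H (z, y)| <= M) ->
  ball_avg s (fun y => \int[mu]_(z in D) H (z, y)) x =
  \int[mu]_(z in D) ball_avg s (fun y => H (z, y)) x.
Proof.
move=> mD Doo mH HM; rewrite /ball_avg RintegralZl//.
  congr (_ * _).
  pose F (p : 'rV[R]_n * T) := H (p.2, p.1).
  apply: (Rintegral_swap (F := F) (M := M)) => //.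
  - exact: measurable_eball.
  - exact: lebesgue_eball_lty.
  - apply: measurableT_comp mH _; apply: measurable_fun_pair.
      exact: measurable_snd.
    exact: measurable_fst.
  - by move=> y t _ Dt; exact: HM.
pose D' : set (T * 'rV[R]_n) := [set p | eball x s p.2].
have mD' : measurable D'.
  by rewrite -[D']setTI; apply: measurable_snd => //; exact: measurable_eball.
apply: (bounded_Rintegrable (M := M * fine (leb (eball x s)))) => //.
  exact/measurable_funTS/(measurable_fun_Rintegral leb mD').
move=> t Dt; apply: le_Rintegral_bound.
- exact: measurable_eball.
- exact: lebesgue_eball_lty.
- apply: measurable_funTS; apply: measurableT_comp mH _.
  exact: pair1_measurable.
- by move=> y _; exact: HM.
Qed.

(** For positive radii both sides are the double average of [g (x + s y + t z)] over two unit balls,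
    and the order of integration can be exchanged. *)
Lemma ball_avgC s t g x M : measurable_fun setT g -> (forall y, `|g y| <= M) ->
  ball_avg s (ball_avg t g) x = ball_avg t (ball_avg s g) x.
Proof.
move=> mg gM.
have ball_avg0 r : ball_avg r (cst 0) x = 0.
  rewrite /ball_avg Rintegral_cst ?mul0r ?mulr0//; exact: measurable_eball.
have [s0|s0] := leP s 0.
  rewrite ball_avg_le0// (_ : ball_avg s g = cst 0) ?ball_avg0//.
  by apply/funext => y; rewrite ball_avg_le0.
have [t0|t0] := leP t 0.
  rewrite [RHS]ball_avg_le0// (_ : ball_avg t g = cst 0) ?ball_avg0//.
  by apply/funext => y; rewrite ball_avg_le0.
have mb r : measurable_fun setT (ball_avg r g) by exact: measurable_ball_avg_fix.
have E r : 0 < r -> ball_avg r g =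
    fun y => (ball_volume R n)^-1 * \int[leb]_(z in eball 0 1) g (y + r *: z).
  by move=> r0; apply/funext => y; exact: ball_avg_scale.
rewrite (ball_avg_scale x s0 (mb t)) (ball_avg_scale x t0 (mb s)) (E t t0) (E s s0).
pose H (p : 'rV[R]_n * 'rV[R]_n) := g (x + s *: p.1 + t *: p.2).
have mH : measurable_fun setT H.
  apply: measurableT_comp mg _; apply: measurable_rVD.
    exact: measurableT_comp (measurable_affine x s) measurable_fst.
  rewrite (_ : (fun _ => _) = (fun v => 0 + t *: v) \o snd); last first.
    by apply/funext => p /=; rewrite add0r.
  exact: measurableT_comp (measurable_affine 0 t) measurable_snd.
have mB := @measurable_eball R n 0 1; have Boo := @lebesgue_eball_lty R n 0 1.
rewrite [in LHS]RintegralZl; [|exact: mB|]; last first.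
  have mD : measurable [set p : 'rV[R]_n * 'rV[R]_n | eball 0 1 p.2].
    by rewrite -[X in measurable X]setTI; apply: measurable_snd.
  apply: (bounded_Rintegrable (M := M * fine (leb (eball 0 1)))) => //.
    by apply: measurable_funTS; have := measurable_fun_Rintegral leb mD mH.
  move=> y _; apply: le_Rintegral_bound => //.
  apply: measurable_funTS.
  exact: (measurableT_comp mg (measurable_affine (x + s *: y) t)).
rewrite [in RHS]RintegralZl; [|exact: mB|]; last first.
  have mD : measurable [set p : 'rV[R]_n * 'rV[R]_n | eball 0 1 p.2].
    by rewrite -[X in measurable X]setTI; apply: measurable_snd.
  apply: (bounded_Rintegrable (M := M * fine (leb (eball 0 1)))) => //.
    have mG : measurable_fun setT (fun p : 'rV[R]_n * 'rV[R]_n => g (x + t *: p.1 + s *: p.2)).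
      rewrite (_ : (fun _ => _) = H \o (fun p => (p.2, p.1))); last first.
        by apply/funext => p; rewrite /H/= addrAC.
      apply: measurableT_comp mH _; apply: measurable_fun_pair.
        exact: measurable_snd.
      exact: measurable_fst.
    by apply: measurable_funTS; have := measurable_fun_Rintegral leb mD mG.
  move=> y _; apply: le_Rintegral_bound => //.
  apply: measurable_funTS.
  exact: (measurableT_comp mg (measurable_affine (x + t *: y) s)).
have swap := Rintegral_swap mB mB Boo Boo mH (fun _ _ _ _ => gM _).
apply: (congr1 (fun r => (ball_volume R n)^-1 * ((ball_volume R n)^-1 * r))).
apply: (etrans swap); apply: eq_Rintegral => z _; apply: eq_Rintegral => y _.
by rewrite /H/= addrAC.
Qed.

End ball_averages.

(** * The kernel average *)

Section kernel_average.
Context {R : realType} {n : nat}.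
Local Notation leb := (lebesgue_rV R n).
Local Notation lam := (@lebesgue_measure R).
Variable eps : R.
Hypothesis eps_gt0 : 0 < eps.
Implicit Types (x y : 'rV[R]_n) (s t : R) (g h : 'rV[R]_n -> R).

Lemma measurable_kern : measurable_fun setT (kern n eps).
Proof.
apply: measurable_funM; first exact: measurable_funM.
apply: measurable_funB; first exact: measurable_cst.
by apply: measurable_funX; exact: measurable_funM.
Qed.

Lemma kern_ge0 t : 0 <= t <= eps -> 0 <= kern n eps t.
Proof.
move=> /andP[t0 te]; rewrite /kern mulr_ge0 ?divr_ge0// subr_ge0.
by rewrite exprn_ile1 ?divr_ge0 ?(ltW eps_gt0)// ler_pdivrMr// mul1r.
Qed.

Lemma kern_le t : 0 <= t <= eps -> kern n eps t <= eps.
Proof.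
move=> /andP[t0 te]; rewrite -[leRHS]mulr1 /kern ler_pM//.
- by rewrite divr_ge0.
- rewrite subr_ge0 exprn_ile1 ?divr_ge0 ?(ltW eps_gt0)//.
  by rewrite ler_pdivrMr// mul1r.
- rewrite (le_trans _ te)//; case: (n) => [|k]; first by rewrite invr0 mulr0.
  by rewrite ler_pdivrMr// ler_peMr// ler1n.
- by rewrite gerBl exprn_ge0// divr_ge0// ltW.
Qed.

Lemma kern_norm t : 0 <= t <= eps -> `|kern n eps t| <= eps.
Proof. by move=> te; rewrite ger0_norm ?kern_ge0// kern_le. Qed.

(** The operator [J] of the overview. *)
Definition kavg g x : R :=
  \int[lam]_(t in `[0, eps]) (kern n eps t * ball_avg t g x).

Let mI : measurable (`[0, eps]%classic : set (measurableTypeR R)).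
Proof. exact: measurable_itv. Qed.

Let Ioo : (lam `[0%R, eps]%classic < +oo)%E.
Proof. by rewrite lebesgue_measure_itv/= lte_fin eps_gt0 -EFinB ltry. Qed.

Let fineI : fine (lam `[0%R, eps]%classic) = eps.
Proof. by rewrite lebesgue_measure_itv/= lte_fin eps_gt0 -EFinB/= subr0. Qed.

Let H g (p : measurableTypeR R * 'rV[R]_n) := kern n eps p.1 * ball_avg p.1 g p.2.

Let mH g : measurable_fun setT g -> measurable_fun setT (H g).
Proof.
move=> mg; apply: measurable_funM.
  exact: measurableT_comp measurable_kern measurable_fst.
apply: (@measurable_ball_avg _ _ _ (measurableTypeR R) id (fun p => g p.2)) => //.
exact: measurableT_comp mg measurable_snd.
Qed.

Lemma measurable_kavg g : measurable_fun setT g -> measurable_fun setT (kavg g).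
Proof.
move=> mg; pose D : set ('rV[R]_n * measurableTypeR R) := [set p | `[0, eps]%classic p.2].
have mD : measurable D by rewrite -[D]setTI; exact: measurable_snd.
have mH' : measurable_fun setT (fun p : 'rV[R]_n * measurableTypeR R => H g (p.2, p.1)).
  apply: measurableT_comp (mH mg) _; apply: measurable_fun_pair.
    exact: measurable_snd.
  exact: measurable_fst.
by have := measurable_fun_Rintegral lam mD mH'.
Qed.

Lemma measurable_kern_ball_avg g x : measurable_fun setT g ->
  measurable_fun setT (fun t : measurableTypeR R => kern n eps t * ball_avg t g x).
Proof.
move=> mg; rewrite (_ : (fun _ => _) = H g \o (fun t => (t, x)))//.
by apply: measurableT_comp (mH mg) _; exact: pair2_measurable.
Qed.

Lemma kern_ball_avg_bound g x M t : 0 <= M -> measurable_fun setT g ->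
  (forall y, enorm (y - x) < eps -> `|g y| <= M) -> 0 <= t <= eps ->
  `|kern n eps t * ball_avg t g x| <= eps * M.
Proof.
move=> M0 mg gM te; rewrite normrM ler_pM// ?kern_norm// ball_avg_bound// => y yx.
by apply: gM; rewrite (lt_le_trans yx)//; case/andP: te.
Qed.

Lemma kern_ball_avg_integrable g x M : 0 <= M -> measurable_fun setT g ->
  (forall y, enorm (y - x) < eps -> `|g y| <= M) ->
  lam.-integrable `[0, eps] (EFin \o (fun t => kern n eps t * ball_avg t g x)).
Proof.
move=> M0 mg gM; apply: (bounded_Rintegrable (M := eps * M)) => //.
  by apply: measurable_funTS; exact: measurable_kern_ball_avg.
by move=> t; rewrite /= in_itv/=; exact: kern_ball_avg_bound.
Qed.

Lemma kavg_bound g x M : 0 <= M -> measurable_fun setT g ->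
  (forall y, enorm (y - x) < eps -> `|g y| <= M) -> `|kavg g x| <= eps * M * eps.
Proof.
move=> M0 mg gM; rewrite -[X in _ * X]fineI; apply: le_Rintegral_bound => //.
  by apply: measurable_funTS; exact: measurable_kern_ball_avg.
by move=> t; rewrite /= in_itv/=; exact: kern_ball_avg_bound.
Qed.

Lemma eq_kavg g h x : (forall y, enorm (y - x) < eps -> g y = h y) ->
  kavg g x = kavg h x.
Proof.
move=> gh; apply: eq_Rintegral => t; rewrite inE/= in_itv/= => /andP[_ te].
by congr (_ * _); apply: eq_ball_avg => y yx; apply: gh; exact: lt_le_trans te.
Qed.

Lemma kavgB g h x M : 0 <= M -> measurable_fun setT g -> measurable_fun setT h ->
  (forall y, enorm (y - x) < eps -> `|g y| <= M) ->
  (forall y, enorm (y - x) < eps -> `|h y| <= M) ->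
  kavg (fun y => g y - h y) x = kavg g x - kavg h x.
Proof.
move=> M0 mg mh gM hM; rewrite /kavg -RintegralB//; last 2 first.
- exact: kern_ball_avg_integrable gM.
- exact: kern_ball_avg_integrable hM.
apply: eq_Rintegral => t; rewrite inE/= in_itv/= => /andP[_ te].
by rewrite (@ball_avgB _ _ _ _ _ _ M) ?mulrBr// => y yx;
  [apply: gM|apply: hM]; exact: lt_le_trans te.
Qed.

Lemma ball_avg_kavg s g x M : measurable_fun setT g -> (forall y, `|g y| <= M) ->
  ball_avg s (kavg g) x = kavg (ball_avg s g) x.
Proof.
move=> mg gM; have M0 : 0 <= M by exact: le_trans (normr_ge0 _) (gM 0).
rewrite (@ball_avg_Rintegral _ _ _ (measurableTypeR R) lam _ (H g) (eps * M))//.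
- apply: eq_Rintegral => t _; rewrite /H/=.
  rewrite (@ball_avgZ _ _ _ _ _ _ M); last 2 first.
  + exact: measurable_ball_avg_fix.
  + by move=> y _; exact: ball_avg_bound.
  by apply: (congr1 (GRing.mul _)); apply: ball_avgC mg gM.
- exact: mH.
- move=> t y; rewrite /= in_itv/=; exact: kern_ball_avg_bound.
Qed.

End kernel_average.

(** * Iterated averages over the cube *)

Section cube_integral.
Context {R : realType}.
Local Notation leb n := (lebesgue_rV R n).
Local Notation lam := (@lebesgue_measure R).
Variable eps : R.
Hypothesis eps_gt0 : 0 < eps.

Lemma entries_rV_cons m t (r : 'rV[R]_m) : entries (rV_cons (t, r)) = t :: entries r.
Proof.
rewrite /entries enum_ordSl/= mxE unlift_none -map_comp; congr cons.
by apply: eq_map => i /=; rewrite mxE liftK.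
Qed.

Lemma rV_unconsK m : cancel (@rV_uncons R m) (@rV_cons R m).
Proof.
by move=> r; apply/rowP => i; rewrite !mxE; case: unliftP => [j ->|->]//=; rewrite mxE.
Qed.

Lemma multi_avg_cons n m t (r : 'rV[R]_m) (g : 'rV[R]_n -> R) :
  multi_avg (rV_cons (t, r)) g = ball_avg t (multi_avg r g).
Proof. by rewrite /multi_avg entries_rV_cons. Qed.

Lemma measurable_multi_avg n m (g : 'rV[R]_n -> R) : measurable_fun setT g ->
  measurable_fun setT (fun p : 'rV[R]_m * 'rV[R]_n => multi_avg p.1 g p.2).
Proof.
move=> mg; elim: m => [|m ih].
  rewrite (_ : (fun _ => _) = fun p : 'rV[R]_0 * 'rV[R]_n => g p.2); last first.
    by apply/funext => p; rewrite /multi_avg /entries enum_ord0.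
  exact: measurableT_comp mg measurable_snd.
pose h (p : 'rV[R]_m.+1 * 'rV[R]_n) := multi_avg (rV_uncons p.1).2 g p.2.
have mh : measurable_fun setT h.
  rewrite (_ : h = (fun p : 'rV[R]_m * 'rV[R]_n => multi_avg p.1 g p.2) \o
      (fun p : 'rV[R]_m.+1 * 'rV[R]_n => ((rV_uncons p.1).2, p.2)))//.
  apply: measurableT_comp ih _; apply: measurable_fun_pair; last exact: measurable_snd.
  apply: measurableT_comp measurable_snd _.
  exact: measurableT_comp (@measurable_rV_uncons R m) measurable_fst.
have := measurable_ball_avg (@measurable_rV_coord R m.+1 ord0) mh.
congr measurable_fun; apply/funext => p.
by rewrite -[p.1 in RHS]rV_unconsK multi_avg_cons.
Qed.

Lemma measurable_multi_avg_fix n m (r : 'rV[R]_m) (g : 'rV[R]_n -> R) :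
  measurable_fun setT g -> measurable_fun setT (multi_avg r g).
Proof.
move=> mg; rewrite (_ : multi_avg r g =
  (fun p : 'rV[R]_m * 'rV[R]_n => multi_avg p.1 g p.2) \o pair r)//.
exact: (measurableT_comp (measurable_multi_avg mg) (pair1_measurable r)).
Qed.

Lemma multi_avg_bound n m (r : 'rV[R]_m) (g : 'rV[R]_n -> R) M x : 0 <= M ->
  measurable_fun setT g -> (forall y, `|g y| <= M) -> `|multi_avg r g x| <= M.
Proof.
move=> M0 mg gM; elim: m r x => [|m ih] r x.
  by rewrite /multi_avg /entries enum_ord0.
rewrite -[r]rV_unconsK [rV_uncons r]surjective_pairing multi_avg_cons.
by apply: ball_avg_bound => //; exact: measurable_multi_avg_fix.
Qed.

Lemma cube0 : cube 0 eps = setT.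
Proof. by apply/seteqP; split => // r _ []. Qed.

Lemma measurable_cube m : measurable (cube m eps).
Proof.
rewrite (_ : cube m eps = [set r | forall i, `[0, eps]%classic (r ord0 i)]).
  by apply: (@measurable_rV_box R m (fun=> `[0, eps]%classic)) => i; exact: measurable_itv.
by apply/seteqP; split => r /= H i; have := H i; rewrite in_itv.
Qed.

Lemma lebesgue_cube m : leb m (cube m eps) = (eps ^+ m)%:E.
Proof.
rewrite (_ : cube m eps = [set r | forall i, `[0, eps]%classic (r ord0 i)]).
  rewrite (@lebesgue_rV_box R m (fun=> `[0, eps]%classic)); last by move=> i; exact: measurable_itv.
  under eq_bigr do rewrite lebesgue_measure_itv/= lte_fin eps_gt0 oppr0 addr0.
  by rewrite prodEFin prodr_const card_ord.
by apply/seteqP; split => r /= H i; have := H i; rewrite in_itv.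
Qed.

Lemma preimage_cube m :
  @rV_cons R m @^-1` cube m.+1 eps = `[0, eps]%classic `*` cube m eps.
Proof.
apply/seteqP; split => [[t r]/= H|[t r]/= [H1 H2] i].
  split => [|i]; first by have := H ord0; rewrite mxE unlift_none in_itv.
  by have := H (lift ord0 i); rewrite mxE liftK.
case: (unliftP ord0 i) => [j ->|->]; by rewrite mxE ?liftK ?unlift_none.
Qed.

Lemma Rintegral_cubeS m (F : 'rV[R]_m.+1 -> R) M : measurable_fun setT F ->
  (forall r, cube m.+1 eps r -> `|F r| <= M) ->
  \int[leb m.+1]_(r in cube m.+1 eps) F r =
  \int[lam]_(t in `[0, eps]) \int[leb m]_(r in cube m eps) F (rV_cons (t, r)).
Proof.
move=> mF FM.
pose F' (p : measurableTypeR R * 'rV[R]_m) := F (rV_cons p).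
have mF' : measurable_fun setT F' by exact: measurableT_comp mF (@measurable_rV_cons R m).
have mI : measurable (`[0, eps]%classic : set (measurableTypeR R)) by exact: measurable_itv.
have Ioo : (lam `[0%R, eps]%classic < +oo)%E.
  by rewrite lebesgue_measure_itv/= lte_fin eps_gt0 -EFinB ltry.
have mC := @measurable_cube m.
have Coo : (leb m (cube m eps) < +oo)%E by rewrite lebesgue_cube ltry.
have F'M t r : `[0, eps]%classic t -> cube m eps r -> `|F' (t, r)| <= M.
  by move=> tI rC; apply: FM; have : (`[0, eps]%classic `*` cube m eps) (t, r) by []; rewrite -preimage_cube.
have := Rintegral_prod mI mC Ioo Coo mF' F'M; rewrite /F'/= => <-.
rewrite /Rintegral; apply: (congr1 fine).
(* By definition [leb m.+1] is the image of a product measure under [rV_cons]. *)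
rewrite -[LHS]/(\int[pushforward (lam \x leb m)%E (@rV_cons R m)]_(r in cube m.+1 eps) (EFin \o F) r)%E.
rewrite integral_pushforward//.
- by rewrite preimage_cube.
- exact: measurable_rV_cons.
- exact/measurable_EFinP.
- rewrite preimage_cube; exact: (bounded_integrable_prod mI mC Ioo Coo mF' F'M).
- exact: measurable_cube.
Qed.

Lemma measurable_prod_kern n m :
  measurable_fun setT (fun r : 'rV[R]_m => \prod_i kern n eps (r ord0 i)).
Proof.
apply: measurable_prod => i _.
exact: (measurableT_comp (@measurable_kern R n eps) (@measurable_rV_coord R m i)).
Qed.

Lemma prod_kern_bound n m (r : 'rV[R]_m) : cube m eps r ->
  `|\prod_i kern n eps (r ord0 i)| <= eps ^+ m.
Proof.
move=> rC; rewrite normr_prod -[in leRHS](card_ord m) -prodr_const.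
by apply: ler_prod => i _; rewrite normr_ge0 kern_norm.
Qed.

(** Induction on [m]: Fubini isolates the first radius, which belongs to the outermost average, and
    the integral over the other radii moves inside that average. *)
Lemma Rintegral_multi_avg n m (g : 'rV[R]_n -> R) M x : measurable_fun setT g ->
  (forall y, `|g y| <= M) ->
  \int[leb m]_(r in cube m eps) (multi_avg r g x * \prod_i kern n eps (r ord0 i))
  = iter m (kavg eps) g x.
Proof.
move=> mg gM; have M0 : 0 <= M by exact: le_trans (normr_ge0 _) (gM 0).
elim: m x => [|m ih] x.
  rewrite cube0 (@eq_Rintegral _ _ _ _ _ (cst (g x))); last first.
    by move=> r _; rewrite big_ord0 mulr1 /multi_avg /entries enum_ord0.
  transitivity (g x * fine (\d_(0 : 'rV[R]_0) [set: 'rV[R]_0])); first exact: Rintegral_cst.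
  by rewrite diracT mulr1.
pose F (r : 'rV[R]_m.+1) := multi_avg r g x * \prod_i kern n eps (r ord0 i).
have mF : measurable_fun setT F.
  apply: measurable_funM; last exact: measurable_prod_kern.
  exact: (measurableT_comp (@measurable_multi_avg n m.+1 g mg) (pair2_measurable x)).
have FM r : cube m.+1 eps r -> `|F r| <= M * eps ^+ m.+1.
  by move=> rC; rewrite normrM ler_pM ?multi_avg_bound ?prod_kern_bound.
rewrite (Rintegral_cubeS mF FM) iterS; apply: eq_Rintegral => t.
rewrite inE/= in_itv/= => tI.
pose G (p : 'rV[R]_m * 'rV[R]_n) :=
  multi_avg p.1 g p.2 * \prod_i kern n eps (p.1 ord0 i).
have mG : measurable_fun setT G.
  apply: measurable_funM; first exact: measurable_multi_avg.
  exact: (measurableT_comp (@measurable_prod_kern n m) measurable_fst).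
have GM r y : cube m eps r -> `|G (r, y)| <= M * eps ^+ m.
  by move=> rC; rewrite normrM ler_pM ?multi_avg_bound ?prod_kern_bound.
have mC := @measurable_cube m.
have Coo : (leb m (cube m eps) < +oo)%E by rewrite lebesgue_cube ltry.
have -> : iter m (kavg eps) g = fun y => \int[leb m]_(r in cube m eps) G (r, y).
  by apply/funext => y; rewrite -ih.
rewrite (ball_avg_Rintegral t x mC Coo mG GM) -RintegralZl//; last first.
  apply: (bounded_Rintegrable (M := M * eps ^+ m)) => //.
    apply: measurable_funTS.
    have mA := measurable_ball_avg (@measurable_cst _ _ 'rV[R]_m R setT t) mG.
    exact: (measurableT_comp mA (pair2_measurable x)).
  move=> r rC; apply: ball_avg_bound.
  - by rewrite mulr_ge0// exprn_ge0// ltW.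
  - exact: (measurableT_comp mG (pair1_measurable r)).
  - by move=> y _; exact: GM.
apply: eq_Rintegral => r _.
rewrite /F multi_avg_cons big_ord_recl mxE unlift_none mulrCA; congr (_ * _).
rewrite [LHS]mulrC (eq_bigr (fun i => kern n eps (r ord0 i))); last first.
  by move=> i _; rewrite mxE liftK.
rewrite -(@ball_avgZ _ _ _ _ _ _ M); last 2 first.
- exact: measurable_multi_avg_fix.
- by move=> y _; exact: multi_avg_bound.
by apply: eq_ball_avg => y _; rewrite mulrC.
Qed.

End cube_integral.

(** * Bounded Borel functions and the iteration of the one-step identity *)

Section bounded_measurable.
Context {R : realType} {n : nat}.
Local Notation leb := (lebesgue_rV R n).
Implicit Types (x y : 'rV[R]_n) (g h : 'rV[R]_n -> R).

(** The class in which all averaging takes place: it is stable under differences, ball averages and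
    [J], and Fubini applies to its members. *)
Definition bmeas g := measurable_fun setT g /\ exists M, forall x, `|g x| <= M.

Lemma bmeasB g h : bmeas g -> bmeas h -> bmeas (fun x => g x - h x).
Proof.
move=> [mg [M gM]] [mh [N hN]]; split; first exact: measurable_funB.
by exists (M + N) => x; rewrite (le_trans (ler_normB _ _))// lerD.
Qed.

Lemma bmeas_ball_avg s g : bmeas g -> bmeas (ball_avg s g).
Proof.
move=> [mg [M gM]]; split; first exact: measurable_ball_avg_fix.
have M0 : 0 <= M by exact: le_trans (normr_ge0 _) (gM 0).
by exists M => x; exact: ball_avg_bound.
Qed.

Lemma ball_avg_bmeasB s g h x : bmeas g -> bmeas h ->
  ball_avg s (fun y => g y - h y) x = ball_avg s g x - ball_avg s h x.
Proof.
move=> [mg [M gM]] [mh [N hN]]; apply: (ball_avgB (M := Num.max M N)) => // y _.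
  by rewrite le_max gM.
by rewrite le_max hN orbT.
Qed.

Lemma bmeas_avg_sub_pow s l g : bmeas g -> bmeas (avg_sub_pow s l g).
Proof.
move=> bg; elim: l => [//|l ih]; rewrite /avg_sub_pow iterS.
by apply: bmeasB => //; exact: bmeas_ball_avg.
Qed.

Lemma avg_sub_pow_bound s l g x (M : R) : 0 < s -> 0 <= M -> bmeas g ->
  (forall y, enorm (y - x) <= l%:R * s -> `|g y| <= M) ->
  `|avg_sub_pow s l g x| <= 2 ^+ l * M.
Proof.
move=> s0 M0 bg; elim: l x => [|l ih] x gM.
  by rewrite expr0 mul1r; apply: gM; rewrite subrr enorm0 mul0r.
rewrite /avg_sub_pow iterS -!/(avg_sub_pow _ _ _).
have ihb y : enorm (y - x) <= s -> `|avg_sub_pow s l g y| <= 2 ^+ l * M.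
  move=> yx; apply: ih => z zy; apply: gM; rewrite (le_trans (enorm_tri z y x))//.
  by rewrite -natr1 mulrDl mul1r lerD.
rewrite (le_trans (ler_normB _ _))// exprS -mulrA mulrDl !mul1r lerD//; last first.
  by apply: ihb; rewrite subrr enorm0 ltW.
apply: ball_avg_bound; first by rewrite mulr_ge0// exprn_ge0.
  by have [] := bmeas_avg_sub_pow s l bg.
by move=> y /ltW; exact: ihb.
Qed.

Lemma avg_sub_powSr s l g : avg_sub_pow s l.+1 g =
  avg_sub_pow s l (fun y => ball_avg s g y - g y).
Proof. by rewrite /avg_sub_pow iterSr. Qed.

Lemma eq_avg_sub_pow s l g h x : 0 < s ->
  (forall y, enorm (y - x) <= l%:R * s -> g y = h y) ->
  avg_sub_pow s l g x = avg_sub_pow s l h x.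
Proof.
move=> s0; elim: l x => [|l ih] x gh.
  by apply: gh; rewrite subrr enorm0 mul0r.
have ihb y : enorm (y - x) <= s -> avg_sub_pow s l g y = avg_sub_pow s l h y.
  move=> yx; apply: ih => z zy; apply: gh; rewrite (le_trans (enorm_tri z y x))//.
  by rewrite -natr1 mulrDl mul1r lerD.
rewrite /avg_sub_pow !iterS -!/(avg_sub_pow _ _ _); congr (_ - _).
  by apply: eq_ball_avg => y /ltW; exact: ihb.
by apply: ihb; rewrite subrr enorm0 ltW.
Qed.

Section iterated_kernel_average.
Variable eps : R.
Hypothesis eps_gt0 : 0 < eps.
Local Notation J := (kavg eps).

Lemma bmeas_kavg g : bmeas g -> bmeas (J g).
Proof.
move=> [mg [M gM]]; split; first exact: measurable_kavg.
have M0 : 0 <= M by exact: le_trans (normr_ge0 _) (gM 0).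
by exists (eps * M * eps) => x; exact: kavg_bound.
Qed.

Lemma bmeas_iter_kavg j g : bmeas g -> bmeas (iter j J g).
Proof. by move=> bg; elim: j => //= j; exact: bmeas_kavg. Qed.

(** Each [J] reads its argument only within [eps] of the point, so the radii of dependency add
    up. *)
Lemma eq_iter_kavg j g h x : (forall y, enorm (y - x) <= j%:R * eps -> g y = h y) ->
  iter j J g x = iter j J h x.
Proof.
elim: j x => [|j ih] x gh; first by apply: gh; rewrite subrr enorm0 mul0r.
rewrite !iterS; apply: eq_kavg => y /ltW yx; apply: ih => z zy; apply: gh.
by rewrite (le_trans (enorm_tri z y x))// -natr1 mulrDl mul1r lerD.
Qed.

Lemma iter_kavgB j g h : bmeas g -> bmeas h ->
  iter j J (fun y => g y - h y) = fun y => iter j J g y - iter j J h y.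
Proof.
move=> bg bh; elim: j => [//|j ih]; rewrite iterS ih; apply/funext => x.
have [mg [M gM]] := bmeas_iter_kavg j bg; have [mh [N hN]] := bmeas_iter_kavg j bh.
rewrite (@kavgB _ _ _ eps_gt0 _ _ _ (Num.max M N))//.
- by rewrite le_max (le_trans (normr_ge0 _) (gM 0)).
- by move=> y _; rewrite le_max gM.
- by move=> y _; rewrite le_max hN orbT.
Qed.

Lemma ball_avg_iter_kavg s j g : bmeas g ->
  ball_avg s (iter j J g) = iter j J (ball_avg s g).
Proof.
move=> bg; elim: j => [//|j ih]; apply/funext => x.
rewrite !iterS -ih; have [mJ [M JM]] := bmeas_iter_kavg j bg.
exact: ball_avg_kavg mJ JM.
Qed.

(* [(A - I)^j] and [J^j] commute and each application enlarges the dependency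
   ball by [eps], so a one-step identity [(A - I) v_i = J v_(i+1)] iterates. *)
Lemma avg_sub_pow_iter_kavg m (v : nat -> 'rV[R]_n -> R) x :
  (forall i, bmeas (v i)) ->
  (forall i y, (i < m)%N -> enorm (y - x) <= m.-1%:R * eps ->
    ball_avg eps (v i) y - v i y = J (v i.+1) y) ->
  avg_sub_pow eps m (v 0%N) x = iter m J (v m) x.
Proof.
move=> bv step.
(* The index [i] is where the chain starts, and [(m - j) eps] is the room left after [j] steps: for
   [j = m] only the point [x] itself remains. *)
suff : forall j i y, (i + j <= m)%N -> enorm (y - x) <= (m - j)%:R * eps ->
    avg_sub_pow eps j (v i) y = iter j J (v (i + j)%N) y.
  by move=> /(_ m 0%N x); rewrite subrr enorm0 subnn mul0r => ->.
elim=> [|j ih] i y ijm yx; first by rewrite addn0.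
have jm : (j < m)%N by rewrite (leq_trans _ ijm)// addnS ltnS leq_addl.
set w := v (i + j)%N.
have ihz z : enorm (z - y) <= eps -> avg_sub_pow eps j (v i) z = iter j J w z.
  move=> zy; apply: ih; first by rewrite (leq_trans _ ijm)// leq_add2l.
  rewrite (le_trans (enorm_tri z y x))// -subnSK// -natr1 mulrDl mul1r addrC lerD//.
rewrite /avg_sub_pow iterS -!/(avg_sub_pow _ _ _).
rewrite ihz; last by rewrite subrr enorm0 ltW.
rewrite (@eq_ball_avg _ _ _ _ (iter j J w)); last by move=> z /ltW; exact: ihz.
(* [(A - I) J^j w] becomes [J^j (A - I) w], to which the one-step hypothesis applies inside
   [J^j]. *)
rewrite ball_avg_iter_kavg; last exact: bv.
have := iter_kavgB j (bmeas_ball_avg eps (bv (i + j)%N)) (bv (i + j)%N).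
move=> /(congr1 (fun F => F y)) <-.
rewrite addnS iterSr; apply: eq_iter_kavg => z zy; apply: step.
  by rewrite -addnS (leq_trans _ ijm)// addnS.
(* The radii [j eps] and [(m - j - 1) eps] add up to [(m - 1) eps], which is why the one-step
   identity is assumed only there. *)
rewrite (le_trans (enorm_tri z y x))// (le_trans (lerD zy yx))//.
by rewrite -mulrDl -natrD ler_wpM2r ?(ltW eps_gt0)// ler_nat; lia.
Qed.

End iterated_kernel_average.

End bounded_measurable.

(** * Integration by parts on balls *)

Section radial_integration_by_parts.
Context {R : realType} {n : nat}.
Local Notation leb := (lebesgue_rV R n).
Local Notation e_ i := (delta_mx ord0 i : 'rV[R]_n).
Variables (x : 'rV[R]_n) (r : R).
Hypothesis r_gt0 : 0 < r.

Lemma enorm_sqr_shift (z : 'rV[R]_n) (t : R) i :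
  enorm (z + t *: e_ i) ^+ 2 = enorm z ^+ 2 + 2 * t * z ord0 i + t ^+ 2.
Proof.
rewrite !enorm_sqr (bigD1 i)//= [in RHS](bigD1 i)//= !mxE !eqxx mulr1.
rewrite (eq_bigr (fun j => z ord0 j ^+ 2)); first by ring.
by move=> j ji; rewrite !mxE (negbTE ji) andbF mulr0 addr0.
Qed.

Lemma enorm_delta (t : R) i : 0 <= t -> enorm (t *: e_ i) = t.
Proof.
move=> t0; apply/eqP; rewrite -(@eqrXn2 _ 2)// ?enorm_ge0//; apply/eqP.
by have := enorm_sqr_shift 0 t i; rewrite add0r enorm0 expr0n mxE mulr0 !add0r.
Qed.

Let enorm_sqr_shiftB (y : 'rV[R]_n) (t : R) i :
  enorm (y - t *: e_ i - x) ^+ 2 =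
  enorm (y - x) ^+ 2 - 2 * t * (y - x) ord0 i + t ^+ 2.
Proof. by rewrite addrAC -scaleNr enorm_sqr_shift; ring. Qed.

Let enorm_shiftB_ge (y : 'rV[R]_n) (t : R) i : 0 <= t ->
  enorm (y - x) <= enorm (y - t *: e_ i - x) + t.
Proof.
move=> t0; rewrite -{2}(enorm_delta i t0).
by apply: le_trans (enormD _ _); rewrite [y - _ - x]addrAC subrK.
Qed.

(* The potential [(r^2 - |y - x|^2) / 2], extended by [0] outside the ball. *)
Let b (y : 'rV[R]_n) : R := Num.max 0 ((r ^+ 2 - enorm (y - x) ^+ 2) / 2).

Let b_ge0 y : 0 <= b y. Proof. by rewrite /b le_max lexx. Qed.

Let b_in y : enorm (y - x) < r -> b y = (r ^+ 2 - enorm (y - x) ^+ 2) / 2.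
Proof.
move=> yx; rewrite /b; apply/max_idPr; rewrite divr_ge0// subr_ge0.
by rewrite ler_pXn2r ?nnegrE ?enorm_ge0 ?(ltW r_gt0)// ltW.
Qed.

Let b_out y : r <= enorm (y - x) -> b y = 0.
Proof.
move=> yx; rewrite /b; apply/max_idPl; rewrite pmulr_lle0// subr_le0.
by rewrite ler_pXn2r ?nnegrE ?enorm_ge0 ?(ltW r_gt0).
Qed.

Let b_le y : b y <= r ^+ 2.
Proof.
rewrite /b ge_max sqr_ge0/=; have := sqr_ge0 (enorm (y - x)); have := sqr_ge0 r; lra.
Qed.

Let b_lip y t i : 0 <= t <= 1 -> `|b (y - t *: e_ i) - b y| <= t * (enorm (y - x) + 1).
Proof.
move=> /andP[t0 t1].
have maxl (p q : R) : `|Num.max 0 p - Num.max 0 q| <= `|p - q|.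
  by rewrite !maxEle; case: (leP 0 p) => p0; case: (leP 0 q) => q0; rewrite ler_norml;
    have := ler_norm (p - q); have := ler_norm (q - p); rewrite [`|q - p|]distrC => ? ?; apply/andP; split; lra.
rewrite (le_trans (maxl _ _))// enorm_sqr_shiftB.
set E := enorm _; rewrite (_ : _ - _ = t * ((y - x) ord0 i - t / 2)); last by field.
rewrite normrM ger0_norm// ler_wpM2l// (le_trans (ler_normB _ _))//.
by rewrite lerD ?enorm_coord// ger0_norm ?divr_ge0//; lra.
Qed.

Let measurable_b : measurable_fun setT b.
Proof.
apply: measurable_maxr => //; apply: measurable_funM => //.
apply: measurable_funB => //; apply: measurable_funX.
apply: measurableT_comp; first exact: measurable_enorm.
rewrite (_ : (fun _ => _) = (fun y : 'rV[R]_n => - x + 1 *: y)); first exact: measurable_affine.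
by apply/funext => y; rewrite scale1r addrC.
Qed.

Let b_quotient_in y i : enorm (y - x) < r ->
  t^-1 * (b (y - t *: e_ i) - b y) @[t --> 0^'+] --> (y - x) ord0 i.
Proof.
move=> yx; have lim : (y - x) ord0 i - t / 2 @[t --> 0^'+] --> (y - x) ord0 i.
  suff : (y - x) ord0 i - t / 2 @[t --> 0^'+] --> (y - x) ord0 i - 0 / 2.
    by rewrite mul0r subr0.
  apply: cvg_at_right_filter; apply: cvgB; first exact: cvg_cst.
  by apply: cvgMl; exact: cvg_id.
apply: cvg_trans lim; apply: near_eq_cvg; near=> t.
have t0 : 0 < t by near: t; exact: nbhs_right_gt.
have tr : t < r - enorm (y - x).
  by near: t; apply: nbhs_right_lt; rewrite subr_gt0.
have yt : enorm (y - t *: e_ i - x) < r.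
  rewrite addrAC (le_lt_trans (enormD _ _))// enormN enorm_delta ?(ltW t0)//.
  by rewrite -ltrBrDl.
rewrite !b_in// enorm_sqr_shiftB.
by field; rewrite gt_eqF.
Unshelve. all: by end_near. Qed.

Let b_quotient_out y i : r < enorm (y - x) ->
  t^-1 * (b (y - t *: e_ i) - b y) @[t --> 0^'+] --> 0.
Proof.
move=> yx; have lim : (fun=> 0 : R) @ (0 : R)^'+ --> (0 : R) by exact: cvg_cst.
apply: cvg_trans lim; apply: near_eq_cvg; near=> t.
have t0 : 0 < t by near: t; exact: nbhs_right_gt.
have tr : t < enorm (y - x) - r.
  by near: t; apply: nbhs_right_lt; rewrite subr_gt0.
rewrite !b_out ?subrr ?mulr0//; first exact: ltW.
by have := enorm_shiftB_ge y i (ltW t0); lra.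
Unshelve. all: by end_near. Qed.

Variables (rho tau L Ma : R) (a : 'I_n -> 'rV[R]_n -> R) (g : 'rV[R]_n -> R).
Hypotheses (n_gt0 : (0 < n)%N) (r_rho : r < rho) (tau_gt0 : 0 < tau).
Hypothesis ma : forall i, measurable_fun setT (a i).
Hypothesis aM : forall i y, `|a i y| <= Ma.
Hypothesis mg : measurable_fun setT g.
Hypothesis a_lip : forall i y t, enorm (y - x) < r -> 0 < t < tau ->
  `|a i (y + t *: e_ i) - a i y| <= L * t.
Hypothesis a_div : {ae leb, forall y, enorm (y - x) < r ->
  \sum_i t^-1 * (a i (y + t *: e_ i) - a i y) @[t --> 0^'+] --> g y}.

(** Strictly larger than the support of [b], so that a shift by [t < rho - r] keeps the support
    inside. *)
Let E := eball x rho.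
Let mE : measurable E. Proof. exact: measurable_eball. Qed.
Let Eoo : (leb E < +oo)%E. Proof. exact: lebesgue_eball_lty. Qed.

Let Ma0 : 0 <= Ma.
Proof. exact: le_trans (normr_ge0 _) (aM (Ordinal n_gt0) 0). Qed.

(** Both integrands vanish outside [E], so this is translation invariance on the whole space. *)
Let translate i t : 0 <= t -> r + t < rho ->
  \int[leb]_(y in E) (a i (y + t *: e_ i) * b y) =
  \int[leb]_(y in E) (a i y * b (y - t *: e_ i)).
Proof.
move=> t0 rt.
have toT F : (forall y, rho <= enorm (y - x) -> F y = 0) ->
    \int[leb]_(y in E) F y = \int[leb]_y F y.
  move=> F0; rewrite Rintegral_mkcond; apply: eq_Rintegral => y _.
  rewrite patchE; case: ifPn => // /negP; rewrite inE /E /eball/= => /negP.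
  by rewrite -leNgt => /F0.
rewrite !toT; last 2 first.
- move=> y yx; rewrite b_out ?mulr0//.
  by have := enorm_shiftB_ge y i t0; lra.
- by move=> y yx; rewrite b_out ?mulr0//; lra.
rewrite [RHS](Rintegral_affine (t *: e_ i) ltr01)//; last first.
  apply: measurable_funM => //; apply: measurableT_comp measurable_b _.
  rewrite (_ : (fun _ => _) = (fun y : 'rV[R]_n => - (t *: e_ i) + 1 *: y)); first exact: measurable_affine.
  by apply/funext => y; rewrite scale1r addrC.
rewrite expr1n mul1r; apply: eq_Rintegral => y _.
by rewrite /= scale1r [_ + y]addrC addrK.
Qed.

Let mb_shift t i : measurable_fun setT (fun y : 'rV[R]_n => b (y - t *: e_ i)).
Proof.
apply: measurableT_comp measurable_b _.
rewrite (_ : (fun _ => _) = (fun y : 'rV[R]_n => - (t *: e_ i) + 1 *: y)); first exact: measurable_affine.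
by apply/funext => y; rewrite scale1r addrC.
Qed.

Let ma_shift t i : measurable_fun setT (fun y : 'rV[R]_n => a i (y + t *: e_ i)).
Proof.
apply: measurableT_comp (ma i) _.
rewrite (_ : (fun _ => _) = (fun y : 'rV[R]_n => t *: e_ i + 1 *: y)); first exact: measurable_affine.
by apply/funext => y; rewrite scale1r addrC.
Qed.

(** Summation by parts: translation moves the forward quotient of [a i] to a backward quotient of
    [b]. *)
Let discrete_parts i t : 0 < t -> r + t < rho ->
  \int[leb]_(y in E) (t^-1 * (a i (y + t *: e_ i) - a i y) * b y) =
  \int[leb]_(y in E) (a i y * (t^-1 * (b (y - t *: e_ i) - b y))).
Proof.
move=> t0 rt.
have iab (F G : 'rV[R]_n -> R) (N : R) : measurable_fun setT F -> measurable_fun setT G ->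
    (forall y, `|F y| <= Ma) -> (forall y, `|G y| <= N) ->
    leb.-integrable E (EFin \o (fun y => F y * G y)).
  move=> mF mG FM GN; apply: (bounded_Rintegrable (M := Ma * N)) => //.
    by apply: measurable_funTS; exact: measurable_funM.
  by move=> y _; rewrite normrM ler_pM.
have bN y : `|b y| <= r ^+ 2 by rewrite ger0_norm.
have i1 := iab _ _ _ (ma_shift t i) measurable_b (fun y => aM i _) bN.
have i2 := iab _ _ _ (ma i) measurable_b (aM i) bN.
have i3 := iab _ _ _ (ma i) (mb_shift t i) (aM i) (fun y => bN _).
transitivity (t^-1 * (\int[leb]_(y in E) (a i (y + t *: e_ i) * b y) -
    \int[leb]_(y in E) (a i y * b y))).
  rewrite -RintegralB// -RintegralZl//; last first.
    exact: (integrableB mE i1 i2).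
  by apply: eq_Rintegral => y _; ring.
rewrite translate ?(ltW t0)//.
rewrite -RintegralB// -RintegralZl//; last first.
  exact: (integrableB mE i3 i2).
by apply: eq_Rintegral => y _; ring.
Qed.

(** Limit of [discrete_parts] along a sequence of steps tending to 0. The quotients of [a] are
    bounded by [a_lip] and those of [b] by [b_lip]; the backward quotient of [b] tends to
    [(y - x)_i] inside the ball and to 0 outside. *)
Lemma radial_integration_by_parts :
  \int[leb]_(y in eball x r) (\sum_i a i y * (y - x) ord0 i) =
  \int[leb]_(y in eball x r) (g y * ((r ^+ 2 - enorm (y - x) ^+ 2) / 2)).
Proof.
(* Steps below [tau] allow [a_lip], those below 1 allow [b_lip], and those below [rho - r] allow
   [discrete_parts]. *)
pose d := Num.min tau (Num.min 1 (rho - r)) / 2.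
have m0 : 0 < Num.min tau (Num.min 1 (rho - r)).
  by rewrite !lt_min tau_gt0 ltr01 subr_gt0.
have d0 : 0 < d by rewrite divr_gt0.
have : d < Num.min tau (Num.min 1 (rho - r)) by rewrite /d; lra.
rewrite !lt_min => /and3P[dtau d1 drho].
pose u k : R := d * harmonic k.
have u0 k : 0 < u k by rewrite mulr_gt0// harmonic_gt0.
have ud k : u k <= d by rewrite /u ger_pMr// invf_le1// ler1n.
have ucvg : u k @[k --> \oo] --> 0.
  by rewrite -(mulr0 d); apply: cvgMr; exact: cvg_harmonic.
pose F k y := (\sum_i (u k)^-1 * (a i (y + u k *: e_ i) - a i y)) * b y.
pose G k y := \sum_i a i y * ((u k)^-1 * (b (y - u k *: e_ i) - b y)).
pose G' y := \sum_i a i y * (if enorm (y - x) < r then (y - x) ord0 i else 0).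
have mF1 i k : measurable_fun setT (fun y : 'rV[R]_n => (u k)^-1 * (a i (y + u k *: e_ i) - a i y)).
  by apply: measurable_funM => //; apply: measurable_funB.
have mF k : measurable_fun setT (F k).
  by apply: measurable_funM => //; apply: measurable_sum => i.
have mG1 i k : measurable_fun setT (fun y : 'rV[R]_n => a i y * ((u k)^-1 * (b (y - u k *: e_ i) - b y))).
  by apply: measurable_funM => //; apply: measurable_funM => //; apply: measurable_funB.
have mG k : measurable_fun setT (G k) by apply: measurable_sum => i.
have mG' : measurable_fun setT G'.
  apply: measurable_sum => i; apply: measurable_funM => //.
  apply: measurable_fun_ifT => //.
    apply: measurable_fun_ltr => //; apply: measurableT_comp; first exact: measurable_enorm.
    rewrite (_ : (fun _ => _) = (fun y : 'rV[R]_n => - x + 1 *: y)); first exact: measurable_affine.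
    by apply/funext => y; rewrite scale1r addrC.
  rewrite (_ : (fun _ => _) = (fun y => rV_coord i y - x ord0 i)); last first.
    by apply/funext => y; rewrite !mxE.
  by apply: measurable_funB => //; exact: measurable_rV_coord.
have qb i k y : E y -> `|(u k)^-1 * (b (y - u k *: e_ i) - b y)| <= rho + 1.
  rewrite /E /eball/= => yx; rewrite normrM gtr0_norm ?invr_gt0// ler_pdivrMl//.
  rewrite (le_trans (b_lip _ _ _))//; first by rewrite (ltW (u0 k))/= (le_trans (ud k))// ltW.
  by rewrite ler_wpM2l ?(ltW (u0 k))// lerD2r ltW.
have qa i k y : enorm (y - x) < r -> `|(u k)^-1 * (a i (y + u k *: e_ i) - a i y)| <= L.
  move=> yx; rewrite normrM gtr0_norm ?invr_gt0// ler_pdivrMl// mulrC a_lip//.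
  by rewrite u0 (le_lt_trans (ud k)).
have L0 : 0 <= L.
  have := qa (Ordinal n_gt0) 0%N x; rewrite subrr enorm0 => /(_ r_gt0).
  exact: le_trans (normr_ge0 _).
have FG k : \int[leb]_(y in E) F k y = \int[leb]_(y in E) G k y.
  rewrite /F; under eq_Rintegral do rewrite mulr_suml.
  rewrite Rintegral_sum//; last first.
    move=> i; apply: (bounded_Rintegrable (M := L * r ^+ 2)) => //.
      by apply: measurable_funTS; exact: measurable_funM.
    move=> y Ey; have [yx|yx] := ltP (enorm (y - x)) r; last first.
      by rewrite b_out// mulr0 normr0 mulr_ge0// sqr_ge0.
    by rewrite normrM ler_pM ?qa// ger0_norm.
  rewrite Rintegral_sum//; last first.
    move=> i; apply: (bounded_Rintegrable (M := Ma * (rho + 1))) => //.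
      by apply: measurable_funTS.
    by move=> y Ey; rewrite normrM ler_pM ?qb.
  apply: eq_bigr => i _; apply: discrete_parts => //.
  by rewrite -ltrBrDl (le_lt_trans (ud k)).
have cF : \int[leb]_(y in E) F k y @[k --> \oo] --> \int[leb]_(y in E) (g y * b y).
  apply: (Rintegral_dominated_cvg (M := n%:R * L * r ^+ 2)) => //.
  - by move=> k; exact: measurable_funTS.
  - by apply: measurable_funTS; exact: measurable_funM.
  - move=> k y Ey; have [yx|yx] := ltP (enorm (y - x)) r; last first.
      by rewrite /F b_out// mulr0 normr0 !mulr_ge0// ltW.
    rewrite normrM ler_pM//; last by rewrite ger0_norm.
    rewrite (le_trans (ler_norm_sum _ _ _))// (le_trans (ler_sum _ (fun i _ => qa i k y yx)))//.
    by rewrite sumr_const card_ord mulr_natl.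
  apply: filterS a_div => y ay _; rewrite /F.
  have [yx|yx] := ltP (enorm (y - x)) r; last first.
    by rewrite b_out// mulr0; under eq_fun do rewrite mulr0; exact: cvg_cst.
  apply: cvgMl; exact: (((cvg_at_rightP _ _ _).1 (ay yx)) u (conj u0 ucvg)).
have cG : \int[leb]_(y in E) G k y @[k --> \oo] --> \int[leb]_(y in E) G' y.
  apply: (Rintegral_dominated_cvg (M := n%:R * (Ma * (rho + 1)))) => //.
  - by move=> k; exact: measurable_funTS.
  - exact: measurable_funTS.
  - move=> k y Ey; rewrite (le_trans (ler_norm_sum _ _ _))//.
    apply: (@le_trans _ _ (\sum_(i < n) (Ma * (rho + 1)))).
      by apply: ler_sum => i _; rewrite normrM ler_pM ?qb.
    by rewrite sumr_const card_ord mulr_natl.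
  (* On the sphere [b] has a kink and no limit is computed; the sphere is null. *)
  have S0 : leb.-negligible [set y | enorm (y - x) = r].
    exists [set y | enorm (y - x) = r]; split => //; last exact: lebesgue_sphere.
    exact: measurable_sphere.
  apply: negligibleS S0 => y /=; apply: contra_notP => yr Ey.
  apply: cvg_big => [|i _]; first exact: add_continuous.
  apply: cvgMr.
  case: ltgtP yr => // yx _.
    exact: ((cvg_at_rightP _ _ _).1 (@b_quotient_in y i yx) u (conj u0 ucvg)).
  exact: ((cvg_at_rightP _ _ _).1 (@b_quotient_out y i yx) u (conj u0 ucvg)).
have lim : \int[leb]_(y in E) (g y * b y) = \int[leb]_(y in E) G' y.
  have FG' := funext FG; rewrite -FG' in cG.
  exact: (cvg_unique (@Rhausdorff R) cF cG).
have Er h : (forall y, r <= enorm (y - x) -> h y = 0) ->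
    \int[leb]_(y in E) h y = \int[leb]_(y in eball x r) h y.
  move=> h0; rewrite Rintegral_mkcond [RHS]Rintegral_mkcond; apply: eq_Rintegral => y _.
  rewrite !patchE; case: ifPn => yE; case: ifPn => yr //.
    by apply: h0; move: yr; rewrite notin_setE /eball/= => /negP; rewrite -leNgt.
  move: yE yr; rewrite notin_setE inE /E /eball/= => /negP; rewrite -leNgt => yE yr.
  by have := lt_trans yr r_rho; rewrite ltNge yE.
transitivity (\int[leb]_(y in eball x r) G' y).
  apply: eq_Rintegral => y; rewrite inE /eball/= => yx.
  by apply: eq_bigr => i _; rewrite yx.
rewrite -Er => [|y yx]; last by rewrite /G' big1// => i _; rewrite ltNge yx mulr0.
rewrite -lim Er => [|y yx]; last by rewrite b_out ?mulr0.
by apply: eq_Rintegral => y; rewrite inE /eball/= => yx; rewrite b_in.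
Qed.

End radial_integration_by_parts.

(** * Derivatives along lines *)

Section differentiation.
Context {R : realType} {n : nat}.
Implicit Types (v : 'rV[R]_n -> R) (p q w : 'rV[R]_n).
Local Notation e_ i := (delta_mx ord0 i : 'rV[R]_n).

Lemma line_is_derive v q w (t : R) : derivable v (q + t *: w) w ->
  is_derive t 1 (fun s : R => v (q + s *: w)) ('D_w v (q + t *: w)).
Proof.
move=> dv.
have E : (fun h : R => h^-1 *: (((fun s : R => v (q + s *: w)) \o shift t) (h *: 1) - v (q + t *: w))) =
    (fun h : R => h^-1 *: ((v \o shift (q + t *: w)) (h *: w) - v (q + t *: w))).
  apply/funext => h /=; congr (_ *: (v _ - _)).
  by rewrite scalerDl [h *: 1]mulr1 addrCA.
by split; rewrite ?/derivable ?/derive /= E.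
Qed.

Lemma line_continuous v q w (t : R) : {for q + t *: w, continuous v} ->
  {for t, continuous (fun s : R => v (q + s *: w))}.
Proof.
move=> cv; apply: (@continuous_comp _ _ _ (fun s : R => q + s *: w) v) => //.
by apply: cvgD; [exact: cvg_cst|apply: cvgZr_tmp; exact: cvg_id].
Qed.

Lemma line_MVT v q w (t : R) :
  (forall s : R, `|s| <= `|t| -> derivable v (q + s *: w) w) ->
  exists2 c, `|c| <= `|t| & v (q + t *: w) - v q = t * 'D_w v (q + c *: w).
Proof.
move=> dv; pose phi (s : R) := v (q + s *: w).
have dphi (s : R) : `|s| <= `|t| -> is_derive s 1 phi ('D_w v (q + s *: w)).
  by move=> st; apply: line_is_derive; exact: dv.
have cphi (s : R) : `|s| <= `|t| -> {for s, continuous phi}.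
  move=> st; apply: differentiable_continuous; apply/derivable1_diffP.
  by have [] := dphi s st.
have phi0 : phi 0 = v q by rewrite /phi scale0r addr0.
have [t0|t0] := leP 0 t.
  have [||c] := @MVT_segment R phi (fun s => 'D_w v (q + s *: w)) 0 t t0.
  - move=> s; rewrite in_itv/= => /andP[s0 st]; apply: dphi.
    by rewrite !ger0_norm// ltW.
  - apply: continuous_in_subspaceT => s; rewrite inE/= in_itv/= => /andP[s0 st].
    by apply: cphi; rewrite !ger0_norm.
  rewrite in_itv/= subr0 phi0 => /andP[c0 ct] E.
  by exists c; rewrite ?ger0_norm// E mulrC.
have [||c] := @MVT_segment R phi (fun s => 'D_w v (q + s *: w)) t 0 (ltW t0).
- move=> s; rewrite in_itv/= => /andP[s0 st]; apply: dphi.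
  by rewrite !ltr0_norm// lerN2 ltW.
- apply: continuous_in_subspaceT => s; rewrite inE/= in_itv/= => /andP[s0 st].
  by apply: cphi; rewrite !ler0_norm ?lerN2// ltW.
rewrite in_itv/= sub0r phi0 => /andP[ct c0] E.
exists c; first by rewrite !ler0_norm ?lerN2// ltW.
by rewrite -opprB E mulrN opprK mulrC.
Qed.

(* A function with continuous partial derivatives is differentiable along every
   vector: telescope along the coordinates and apply the mean value theorem. *)
Lemma C1_is_derive v p w :
  (\forall q \near p, forall i, derivable v q (e_ i)) ->
  (forall i, {for p, continuous (partial i v)}) ->
  is_derive p w v (\sum_i w ord0 i * partial i v p).
Proof.
move=> dv cv.
(* The vectors [trunc k] join 0 to [w], changing one coordinate at a time. *)
pose trunc k : 'rV[R]_n := \row_j (if (j < k)%N then w ord0 j else 0).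
have truncS (i : 'I_n) : trunc i.+1 = trunc i + w ord0 i *: e_ i.
  apply/rowP => j; rewrite !mxE eqxx/= ltnS.
  have [->|ji] := eqVneq j i; first by rewrite leqnn ltnn add0r mulr1.
  by rewrite mulr0 addr0 leq_eqVlt (negbTE (ji : (j : nat) != i)).
have trunc_norm k (h c : R) (i : 'I_n) : (k <= i)%N -> `|c| <= `|h * w ord0 i| ->
    `|h *: trunc k + c *: e_ i| <= `|h| * `|w|.
  move=> ki ch; rewrite [leLHS]/Num.norm/= mx_normrE.
  apply: bigmax_le => [|[j1 j] _]; first by rewrite mulr_ge0.
  rewrite [j1]ord1 !mxE eqxx/=; have [->|ji] := eqVneq j i.
    rewrite ltnNge ki/= mulr0 add0r mulr1 (le_trans ch)// normrM.
    by rewrite ler_wpM2l// coord_norm.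
  rewrite mulr0 addr0 normrM ler_wpM2l//; case: ifP => _; last by rewrite normr0.
  exact: coord_norm.
suff lim : h^-1 *: (v (h *: w + p) - v p) @[h --> 0^'] -->
    \sum_i w ord0 i * partial i v p.
  by split; [exact: cvgP lim|exact: cvg_lim lim].
apply/cvgrPdist_le => e e0.
(* Each of the [n] coordinates contributes an error of at most [|w| e1]; the [+ 1] covers
   [w = 0]. *)
pose e1 := e / (n%:R * `|w| + 1).
have e10 : 0 < e1 by rewrite divr_gt0// ltr_wpDl// mulr_ge0.
have cve : \forall q \near p, forall i, `|partial i v p - partial i v q| <= e1.
  apply: (filter_forall (nbhs_filter p)) => i.
  have /(cvgrPdist_le (FF := nbhs_filter p)) cvi : partial i v @ p --> partial i v p by exact: cv.
  exact: cvi.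
have : nbhs p [set q | (forall i, derivable v q (e_ i)) /\
    forall i, `|partial i v p - partial i v q| <= e1] by exact: filterI dv cve.
move=> /nbhs_ballP[d/= d0 dball].
have d10 : 0 < d / (`|w| + 1) by rewrite divr_gt0// ltr_wpDl.
near=> h.
have h0 : h != 0 by near: h; exact: nbhs_dnbhs_neq.
have hd : `|h| * `|w| < d.
  have : `|h| < d / (`|w| + 1) by near: h; exact: dnbhs0_lt.
  rewrite ltr_pdivlMr ?ltr_wpDl// => /(le_lt_trans _); apply.
  by rewrite mulrDr mulr1 lerDl.
have dbl (i : 'I_n) (c : R) : `|c| <= `|h * w ord0 i| ->
    ball p d (p + h *: trunc i + c *: e_ i).
  move=> ch; rewrite -ball_normE/= -addrA opprD addNKr normrN.
  by rewrite (le_lt_trans (trunc_norm i _ _ _ _ ch)).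
have /choice[c cP] : forall i : 'I_n, exists c : R, `|c| <= `|h * w ord0 i| /\
    v (p + h *: trunc i.+1) - v (p + h *: trunc i) =
    h * w ord0 i * partial i v (p + h *: trunc i + c *: e_ i).
  move=> i; have [s /dbl/dball[+ _]|c ch E] := @line_MVT v (p + h *: trunc i) (e_ i) (h * w ord0 i).
    exact.
  by exists c; split => //; rewrite truncS scalerDr addrA scalerA.
have telescope : v (h *: w + p) - v p =
    \sum_(i < n) h * w ord0 i * partial i v (p + h *: trunc i + c i *: e_ i).
  transitivity (\sum_(0 <= k < n) (v (p + h *: trunc k.+1) - v (p + h *: trunc k))).
    rewrite telescope_sumr//; congr (v _ - v _).
      rewrite addrC; congr (_ + _ *: _); apply/rowP => j.
      by rewrite mxE ltn_ord.
    rewrite (_ : trunc 0%N = 0) ?scaler0 ?addr0//.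
    by apply/rowP => j; rewrite !mxE.
  by rewrite big_mkord; apply: eq_bigr => i _; exact: (cP i).2.
rewrite telescope scaler_sumr -sumrB (le_trans (ler_norm_sum _ _ _))//.
apply: (@le_trans _ _ (\sum_(i < n) `|w| * e1)).
  apply: ler_sum => i _; rewrite -mulrA [_ *: _]mulKf//.
  rewrite -mulrBr normrM ler_pM ?coord_norm//.
  by have [_] := dball _ (dbl _ _ (cP i).1); exact.
rewrite sumr_const card_ord -[leLHS]mulr_natl mulrA /e1 mulrA ler_pdivrMr ?ltr_wpDl ?mulr_ge0//.
by rewrite mulrC ler_wpM2l ?(ltW e0)// lerDl.
Unshelve. all: by end_near. Qed.

End differentiation.

(** * Integrals of powers *)

Section one_dimensional_integrals.
Context {R : realType}.
Local Notation lam := (@lebesgue_measure R).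

Lemma Rintegral_is_derive (f F : R -> R) (a b : R) : a <= b ->
  (forall t, a <= t <= b -> is_derive t 1 F (f t)) ->
  (forall t, a <= t <= b -> {for t, continuous f}) ->
  \int[lam]_(t in `[a, b]) f t = F b - F a.
Proof.
move=> ab dF cf; move: (ab); rewrite le_eqVlt => /predU1P[<-|altb].
  by rewrite set_itv1 Rintegral_set1 subrr.
have cF t : a <= t <= b -> {for t, continuous F}.
  move=> tab; apply: differentiable_continuous; apply/derivable1_diffP.
  by have [] := dF t tab.
have sub t : t \in `]a, b[ -> a <= t <= b.
  by rewrite in_itv/= => /andP[/ltW-> /ltW->].
rewrite /Rintegral (@continuous_FTC2 _ f F)//.
- apply: continuous_in_subspaceT => t; rewrite inE/= in_itv/=; exact: cf.
- split.
  + by move=> t /sub/dF[].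
  + by apply: cvg_at_right_filter; apply: cF; rewrite lexx.
  + by apply: cvg_at_left_filter; apply: cF; rewrite lexx andbT.
- by move=> t /sub/dF dFt; rewrite derive1E derive_val.
Qed.

Let is_derive_exprn (k : nat) (t : R) :
  is_derive t 1 (fun t : R => t ^+ k) (k%:R * t ^+ k.-1).
Proof.
have -> : (fun t : R => t ^+ k) = id ^+ k by rewrite exprfctE.
by apply: is_derive_eq (is_deriveX k (is_derive_id t 1)) _; rewrite /GRing.scale/= mulr1.
Qed.

Let is_derive_mulr (f : R -> R) (c t d : R) : is_derive t 1 f d ->
  is_derive t 1 (fun t => f t * c) (d * c).
Proof.
move=> df; have := is_deriveM df (is_derive_cst c t 1).
by move/is_derive_eq; apply; rewrite scaler0 add0r /GRing.scale/= mulrC.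
Qed.

Lemma Rintegral_exprn (k : nat) (a b : R) : a <= b ->
  \int[lam]_(t in `[a, b]) t ^+ k = (b ^+ k.+1 - a ^+ k.+1) / k.+1%:R.
Proof.
move=> ab; have := @Rintegral_is_derive (fun t => t ^+ k) (fun t => t ^+ k.+1 / k.+1%:R) a b ab.
rewrite -mulrBl; apply=> t _; last exact: exprn_continuous.
apply: is_derive_eq (is_derive_mulr _ (is_derive_exprn k.+1 t)) _ => /=.
by rewrite mulrAC mulfV ?mul1r.
Qed.

Lemma Rintegral_exprVn (k : nat) (a b : R) : (0 < k)%N -> 0 < a -> a <= b ->
  \int[lam]_(t in `[a, b]) (t^-1) ^+ k.+1 = ((a^-1) ^+ k - (b^-1) ^+ k) / k%:R.
Proof.
move=> k0 a0 ab.
have k_neq0 : k%:R != 0 :> R by rewrite pnatr_eq0 -lt0n.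
have := @Rintegral_is_derive (fun t => t^-1 ^+ k.+1) (fun t => t^-1 ^+ k * - k%:R^-1) a b ab.
rewrite !mulrN opprK addrC -mulrBl; apply=> t /andP[ta _];
  have t0 : t != 0 by rewrite gt_eqF// (lt_le_trans a0).
  have dV := is_deriveV (f := id) t0 (is_derive_id t 1).
  have := @is_derive1_comp _ (fun t => t ^+ k) (fun t => t^-1) t _ _ (is_derive_exprn k t^-1) dV.
  move=> /(is_derive_mulr (- k%:R^-1))/is_derive_eq; apply.
  rewrite /GRing.scale/= -exprVn; case: (k) k0 k_neq0 => // j _ j0.
  transitivity ((j.+1%:R / j.+1%:R) * (t^-1 ^+ j * t^-1 ^+ 2)).
    by rewrite /= mulr1 !mulrN mulNr opprK mulrAC (mulrAC j.+1%:R) -mulrA.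
  by rewrite mulfV// mul1r -exprD addn2.
apply: (@cvg_comp _ _ _ (fun s : R => s^-1) (fun s : R => s ^+ k.+1) (nbhs t) (nbhs t^-1)).
  exact: inv_continuous.
exact: exprn_continuous.
Qed.

End one_dimensional_integrals.

(** * The mean value expansion of order one *)

Lemma measurable_patch_open (R : realType) n (U : set 'rV[R]_n) (f : 'rV[R]_n -> R) :
  open U -> (forall y, U y -> {for y, continuous f}) -> measurable_fun setT (f \_ U).
Proof.
move=> oU cf; have mU := open_measurable_rV oU.
rewrite -measurable_restrictT//.
move=> _; apply: (measurability _ (RGenOInfty.measurableE R)) => // _ [_ [a ->] <-].
apply: open_measurable_rV; rewrite openE => y [Uy]; rewrite preimage_itvoy/= => fy.
have Uy' : nbhs y U by move: oU; rewrite openE => /(_ y Uy).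
have fy' : nbhs y [set z | a < f z] by have /cvgr_gt/(_ a fy) := cf y Uy.
by apply: filterS (filterI Uy' fy') => z [].
Qed.

(** * The radial weight and the kernel *)

Section radial_kernels.
Context {R : realType}.
Local Notation lam := (@lebesgue_measure R).

(** With [q] the distance to the centre, the weight is a superposition of indicators of the balls of
    radius [s], so a weighted integral becomes an integral of ball averages. *)
Lemma Rintegral_layer (eps q r : R) : 0 <= q -> q <= r -> r <= eps ->
  \int[lam]_(s in `[0, eps]) (if q < s <= r then s else 0) = (r ^+ 2 - q ^+ 2) / 2.
Proof.
move=> q0 qr re.
rewrite (@eq_Rintegral _ _ R lam _ ((fun s => s) \_ `]q, r]%classic)); last first.
  by move=> s _; rewrite patchE mem_setE in_itv.
rewrite -Rintegral_mkcondr (_ : _ `&` _ = `]q, r]%classic); last first.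
  apply/seteqP; split => [s [_]//|s /= sqr]; split => //.
  by move: sqr; rewrite /= !in_itv/= => /andP[qs sr]; rewrite (le_trans q0 (ltW qs)) (le_trans sr re).
have intid : lam.-integrable `[q, r] (EFin \o (fun s : R => s ^+ 1)).
  apply: continuous_compact_integrable; first exact: segment_compact.
  by apply: continuous_in_subspaceT => s _; exact: exprn_continuous.
rewrite Rintegral_itv_obnd_cbnd; last first.
  by apply: (integrableS _ _ _ intid) => //=; apply: subset_itvr; rewrite bnd_simp.
exact: (Rintegral_exprn 1 qr).
Qed.

(** Origin of the kernel: it collects, over all slices of radius [r] between [s] and [eps], the
    contribution of the average of radius [s]. *)
Lemma Rintegral_kern n (eps s : R) : (0 < n)%N -> 0 < s -> s <= eps ->
  \int[lam]_(r in `]0, eps]) (if s <= r then (s / r) ^+ n.+1 else 0) = kern n eps s.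
Proof.
move=> n0 s0 se.
rewrite (@eq_Rintegral _ _ R lam _ ((fun r => s ^+ n.+1 * (r^-1) ^+ n.+1) \_ `[s, +oo[%classic)); last first.
  by move=> r _; rewrite patchE mem_setE in_itv/= andbT exprMn.
rewrite -Rintegral_mkcondr (_ : _ `&` _ = `[s, eps]%classic); last first.
  apply/seteqP; split => [r [/=]|r /=]; rewrite !in_itv/= ?andbT; first by move=> /andP[_ ->] ->.
  by move=> /andP[sr re]; rewrite sr re (lt_le_trans s0 sr).
rewrite RintegralZl//; last first.
  apply: continuous_compact_integrable; first exact: segment_compact.
  apply: continuous_in_subspaceT => r; rewrite inE/= in_itv/= => /andP[sr _].
  apply: (@cvg_comp _ _ _ (fun s : R => s^-1) (fun s : R => s ^+ n.+1) (nbhs r) (nbhs r^-1)).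
    by apply: inv_continuous; rewrite gt_eqF// (lt_le_trans s0).
  exact: exprn_continuous.
rewrite Rintegral_exprVn// /kern !exprMn exprS.
have sn : s ^+ n * (s^-1) ^+ n = 1 by rewrite -exprMn divff ?expr1n// gt_eqF.
rewrite mulrA mulrBr -[s * s ^+ n * _]mulrA sn; ring.
Qed.

End radial_kernels.

(** * The one-step identity for a function of class C^{1,1} *)

Section ball_average_laplacian.
Context {R : realType} {n : nat}.
Local Notation leb := (lebesgue_rV R n).
Local Notation lam := (@lebesgue_measure R).
Local Notation e_ i := (delta_mx ord0 i : 'rV[R]_n).
Variables (v g : 'rV[R]_n -> R) (x : 'rV[R]_n) (eps rho tau L M Mg : R).
Hypotheses (n_gt0 : (0 < n)%N) (eps_gt0 : 0 < eps) (eps_rho : eps < rho).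
Hypothesis v_cont : forall y, enorm (y - x) < rho -> {for y, continuous v}.
Hypothesis v_der : forall y i, enorm (y - x) < rho -> derivable v y (e_ i).
Hypothesis dv_cont : forall y i, enorm (y - x) < rho -> {for y, continuous (partial i v)}.
Hypothesis v_bound : forall y, enorm (y - x) < rho -> `|v y| <= M.
Hypothesis dv_bound : forall y i, enorm (y - x) < rho -> `|partial i v y| <= M.
Hypotheses (tau_gt0 : 0 < tau) (tau_le : tau <= rho - eps).
Hypothesis dv_lip : forall i y t, enorm (y - x) < eps -> 0 < t < tau ->
  `|partial i v (y + t *: e_ i) - partial i v y| <= L * t.
Hypotheses (mg : measurable_fun setT g) (gM : forall y, `|g y| <= Mg).
Hypothesis v_laplacian : {ae leb, forall y, enorm (y - x) < rho ->
  (forall i, derivable (partial i v) y (e_ i)) /\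
  \sum_i partial i (partial i v) y = g y}.

Let B : set 'rV[R]_n := eball x rho.
(** Cutting the gradient off outside [B] makes it bounded and Borel on the whole space. *)
Let a i : 'rV[R]_n -> R := partial i v \_ B.
Let om := ball_volume R n.

Let aE i y : enorm (y - x) < rho -> a i y = partial i v y.
Proof. by move=> yB; rewrite /a patchE mem_set. Qed.

Let ma i : measurable_fun setT (a i).
Proof. by apply: measurable_patch_open; [exact: eball_open|move=> y; exact: dv_cont]. Qed.

Let M0 : 0 <= M.
Proof.
apply: le_trans (normr_ge0 _) (v_bound (y := x) _).
by rewrite subrr enorm0 (lt_trans eps_gt0).
Qed.

Let aM i y : `|a i y| <= M.
Proof.
rewrite /a patchE; case: ifPn; first by rewrite inE => /dv_bound.
by rewrite normr0.
Qed.

Let near_B y : enorm (y - x) < rho -> \forall z \near y, enorm (z - x) < rho.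
Proof. by move=> yB; have := @eball_open R n x rho; rewrite openE => /(_ y yB). Qed.

Let ray_B (r : R) z : 0 <= r <= eps -> enorm z < 1 -> enorm (x + r *: z - x) < rho.
Proof.
move=> /andP[r0 re] z1; rewrite addrAC subrr add0r enormZ//.
by rewrite (le_lt_trans _ eps_rho)// (le_trans _ re)// ler_piMr// ltW.
Qed.

Let ray_FTC z : enorm z < 1 ->
  v (x + eps *: z) - v x = \int[lam]_(r in `[0, eps]) \sum_i z ord0 i * a i (x + r *: z).
Proof.
move=> z1.
rewrite (@eq_Rintegral _ _ R lam _ (fun r => \sum_i z ord0 i * partial i v (x + r *: z))); last first.
  move=> r; rewrite inE/= in_itv/= => rI; apply: eq_bigr => i _.
  by rewrite aE// ray_B.
pose f (r : R) := \sum_i z ord0 i * partial i v (x + r *: z).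
have dF (r : R) : 0 <= r <= eps -> is_derive r 1 (fun r : R => v (x + r *: z)) (f r).
  move=> rI; have yB := ray_B rI z1.
  have D : is_derive (x + r *: z) z v (\sum_i z ord0 i * partial i v (x + r *: z)).
    apply: C1_is_derive => [|i]; last exact: dv_cont.
    by apply: filterS (near_B yB) => q qB i; exact: v_der.
  have D1 := line_is_derive (ex_derive (is_derive := D)).
  by rewrite (derive_val (is_derive := D)) in D1.
have cf (r : R) : 0 <= r <= eps -> {for r, continuous f}.
  move=> rI; have yB := ray_B rI z1.
  apply: cvg_big => [|i _]; first exact: add_continuous.
  by apply: cvgMr; apply: line_continuous; exact: dv_cont.
by have := Rintegral_is_derive (ltW eps_gt0) dF cf; rewrite scale0r addr0.
Qed.

Let H (p : 'rV[R]_n * measurableTypeR R) : R :=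
  \sum_i p.1 ord0 i * a i (x + (p.2 : R) *: p.1).

Let mscale : measurable_fun setT
  (fun p : 'rV[R]_n * measurableTypeR R => x + (p.2 : R) *: p.1).
Proof.
apply: measurable_fun_rVP => i.
rewrite (_ : _ \o _ = fun p : 'rV[R]_n * measurableTypeR R =>
    x ord0 i + p.2 * rV_coord i p.1); last first.
  by apply/funext => p; rewrite /rV_coord/= !mxE.
apply: measurable_funD => //; apply: measurable_funM; first exact: measurable_snd.
exact: measurableT_comp (@measurable_rV_coord R n i) measurable_fst.
Qed.

Let mH : measurable_fun setT H.
Proof.
apply: measurable_sum => i; apply: measurable_funM.
  exact: measurableT_comp (@measurable_rV_coord R n i) measurable_fst.
exact: measurableT_comp (ma i) mscale.
Qed.

Let HM z r : enorm z < 1 -> `|H (z, r)| <= n%:R * M.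
Proof.
move=> z1; rewrite (le_trans (ler_norm_sum _ _ _))//.
apply: (@le_trans _ _ (\sum_(i < n) M)); last by rewrite sumr_const card_ord mulr_natl.
apply: ler_sum => i _; rewrite normrM -[leRHS]mul1r ler_pM//.
by rewrite (le_trans (enorm_coord _ _))// ltW.
Qed.

Let mB1 : measurable (eball 0 1 : set 'rV[R]_n). Proof. exact: measurable_eball. Qed.
Let B1oo : (leb (eball 0 1) < +oo)%E. Proof. exact: lebesgue_eball_lty. Qed.
Let mI : measurable (`[0, eps]%classic : set (measurableTypeR R)).
Proof. exact: measurable_itv. Qed.
Let mI' : measurable (`]0, eps]%classic : set (measurableTypeR R)).
Proof. exact: measurable_itv. Qed.
Let Ioo : (lam `[0%R, eps]%classic < +oo)%E.
Proof. by rewrite lebesgue_measure_itv/= lte_fin eps_gt0 -EFinB ltry. Qed.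
Let Ioo' : (lam `]0%R, eps]%classic < +oo)%E.
Proof. by rewrite lebesgue_measure_itv/= lte_fin eps_gt0 -EFinB ltry. Qed.
Let om_gt0 : 0 < om. Proof. exact: ball_volume_gt0. Qed.
Let Mg0 : 0 <= Mg. Proof. exact: le_trans (normr_ge0 _) (gM 0). Qed.

Let in_B1 z : z \in (eball 0 1 : set 'rV[R]_n) -> enorm z < 1.
Proof. by rewrite inE /eball/= subr0. Qed.

Let increment : ball_avg eps v x - v x =
  om^-1 * \int[leb]_(z in eball 0 1) \int[lam]_(r in `[0, eps]) H (z, r).
Proof.
pose v' := v \_ B.
have v'E y : enorm (y - x) < rho -> v' y = v y by move=> yB; rewrite /v' patchE mem_set.
have mv' : measurable_fun setT v' by apply: measurable_patch_open; [exact: eball_open|].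
have v'M y : `|v' y| <= M.
  by rewrite /v' patchE; case: ifPn; [rewrite inE => /v_bound|rewrite normr0].
have -> : ball_avg eps v x = ball_avg eps v' x.
  by apply: eq_ball_avg => y yx; rewrite v'E// (lt_trans yx).
rewrite ball_avg_scale// -/om.
have -> : v x = om^-1 * \int[leb]_(z in eball 0 1) v x.
  by rewrite Rintegral_cst// mulrCA mulVf ?mulr1// gt_eqF.
rewrite -mulrBr -RintegralB//; last 2 first.
- apply: (bounded_Rintegrable (M := M)) => //; apply: measurable_funTS.
  exact: (measurableT_comp mv' (measurable_affine x eps)).
- exact: (bounded_Rintegrable (M := `|v x|)).
congr (_ * _); apply: eq_Rintegral => z /in_B1 z1.
by rewrite v'E ?ray_FTC// ray_B// ltW//= lexx.
Qed.

Let sphere_slice_parts (r : R) : 0 < r -> r <= eps ->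
  \int[leb]_(y in eball x r) (\sum_i a i y * (y - x) ord0 i) =
  \int[leb]_(y in eball x r) (g y * ((r ^+ 2 - enorm (y - x) ^+ 2) / 2)).
Proof.
move=> r0 re; have r_rho : r < rho by exact: le_lt_trans eps_rho.
apply: (@radial_integration_by_parts R n x r r0 rho tau L M a g) => //.
- move=> i y t yr /andP[t0 tt]; have yeps := lt_le_trans yr re.
  rewrite !aE ?dv_lip ?t0//; first by rewrite (lt_trans yr).
  rewrite addrAC (le_lt_trans (enormD _ _))// enorm_delta ?(ltW t0)//.
  by move: tt tau_le yeps; lra.
- apply: filterS v_laplacian => y vy yr; have yB : enorm (y - x) < rho by exact: lt_trans r_rho.
  have [dy <-] := vy yB.
  apply: cvg_big => [|i _]; first exact: add_continuous.
  have dyi : h^-1 *: (partial i v (h *: e_ i + y) - partial i v y) @[h --> 0^'] -->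
    partial i (partial i v) y by exact: dy.
  have dyi' := cvg_dnbhs_at_right dyi.
  apply: cvg_trans dyi'; apply: near_eq_cvg; near=> t.
  have t0 : 0 < t by near: t; exact: nbhs_right_gt.
  have yt : enorm (y + t *: e_ i - x) < rho.
    have : t < rho - enorm (y - x) by near: t; apply: nbhs_right_lt; rewrite subr_gt0.
    rewrite addrAC => tt; rewrite (le_lt_trans (enormD _ _))// enorm_delta ?(ltW t0)//.
    by rewrite -ltrBrDl.
  by rewrite (aE i yB) (aE i yt) [_ + y]addrC.
Unshelve. all: by end_near. Qed.

(** Substituting [y = x + r z] gives [r^n] from the volume and one more [r] from [y - x = r z],
    whence the power [n + 1]. *)
Let sphere_slice (r : R) : 0 < r -> r <= eps ->
  \int[leb]_(z in eball 0 1) H (z, r) =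
  (r^-1) ^+ n.+1 *
  \int[leb]_(y in eball x r) (g y * ((r ^+ 2 - enorm (y - x) ^+ 2) / 2)).
Proof.
move=> r0 re; rewrite -sphere_slice_parts//.
have mF : measurable_fun setT (fun y => \sum_i a i y * (y - x) ord0 i).
  apply: measurable_sum => i; apply: measurable_funM => //.
  rewrite (_ : (fun _ => _) = fun y => rV_coord i y - x ord0 i); last first.
    by apply/funext => y; rewrite !mxE.
  by apply: measurable_funB => //; exact: measurable_rV_coord.
rewrite (Rintegral_affine x r0 (measurable_eball _ _) mF).
rewrite preimage_eball_affine// divff ?gt_eqF//.
rewrite [in RHS](@eq_Rintegral _ _ _ _ _ (fun z => r * H (z, r))); last first.
  move=> z _; rewrite /H/= mulr_sumr; apply: eq_bigr => i _.
  by rewrite /= !mxE addrAC subrr add0r mulrCA [X in r * X]mulrC.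
rewrite [in RHS]RintegralZl//; last first.
  apply: (bounded_Rintegrable (M := n%:R * M)) => //.
    by apply: measurable_funTS; exact: (measurableT_comp mH (pair2_measurable r)).
  by move=> z; rewrite -in_setE => /in_B1; exact: HM.
by rewrite !mulrA -[r^-1 ^+ _ * _ * r]mulrA -exprSr -exprMn mulVf ?expr1n ?mul1r// gt_eqF.
Qed.

(** Write the weight by [Rintegral_layer] and exchange the integrals: the integral of [g] over the
    ball of radius [s] is [s^n om] times its average, and the layer brings the last factor [s]. *)
Let layer_cake (r : R) : 0 < r -> r <= eps ->
  \int[leb]_(y in eball x r) (g y * ((r ^+ 2 - enorm (y - x) ^+ 2) / 2)) =
  \int[lam]_(s in `[0, eps]) (if s <= r then s ^+ n.+1 * om * ball_avg s g x else 0).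
Proof.
move=> r0 re.
pose P (p : 'rV[R]_n * measurableTypeR R) : R :=
  g p.1 * (if enorm (p.1 - x) < p.2 <= r then p.2 else 0).
have mE := @measurable_eball R n x eps; have Eoo := @lebesgue_eball_lty R n x eps.
have mP : measurable_fun setT P.
  apply: measurable_funM; first exact: measurableT_comp mg measurable_fst.
  apply: measurable_fun_ifT => //.
  apply: measurable_and.
    apply: measurable_fun_ltr; last exact: measurable_snd.
    apply: measurableT_comp; first exact: measurable_enorm.
    apply: measurable_rVD; first exact: measurable_fst.
    by apply: measurable_rVN; exact: measurable_cst.
  by apply: measurable_fun_ler => //; exact: measurable_snd.
have PM y s : `[0, eps]%classic s -> `|P (y, s)| <= Mg * eps.
  rewrite /P/= in_itv/= => /andP[s0 se]; rewrite normrM ler_pM//.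
  by case: ifP => _; rewrite ?normr0 ?(ltW eps_gt0)// ger0_norm.
transitivity (\int[leb]_(y in eball x eps) \int[lam]_(s in `[0, eps]) P (y, s)).
  transitivity (\int[leb]_(y in eball x eps)
      ((fun y => g y * ((r ^+ 2 - enorm (y - x) ^+ 2) / 2)) \_ (eball x r)) y).
    rewrite -Rintegral_mkcondr; congr (Rintegral _ _ _).
    by apply/esym/setIidPr; apply: subset_eball; rewrite subrr enorm0 addr0.
  apply: eq_Rintegral => y _; rewrite /P/= RintegralZl//; last first.
    apply: (bounded_Rintegrable (M := eps)) => //.
      apply: measurable_funTS; apply: measurable_fun_ifT => //; apply: measurable_and.
        by apply: measurable_fun_ltr.
      by apply: measurable_fun_ler.
    move=> s; rewrite /= in_itv/= => /andP[s0 se].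
    by case: ifP => _; rewrite ?normr0 ?(ltW eps_gt0)// ger0_norm.
  rewrite patchE; have [yr|yr] := ltP (enorm (y - x)) r.
    by rewrite mem_set// Rintegral_layer ?enorm_ge0// ltW.
  rewrite memNset; last by apply/negP; rewrite -leNgt.
  rewrite (@eq_Rintegral _ _ _ _ _ (cst 0)) ?Rintegral_cst ?mul0r ?mulr0// => s _.
  by case: ifP => // /andP[ys sr]; have := lt_le_trans ys sr; rewrite ltNge yr.
rewrite (Rintegral_swap mE mI Eoo Ioo mP (fun y s _ => @PM y s)).
apply: eq_Rintegral => s; rewrite inE/= in_itv/= => /andP[s0 se].
rewrite /P/=; case: ifPn => sr; last first.
  rewrite (@eq_Rintegral _ _ _ _ _ (cst 0)) ?Rintegral_cst ?mul0r// => y _ /=.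
  by rewrite andbF mulr0.
rewrite (@eq_Rintegral _ _ _ _ _ ((fun y => g y * s) \_ (eball x s))); last first.
  move=> y _ /=; rewrite patchE andbT; have [ys|ys] := ltP (enorm (y - x)) s.
    by rewrite mem_set.
  by rewrite memNset ?mulr0//; apply/negP; rewrite -leNgt.
rewrite -Rintegral_mkcondr (_ : _ `&` _ = eball x s); last first.
  by apply/setIidPr; apply: subset_eball; rewrite subrr enorm0 addr0.
have [s00|s_gt0] := eqVneq s 0.
  by rewrite s00 eball_le0// Rintegral_set0 expr0n/= !mul0r.
have sp : 0 < s by rewrite lt_def s_gt0.
rewrite RintegralZr//; last 2 first.
- exact: measurable_eball.
- by apply: (ball_integrable (M := Mg)).
rewrite ball_avgE// -/om exprS -[s * _ * om]mulrA -mulrA mulrC; congr (_ * _).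
by rewrite mulrA divff ?mul1r// mulf_neq0 ?gt_eqF// ?exprn_gt0.
Qed.

(** The increment is a double integral over directions and radii [r]. Each slice is an integral over
    [s <= r] of averages of [g]; integrating in [r] first leaves the kernel at [s]. *)
Lemma ball_avg_laplacian : ball_avg eps v x - v x = kavg eps g x.
Proof.
rewrite increment; have swapH := Rintegral_swap mB1 mI B1oo Ioo mH _.
rewrite (swapH (n%:R * M)); last first.
  by move=> z r; rewrite -in_setE => /in_B1 z1 _; exact: HM.
(* The first component is the slice radius [r], the second the averaging radius [s]. The inverse is
   written [^ (-1)] so that [measurable_powR] applies. *)
pose Q (p : measurableTypeR R * measurableTypeR R) : R :=
  (if p.2 <= p.1 then (p.2 * p.1 `^ (-1)) ^+ n.+1 else 0) * ball_avg p.2 g x.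
have mAv : measurable_fun setT (fun s : measurableTypeR R => ball_avg s g x).
  have mA : measurable_fun setT (fun p : measurableTypeR R * 'rV[R]_n => ball_avg p.1 g p.2).
    apply: (@measurable_ball_avg _ _ _ (measurableTypeR R) id (fun p => g p.2)) => //.
    exact: measurableT_comp mg measurable_snd.
  exact: (measurableT_comp mA (pair2_measurable x)).
have mQ : measurable_fun setT Q.
  apply: measurable_funM; last exact: measurableT_comp mAv measurable_snd.
  apply: measurable_fun_ifT => //.
    by apply: measurable_fun_ler; [exact: measurable_snd|exact: measurable_fst].
  apply: measurable_funX; apply: measurable_funM; first exact: measurable_snd.
  exact: (measurableT_comp (@measurable_powR R (-1)) measurable_fst).
have QM r s : `]0, eps]%classic r -> `[0, eps]%classic s -> `|Q (r, s)| <= Mg.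
  rewrite /= !in_itv/= => /andP[r0 re] /andP[s0 se]; rewrite /Q/=.
  rewrite normrM -[leRHS]mul1r ler_pM//; last exact: ball_avg_bound.
  case: ifP => sr; last by rewrite normr0.
  rewrite powR_inv1 ?(ltW r0)// normrX exprn_ile1// ger0_norm ?mulr_ge0 ?invr_ge0 ?(ltW r0)//.
  by rewrite ler_pdivrMr// mul1r.
have iH (D : set (measurableTypeR R)) : measurable D -> (lam D < +oo)%E ->
    lam.-integrable D (EFin \o (fun r => \int[leb]_(z in eball 0 1) H (z, r))).
  move=> mD Doo; apply: (bounded_Rintegrable (M := n%:R * M * fine (leb (eball 0 1)))) => //.
    have mD1 : measurable [set p : measurableTypeR R * 'rV[R]_n | eball 0 1 p.2].
      by rewrite -[X in measurable X]setTI; apply: measurable_snd.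
    have mH' : measurable_fun setT (fun p : measurableTypeR R * 'rV[R]_n => H (p.2, p.1)).
      apply: measurableT_comp mH _; apply: measurable_fun_pair.
        exact: measurable_snd.
      exact: measurable_fst.
    by apply: measurable_funTS; have := measurable_fun_Rintegral leb mD1 mH'.
  move=> r _; apply: le_Rintegral_bound => //.
    by apply: measurable_funTS; exact: (measurableT_comp mH (pair2_measurable r)).
  by move=> z; rewrite -in_setE => /in_B1; exact: HM.
(* The endpoint [r = 0] is dropped, as the slice formula divides by [r]. *)
rewrite -(@Rintegral_itv_obnd_cbnd R 0 (BRight eps)); last exact: iH.
have QE r : 0 < r -> r <= eps ->
    om^-1 * \int[leb]_(z in eball 0 1) H (z, r) = \int[lam]_(s in `[0, eps]) Q (r, s).
  move=> r0 re; rewrite sphere_slice// layer_cake// mulrA -RintegralZl//; last first.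
    apply: (bounded_Rintegrable (M := eps ^+ n.+1 * om * Mg)) => //.
      apply: measurable_funTS; apply: measurable_fun_ifT => //.
        by apply: measurable_fun_ler.
      by apply: measurable_funM => //; apply: measurable_funM => //; apply: measurable_funX.
    move=> s; rewrite /= in_itv/= => /andP[s0 se].
    have P0 : 0 <= eps ^+ n.+1 * om by rewrite mulr_ge0 ?exprn_ge0// ltW.
    case: ifP => _; last by rewrite normr0 mulr_ge0.
    rewrite normrM ler_pM//; last exact: ball_avg_bound.
    rewrite ger0_norm ?mulr_ge0 ?exprn_ge0 ?(ltW om_gt0)//.
    by rewrite ler_wpM2r ?(ltW om_gt0)// lerXn2r ?nnegrE ?(ltW eps_gt0).
  apply: eq_Rintegral => s _; rewrite /Q/= powR_inv1 ?(ltW r0)//.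
  case: ifP => _; last by rewrite mulr0 mul0r.
  rewrite mulrA; congr (_ * _); rewrite exprMn [s ^+ _ * om]mulrC mulrA.
  by rewrite [_ * om]mulrAC mulVf ?mul1r 1?mulrC// gt_eqF.
rewrite -RintegralZl//; last exact: iH.
rewrite (@eq_Rintegral _ _ R lam _ (fun r => \int[lam]_(s in `[0, eps]) Q (r, s))); last first.
  by move=> r; rewrite inE/= in_itv/= => /andP[r0 re]; exact: QE.
rewrite (Rintegral_swap mI' mI Ioo' Ioo mQ QM).
apply: eq_Rintegral => s; rewrite inE/= in_itv/= => /andP[s0 se].
have [s00|s_neq0] := eqVneq s 0.
  rewrite ball_avg_le0 ?s00// mulr0 (@eq_Rintegral _ _ R lam _ (cst 0)).
    by rewrite Rintegral_cst ?mul0r.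
  by move=> r _; rewrite /Q/= ball_avg_le0 ?mulr0.
have sp : 0 < s by rewrite lt_def s_neq0.
pose q (r : R) := if s <= r then (s * r `^ (-1)) ^+ n.+1 else 0.
have mq : measurable_fun setT q.
  apply: measurable_fun_ifT => //; first exact: measurable_fun_ler.
  by apply: measurable_funX; apply: measurable_funM => //; exact: (@measurable_powR R (-1)).
have qE r : 0 < r -> q r = if s <= r then (s / r) ^+ n.+1 else 0.
  by move=> r0; rewrite /q powR_inv1// ltW.
rewrite /Q/= RintegralZr//; last first.
  apply: (bounded_Rintegrable (M := 1)) => //; first exact: measurable_funTS.
  move=> r; rewrite /= in_itv/= => /andP[r0 re]; rewrite -/(q r) qE//.
  case: ifP => sr; last by rewrite normr0.
  rewrite normrX exprn_ile1// ger0_norm ?mulr_ge0 ?invr_ge0 ?(ltW r0)//.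
  by rewrite ler_pdivrMr// mul1r.
congr (_ * _); rewrite -(Rintegral_kern n_gt0 sp se).
apply: eq_Rintegral => r; rewrite inE/= in_itv/= => /andP[r0 re].
by rewrite -/(q r) qE.
Qed.

End ball_average_laplacian.

(** * Null sets and Borel representatives *)

Section nonmeasurable_integrands.
Context d {T : measurableType d} {R : realType}.
Variable mu : {measure set T -> \bar R}.

(** The integral of a nonnegative function is a supremum over the simple functions below it, and a
    larger function admits more of them. *)
Let le_integral_ge0 (f g : T -> \bar R) : (forall y, 0 <= f y)%E ->
  (forall y, f y <= g y)%E -> (\int[mu]_y f y <= \int[mu]_y g y)%E.
Proof.
move=> f0 fg; rewrite !ge0_integralTE//; last by move=> y; exact: le_trans (f0 y) (fg y).
apply: le_ereal_sup => _ [h hf <-]; exists h => // y.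
exact: le_trans (hf y) (fg y).
Qed.

(* The integral of the library is a lower integral, defined for every function;
   hence it ignores null sets even when the integrand is not Borel measurable. *)
Let ge0_ae_eq (f g : T -> \bar R) : (forall y, 0 <= f y)%E -> (forall y, 0 <= g y)%E ->
  measurable_fun setT g -> {ae mu, forall y, f y = g y} ->
  (\int[mu]_y f y = \int[mu]_y g y)%E.
Proof.
move=> f0 g0 mg [N [mN N0 subN]].
have fgN y : ~ N y -> f y = g y by move=> Ny; apply: contrapT => /subN.
have patch c : (0 <= c)%E ->
    (\int[mu]_y (if y \in N then c else g y) = \int[mu]_y g y)%E.
  move=> c0; apply: ge0_ae_eq_integral => //.
  - apply: measurable_fun_ifT => //; apply: (measurable_fun_bool true).
    by rewrite setTI (_ : _ @^-1` _ = N)//; apply/seteqP; split => y /= yN; [exact: set_mem|exact: mem_set].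
  - by move=> y _; case: ifP.
  - exists N; split => // y /= H; apply: contrapT => Ny; apply: H => _.
    by rewrite memNset.
(* Off [N] the functions agree, so [f] lies between [g] reset on [N] to 0 and [g] reset to [+oo]; by
   [patch] both have the integral of [g]. *)
apply/eqP; rewrite eq_le; apply/andP; split.
  rewrite -(patch +oo%E)//; apply: le_integral_ge0 => // y.
  by case: ifPn => [|/negP]; rewrite ?leey// inE => /fgN ->.
rewrite -(patch 0%E)//; apply: le_integral_ge0 => y; first by case: ifP.
by case: ifPn => [|/negP]; rewrite ?inE// => /fgN ->.
Qed.

Lemma ae_eq_Rintegral (D : set T) (f g : T -> R) : measurable D ->
  measurable_fun setT g -> {ae mu, forall y, D y -> f y = g y} ->
  \int[mu]_(y in D) f y = \int[mu]_(y in D) g y.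
Proof.
move=> mD mg fg; rewrite Rintegral_mkcond [RHS]Rintegral_mkcond; congr fine.
have mgD : measurable_fun setT (EFin \o (g \_ D)).
  by apply/measurable_EFinP; rewrite -measurable_restrictT//; exact: measurable_funTS.
have fgD : {ae mu, forall y, ((f \_ D) y)%:E = ((g \_ D) y)%:E}.
  by apply: filterS fg => y fgy; rewrite !patchE; case: ifPn => // /set_mem/fgy ->.
rewrite integralE [RHS]integralE; congr (_ - _)%E; apply: ge0_ae_eq => //.
- exact: measurable_funepos.
- by apply: filterS fgD => y fgy; rewrite !funeposE fgy.
- exact: measurable_funeneg.
- by apply: filterS fgD => y fgy; rewrite !funenegE fgy.
Qed.

End nonmeasurable_integrands.

(** * Replacing a Lebesgue measurable function by a Borel one *)

Section borel_representative.
Context {R : realType} {n : nat}.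
Local Notation leb := (lebesgue_rV R n).
Implicit Types (f g : 'rV[R]_n -> R) (x y : 'rV[R]_n).

Lemma ae_eq_ball_avg s f g x : measurable_fun setT g ->
  {ae leb, forall y, enorm (y - x) < s -> f y = g y} ->
  ball_avg s f x = ball_avg s g x.
Proof.
move=> mg fg; rewrite /ball_avg; apply: (congr1 (GRing.mul _)).
by apply: ae_eq_Rintegral => //; exact: measurable_eball.
Qed.

(** The innermost average erases the null set; from there on the functions agree pointwise, which is
    why at least one average is required. *)
Lemma ae_eq_multi_avg (eps rho : R) f g x m (r : 'rV[R]_m) y : measurable_fun setT g ->
  {ae leb, forall y, enorm (y - x) < rho -> f y = g y} ->
  (0 < m)%N -> cube m eps r -> enorm (y - x) <= rho - m%:R * eps ->
  multi_avg r f y = multi_avg r g y.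
Proof.
move=> mg fg; case: m r => // m r _.
elim: m r y => [|m ih] r y rC yx; rewrite -[r]rV_unconsK [rV_uncons r]surjective_pairing !multi_avg_cons;
  have /= /andP[r0 re] := rC ord0.
  rewrite /multi_avg /entries enum_ord0/=; apply: ae_eq_ball_avg => //.
  apply: filterS fg => z + zy; apply; have := enorm_tri z y x.
  by move: yx zy; lra.
apply: eq_ball_avg => z zy; apply: ih => [i|]; first by rewrite mxE; exact: rC.
have := enorm_tri z y x; move: yx zy; rewrite -natr1 mulrDl mul1r; lra.
Qed.

(** Discard the null set where the local bound fails and, for each rational [q], the null part of
    the preimage of []q, +oo[]; on the remaining Borel set [C] the function is Borel. The last
    clause lets any oscillation bound on [f] pass to [g]. *)
Lemma borel_representative (Om : set 'rV[R]_n) f x rho : Linfty_loc Om f ->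
  0 < rho -> [set y | enorm (y - x) <= rho] `<=` Om ->
  exists g, [/\ bmeas g, {ae leb, forall y, enorm (y - x) < rho -> f y = g y},
    g x = f x & forall y, g y = f x \/ (enorm (y - x) < rho /\ g y = f y)].
Proof.
move=> [mf f_bd] rho0 KOm; set B := eball x rho.
have BOm : B `<=` Om by move=> y /ltW; exact: KOm.
have [M [N0 [mN0 N00 subN0]]] := f_bd _ (@compact_eball R n x rho) KOm.
have /choice[A /choice[N AN]] : forall q : rat, exists A N : set 'rV[R]_n,
    [/\ measurable A, measurable N, leb N = 0, Om `&` f @^-1` `]ratr q, +oo[%classic `<=` A `|` N
      & A `<=` Om `&` f @^-1` `]ratr q, +oo[%classic].
  move=> q; have [|A mA [N' [N [mN N0' N'N]] ANE]] := mf `]ratr q, +oo[%classic.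
    exact: measurable_itv.
  by exists A, N; split => //; rewrite -ANE; [exact: setUS|exact: subsetUl].
pose N1 := \bigcup_q N q.
pose C := B `\` (N0 `|` N1).
have mN1 : measurable N1 by apply: bigcupT_measurable_rat => q; have [] := AN q.
have mB : measurable B by exact: measurable_eball.
have mC : measurable C by apply: measurableD => //; exact: measurableU.
have N1_0 : leb.-negligible N1.
  pose F k := if unpickle k is Some q then N q else set0.
  apply: (@negligibleS _ _ _ leb (\bigcup_k F k)).
    by move=> y [q _ Ny]; exists (pickle q); [exact: I|rewrite /F pickleK].
  apply: negligible_bigcup => k; rewrite /F; case: unpickle => [q|]; last exact: negligible_set0.
  by have [_ mNq Nq0 _ _] := AN q; exists (N q); split.
have mfC : measurable_fun C f.
  move=> _; apply: (measurability _ (RGenOInfty.measurableE R)) => // _ [_ [a ->] <-].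
  (* A value exceeds [a] exactly when it exceeds some rational [q >= a]; on [C] this is membership
     in the Borel set [A q]. *)
  rewrite (_ : _ `&` _ = \bigcup_(q : rat) (if a <= ratr q then C `&` A q else set0)).
    apply: bigcupT_measurable_rat => q; case: ifP => // _.
    by apply: measurableI => //; have [] := AN q.
  apply/seteqP; split => [y [Cy]|y [q _]]; last first.
    case: ifP => // aq [Cy Ay]; have [_ _ _ _ /(_ _ Ay)[_]] := AN q.
    by rewrite /= !in_itv/= !andbT => qf; split => //; exact: le_lt_trans qf.
  rewrite /= in_itv/= andbT => /rat_in_itvoo[q]; rewrite in_itv/= => /andP[aq qf].
  exists q => //; rewrite (ltW aq); split => //.
  have [_ _ _ /(_ y) ANy _] := AN q; have [By NN] := Cy.
  have Oy : (Om `&` f @^-1` `]ratr q, +oo[%classic) y.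
    by split; [exact: BOm|rewrite /= in_itv/= andbT].
  by case: (ANy Oy) => // Ny; exfalso; apply: NN; right; exists q.
(* The default value [f x] gives [g x = f x] even when [x] was discarded, and creates no value
   foreign to [f]. *)
pose g y := ((fun z => f z - f x) \_ C) y + f x.
have gE y : g y = if y \in C then f y else f x.
  by rewrite /g patchE; case: ifP => _; rewrite ?subrK ?add0r.
exists g; split.
- split.
    apply: measurable_funD => //; rewrite -measurable_restrictT//.
    by apply: measurable_funB.
  exists (Num.max M `|f x|) => y; rewrite gE; case: ifPn => [/set_mem Cy|_].
    rewrite le_max; apply/orP; left; apply: contrapT => fM.
    have [By NN] := Cy; apply: NN; left; apply: subN0 => /= H; apply: fM; apply: H.
    exact: ltW.
  by rewrite le_max lexx orbT.
- apply: (@negligibleS _ _ _ leb (N0 `|` N1)); last first.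
    by apply: negligibleU => //; exists N0; split.
  move=> y /= H; apply: contrapT => NN; apply: H => yx.
  by rewrite gE mem_set.
- by rewrite gE; case: ifP.
- move=> y; rewrite gE; case: ifPn => [/set_mem[By _]|_]; [right|left] => //.
Qed.

End borel_representative.

(** * Iterated Laplacians of functions of class C^{k,1} *)

Section distance_to_boundary.
Context {R : realType} {n : nat}.
Variable Om : set 'rV[R]_n.
Hypothesis oOm : open Om.

(** Connectedness of [[0, 1]]: the parameters that land in [Om] form an open set, which is also
    closed because a point of the closure off the boundary is interior. *)
Lemma segment_sub_open (x y : 'rV[R]_n) : Om x ->
  (forall t : R, 0 <= t <= 1 -> ~ boundary Om (x + t *: (y - x))) -> Om y.
Proof.
move=> Omx nb; pose gam (t : R) := x + t *: (y - x).
have cgam : continuous gam.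
  by move=> t; apply: cvgD; [exact: cvg_cst|apply: cvgZr_tmp; exact: cvg_id].
pose I : set R := `[0, 1]%classic.
have cI : connected I by apply/connected_intervalP; exact: interval_is_interval.
have II t : I t -> 0 <= t <= 1 by rewrite /I/= in_itv.
suff IE : I `&` gam @^-1` Om = I.
  have : I 1 by rewrite /I/= in_itv/= ler01 lexx.
  by rewrite -IE => -[_]; rewrite /gam/= scale1r addrC subrK.
apply: cI.
- exists 0; split; first by rewrite /I/= in_itv/= ler01 lexx.
  by rewrite /gam/= scale0r addr0.
- by exists (gam @^-1` Om) => //; apply: open_comp => // t _; exact: cgam.
- exists (gam @^-1` closure Om).
    by apply: closed_comp => [t _|]; [exact: cgam|exact: closed_closure].
  apply/seteqP; split => t [It]/= Ot; split => //; first exact: subset_closure.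
  apply: contrapT => nO; apply: (nb t (II t It)); split => //.
  by move=> /interior_subset.
Qed.

(** Strict inequality leaves the margin [rho - m eps], the room for cut-offs and difference
    quotients in what follows. If the boundary is at infinite distance, any margin works. *)
Lemma closed_eball_sub (x : 'rV[R]_n) (m : nat) (eps : R) : (0 < m)%N -> Om x ->
  (eps%:E < dist_boundary Om x / m%:R%:E)%E ->
  exists2 rho, m%:R * eps < rho & [set y | enorm (y - x) <= rho] `<=` Om.
Proof.
move=> m0 Omx; rewrite inver pnatr_eq0 gtn_eqF// lte_pdivlMr ?ltr0n// -EFinM mulrC => epsD.
have [rho erho rhoD] : exists2 rho, m%:R * eps < rho & (rho%:E < dist_boundary Om x)%E.
  move: epsD; case: (dist_boundary Om x) => [D| |]//; last first.
    by exists (m%:R * eps + 1); [rewrite ltrDl|rewrite ltry].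
  by rewrite lte_fin => eD; exists ((m%:R * eps + D) / 2); rewrite ?lte_fin; lra.
exists rho => // y /= yx; apply: (segment_sub_open Omx) => t /andP[t0 t1] bt.
have : (dist_boundary Om x <= (enorm (x - (x + t *: (y - x))))%:E)%E.
  by apply: ereal_inf_lbound; exists (x + t *: (y - x)).
rewrite leNgt => /negP; apply; apply: le_lt_trans rhoD; rewrite lee_fin.
rewrite opprD addNKr enormN enormZ// (le_trans _ yx)// ler_piMl//; exact: enorm_ge0.
Qed.

End distance_to_boundary.

(** * The Laplacian on the classes C^{k,1} *)

Section iterated_laplacians.
Context {R : realType} {n : nat}.
Variable Om : set 'rV[R]_n.
Hypothesis oOm : open Om.
Implicit Types (g h : 'rV[R]_n -> R) (x : 'rV[R]_n).
Local Notation e_ i := (delta_mx ord0 i : 'rV[R]_n).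

Let near_Om x : Om x -> \forall y \near x, Om y.
Proof. by move=> Ox; move: oOm; rewrite openE => /(_ x Ox). Qed.

Lemma Ck_le k l g : (k <= l)%N -> Ck Om l g -> Ck Om k g.
Proof.
move=> kl Cg x Ox s; have [d c] := Cg x Ox s; split => sk.
  by apply: d; exact: leq_trans kl.
by apply: c; exact: leq_trans kl.
Qed.

(** The derivatives of the Laplacian are innermost in [foldr], so the order of differentiation is
    kept; openness gives equality near [x], which can be differentiated again. *)
Lemma partials_laplacian k g s : Ck Om k.+2 g -> (size s <= k)%N -> forall x, Om x ->
  partials s (laplacian g) x = \sum_i partials (s ++ [:: i; i]) g x.
Proof.
move=> Cg; elim: s => [//|j s ih] sk x Ox /=; rewrite /partial.
have E : \forall y \near x, partials s (laplacian g) y = (\sum_i partials (s ++ [:: i; i]) g) y.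
  by apply: filterS (near_Om Ox) => y Oy; rewrite ih ?fct_sumE// ltnW.
rewrite (near_eq_derive _ E) derive_sum//.
move=> i; have [d _] := Cg x Ox (s ++ [:: i; i]).
by apply: d; rewrite size_cat addn2 ltnS.
Qed.

Lemma Ck_laplacian k g : Ck Om k.+2 g -> Ck Om k (laplacian g).
Proof.
move=> Cg x Ox s; have near_partials : (size s <= k)%N ->
    \forall y \near x, (\sum_i partials (s ++ [:: i; i]) g) y = partials s (laplacian g) y.
  move=> sk; apply: filterS (near_Om Ox) => y Oy.
  by rewrite (partials_laplacian Cg) ?fct_sumE.
split=> sk.
  move=> j; apply: near_eq_derivable (near_partials (ltnW sk)) _.
  apply: derivable_sum => i; have [d _] := Cg x Ox (s ++ [:: i; i]).
  by apply: d; rewrite size_cat addn2 !ltnS.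
have cs : \sum_i partials (s ++ [:: i; i]) g y @[y --> x] --> \sum_i partials (s ++ [:: i; i]) g x.
  apply: (cvg_big _ (nbhs_filter x)) => [|i _]; first exact: add_continuous.
  have [_ c] := Cg x Ox (s ++ [:: i; i]).
  by apply: c; rewrite size_cat addn2 !ltnS.
have E := partials_laplacian Cg sk Ox.
have N : {near nbhs x, (fun y => \sum_i partials (s ++ [:: i; i]) g y) =1 partials s (laplacian g)}.
  by apply: filterS (near_Om Ox) => y Oy; rewrite (partials_laplacian Cg).
rewrite -E in cs; exact: cvg_trans (near_eq_cvg N) cs.
Qed.

Lemma Ck1_laplacian k g : Ck1 Om k.+2 g -> Ck1 Om k (laplacian g).
Proof.
move=> [Cg Lg]; split; first exact: Ck_laplacian.
move=> s sk x Ox.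
have /choice[L /choice[U LU]] : forall i : 'I_n, exists (L : R) (U : set 'rV[R]_n),
    [/\ 0 <= L, nbhs x U & forall y z, U y -> U z ->
      `|partials (s ++ [:: i; i]) g y - partials (s ++ [:: i; i]) g z| <= L * enorm (y - z)].
  move=> i; have [|L L0 [U xU UL]] := Lg (s ++ [:: i; i]) _ x Ox.
    by rewrite size_cat addn2 sk.
  by exists L, U.
exists (\sum_i L i); first by apply: sumr_ge0 => i _; have [] := LU i.
exists [set y | Om y /\ forall i, U i y].
  apply: filterI; first exact: near_Om.
  by apply: (filter_forall (nbhs_filter x)) => i; have [] := LU i.
move=> y z [Oy Uy] [Oz Uz].
rewrite !(partials_laplacian Cg) ?sk// -sumrB mulr_suml.
rewrite (le_trans (ler_norm_sum _ _ _))//; apply: ler_sum => i _.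
by have [_ _] := LU i; apply.
Qed.

(** Mean value theorem along the line through two points, with the partial derivatives bounded near
    [x] by continuity. *)
Lemma locally_lipschitz_C1 h : Ck Om 1 h -> locally_lipschitz Om h.
Proof.
move=> Ch x Ox.
pose M := \sum_i `|partial i h x| + 1.
have M0 : 0 <= M by rewrite addr_ge0// sumr_ge0.
have cp i y : Om y -> {for y, continuous (partial i h)}.
  by move=> Oy; have [_ c] := Ch y Oy [:: i]; exact: c.
have dp i y : Om y -> derivable h y (e_ i).
  by move=> Oy; have [d _] := Ch y Oy [::]; exact: d.
have bd : \forall y \near x, forall i, `|partial i h y| <= M.
  apply: (filter_forall (nbhs_filter x)) => i.
  have /(cvgrPdist_lt (FF := nbhs_filter x)) ci : partial i h @ x --> partial i h x by exact: cp.
  apply: filterS (ci 1 ltr01) => y yx.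
  rewrite -[X in `|X|](subrK (partial i h x)) (le_trans (ler_normD _ _))// addrC lerD//.
    by rewrite (bigD1 i)//= lerDl sumr_ge0.
  by rewrite distrC ltW.
have [d d0 dU] := nbhs_eball (filterI (near_Om Ox) bd).
exists (n%:R * M); first by rewrite mulr_ge0.
(* [line_MVT] gives a point [z + c w] with only [|c| <= 1]. Since [w] has length at most [2 d / 3],
   it stays within [d] of [x]. *)
have d30 : 0 < d / 3 by rewrite divr_gt0.
exists (eball x (d / 3)).
  by have := @eball_open R n x (d / 3); rewrite openE; apply; rewrite /eball/= subrr enorm0.
move=> y z; rewrite /eball/= => yx zx.
pose w := y - z.
have wd : enorm w <= 2 * d / 3.
  by have := enorm_tri y x z; rewrite [enorm (x - z)]enormB /w; lra.
have Oc (c : R) : `|c| <= `|1 : R| -> (Om `&` [set y | forall i, `|partial i h y| <= M]) (z + c *: w).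
  rewrite normr1 => c1; apply: dU; rewrite /eball/= addrAC (le_lt_trans (enormD _ _))//.
  have cw : enorm (c *: w) <= enorm w.
    have [c0|c0] := leP 0 c.
      by rewrite enormZ// ler_piMl ?enorm_ge0// -[c]ger0_norm.
    rewrite -[c]opprK scaleNr enormN enormZ ?oppr_ge0 ?(ltW c0)// ler_piMl ?enorm_ge0//.
    by rewrite -ltr0_norm.
  by move: zx wd cw; lra.
have D (c : R) : `|c| <= `|1 : R| -> is_derive (z + c *: w) w h
    (\sum_i w ord0 i * partial i h (z + c *: w)).
  move=> /Oc[Oz _]; apply: C1_is_derive => [|i]; last exact: cp.
  by apply: filterS (near_Om Oz) => q Oq i; exact: dp.
have [c c1|c c1 E] := @line_MVT R n h z w 1; first by have [] := D c c1.
rewrite scale1r [z + w]addrC subrK mul1r in E; rewrite E.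
rewrite (derive_val (is_derive := D c c1)) (le_trans (ler_norm_sum _ _ _))//.
have [_ bM] := Oc c c1.
apply: (@le_trans _ _ (\sum_(i < n) M * enorm w)).
  by apply: ler_sum => i _; rewrite normrM mulrC ler_pM// enorm_coord.
by rewrite sumr_const card_ord -[leLHS]mulr_natl mulrA.
Qed.

Lemma Ck1_le k l g : (k <= l)%N -> Ck1 Om l g -> Ck1 Om k g.
Proof.
rewrite leq_eqVlt => /predU1P[->//|kl] [Cg Lg]; split; first exact: Ck_le (ltnW kl) Cg.
move=> s sk; apply: locally_lipschitz_C1 => x Ox t.
have [d c] := Cg x Ox (t ++ s); rewrite /partials foldr_cat -!/(partials _ _) in d c.
split=> ts.
  by move=> i; apply: d; rewrite size_cat sk; move: ts kl; lia.
by apply: c; rewrite size_cat sk; move: ts kl; lia.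
Qed.

Lemma Ck1_iter_laplacian m j g : (j < m)%N -> Ck1 Om (2 * m).-1 g ->
  Ck1 Om (2 * (m - j)).-1 (iter j laplacian g).
Proof.
move=> + Cg; elim: j => [|j ih] jm; first by rewrite subn0.
rewrite iterS; apply: Ck1_laplacian.
have := ih (ltnW jm); congr Ck1; lia.
Qed.

End iterated_laplacians.

(** * Uniform bounds on compact sets *)

Section compact_bounds.
Context {R : realType} {n : nat}.
Implicit Types (K : set 'rV[R]_n) (h : 'rV[R]_n -> R).
Local Notation e_ i := (delta_mx ord0 i : 'rV[R]_n).

Lemma compact_norm_bound K h : compact K -> (forall y, K y -> {for y, continuous h}) ->
  exists M, forall y, K y -> `|h y| <= M.
Proof.
move=> /compact_near_coveringP cK ch.
have : \forall M \near +oo, K `<=` (fun y => `|h y| <= M).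
  apply: (cK _ _ (fun M y => `|h y| <= M)) => y Ky.
  have /(cvgrPdist_lt (FF := nbhs_filter y)) cy : h @ y --> h y by exact: ch.
  exists ([set z | `|h y - h z| < 1], [set M | `|h y| + 1 < M]).
    by split; [exact: cy|exact: nbhs_pinfty_gt].
  move=> [z M] [/= hz hM]; rewrite (le_trans _ (ltW hM))//.
  rewrite -[X in `|X|](subrK (h y)) (le_trans (ler_normD _ _))// addrC lerD//.
  by rewrite distrC ltW.
move=> [M [_ MK]]; exists (M + 1) => y Ky; apply: MK Ky.
by rewrite ltrDl.
Qed.

(** Near-covering compactness with the pair [(L, tau)] as parameter, [L] tending to infinity and
    [tau] to 0 from the right; the local bounds then hold for one pair on all of [K]. *)
Lemma compact_lipschitz_quotient Om K h i : compact K -> K `<=` Om ->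
  locally_lipschitz Om h ->
  exists L, exists2 tau, 0 < tau & forall y t, K y -> 0 < t < tau ->
    `|h (y + t *: e_ i) - h y| <= L * t.
Proof.
move=> /compact_near_coveringP cK KOm lh.
have nlim : Filter (filter_prod (@pinfty_nbhs R) (0 : R)^'+) by exact: filter_prod_filter.
have [|[A B] /= [nA nB] AB] := cK (R * R)%type _ (fun p y => forall t, 0 < t < p.2 ->
    `|h (y + t *: e_ i) - h y| <= p.1 * t) nlim.
  move=> y Ky.
  have [L L0 [U yU UL]] := lh y (KOm y Ky).
  have [d d0 dU] := nbhs_eball yU.
  exists (eball y (d / 2), [set p : R * R | L < p.1 /\ p.2 < d / 2]).
    split.
      have := @eball_open R n y (d / 2); rewrite openE; apply.
      by rewrite /eball/= subrr enorm0 divr_gt0.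
    exists ([set l | L < l], [set s | s < d / 2]); last by move=> [].
    by split => /=; [exact: nbhs_pinfty_gt (num_real L)|apply: nbhs_right_lt; rewrite divr_gt0].
  move=> [z [l s]] [/= zy [Ll sd]] t /andP[t0 ts].
  have e1 : enorm (z + t *: e_ i - z) = t by rewrite addrAC subrr add0r enorm_delta// ltW.
  rewrite (le_trans (UL _ _ _ _))//.
  - apply: dU; rewrite /eball/=; have := enorm_tri (z + t *: e_ i) z y.
    by rewrite e1; move: zy ts sd; rewrite /eball/=; lra.
  - by apply: dU; move: zy; rewrite /eball/=; lra.
  by rewrite e1 ler_wpM2r ?ltW.
have [L AL] := @filter_ex _ _ _ A nA.
have [tau [Btau t0]] := @filter_ex _ _ _ _ (filterI nB (nbhs_right_gt (0 : R))).
exists L, tau => // y t Ky; exact: (AB (L, tau) (conj AL Btau) y Ky).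
Qed.

End compact_bounds.

(** * The polylaplacian identity *)

Section compact_C11.
Context {R : realType} {n : nat}.
Local Notation e_ i := (delta_mx ord0 i : 'rV[R]_n).

Lemma compact_C11_bounds (Om K : set 'rV[R]_n) w (d : R) : compact K -> K `<=` Om ->
  Ck1 Om 1 w -> 0 < d -> exists M L tau, [/\ 0 < tau <= d,
    forall y, K y -> `|w y| <= M,
    forall y i, K y -> `|partial i w y| <= M &
    forall y i t, K y -> 0 < t < tau ->
      `|partial i w (y + t *: e_ i) - partial i w y| <= L * t].
Proof.
move=> cK KOm [Cw Lw] d0.
have [|M wM] := @compact_norm_bound R n K w cK.
  by move=> y /KOm Oy; have [_ c] := Cw y Oy [::]; exact: c.
have /choice[N wN] : forall i, exists N, forall y, K y -> `|partial i w y| <= N.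
  move=> i; apply: compact_norm_bound => // y /KOm Oy.
  by have [_ c] := Cw y Oy [:: i]; exact: c.
have /choice[L /choice[tau Ltau]] : forall i, exists L tau, 0 < tau /\
    forall y t, K y -> 0 < t < tau -> `|partial i w (y + t *: e_ i) - partial i w y| <= L * t.
  move=> i; have [|L [tau t0 H]] := @compact_lipschitz_quotient R n Om K (partial i w) i cK KOm.
    exact: (Lw [:: i]).
  by exists L, tau.
(* Sums of absolute values dominate the bounds for all directions at once; starting the minimum at
   [d] yields [tau <= d]. *)
exists (`|M| + \sum_i `|N i|), (\sum_i `|L i|), (\big[Num.min/d]_i tau i); split.
- rewrite bigmin_le_id andbT; apply: lt_bigmin => // i _; by have [] := Ltau i.
- by move=> y Ky; rewrite (le_trans (wM y Ky))// (le_trans (ler_norm _))// lerDl sumr_ge0.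
- move=> y i Ky; rewrite (le_trans (wN i y Ky))// (le_trans (ler_norm _))//.
  by rewrite (bigD1 i)//= addrCA lerDl addr_ge0// sumr_ge0.
move=> y i t Ky /andP[t0 tt].
have [_ /(_ y t Ky)] := Ltau i; rewrite t0 (lt_le_trans tt (bigmin_le _ _ _)) => /(_ isT).
move=> /le_trans; apply; rewrite ler_wpM2r ?(ltW t0)// (le_trans (ler_norm _))//.
by rewrite (bigD1 i)//= lerDl sumr_ge0.
Qed.

End compact_C11.

Section polylaplacian_identity.
Context {R : realType} {n m : nat}.
Local Notation leb := (lebesgue_rV R n).
Local Notation e_ i := (delta_mx ord0 i : 'rV[R]_n).
Variables (Om : set 'rV[R]_n) (u f g : 'rV[R]_n -> R) (x : 'rV[R]_n) (eps rho : R).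
Hypotheses (m_gt0 : (0 < m)%N) (n_gt0 : (0 < n)%N) (eps_gt0 : 0 < eps).
Hypotheses (oOm : open Om) (u_C : Ck1 Om (2 * m).-1 u).
Hypothesis u_eq : {ae leb, forall y, Om y -> is_polylaplacian m u y (f y)}.
Hypothesis eps_rho : m%:R * eps < rho.
Hypothesis ball_Om : [set y | enorm (y - x) <= rho] `<=` Om.
Hypotheses (bg : bmeas g) (fg : {ae leb, forall y, enorm (y - x) < rho -> f y = g y}).

Let B := eball x rho.
(** The chain for [avg_sub_pow_iter_kavg]: the cut-off iterated Laplacians of [u], ending with [g]
    at index [m]. *)
Let v i : 'rV[R]_n -> R := if (i < m)%N then iter i laplacian u \_ B else g.

Let BOm : B `<=` Om. Proof. by move=> y /ltW; exact: ball_Om. Qed.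

Let vE i y : (i < m)%N -> B y -> v i y = iter i laplacian u y.
Proof. by move=> im By; rewrite /v im patchE mem_set. Qed.

Let iter_C i : (i < m)%N -> Ck1 Om 1 (iter i laplacian u).
Proof. by move=> im; apply: Ck1_le (Ck1_iter_laplacian oOm im u_C) => //; lia. Qed.

Let compact_B : compact [set y : 'rV[R]_n | enorm (y - x) <= rho].
Proof. exact: compact_eball. Qed.

Let bv i : bmeas (v i).
Proof.
rewrite /v; case: ifPn => // im; have [Cw _] := iter_C im.
have cw y : Om y -> {for y, continuous (iter i laplacian u)}.
  by move=> Oy; have [_ c] := Cw y Oy [::]; exact: c.
split; first by apply: measurable_patch_open; [exact: eball_open|move=> y /BOm; exact: cw].
have [|M uM] := compact_norm_bound compact_B (h := iter i laplacian u).
  by move=> y /ball_Om; exact: cw.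
exists `|M| => y; rewrite patchE; case: ifPn; last by rewrite normr0.
by rewrite inE => /ltW yx; rewrite (le_trans (uM y yx))// ler_norm.
Qed.

Let mS : m%:R = m.-1%:R + 1 :> R. Proof. by rewrite natr1 prednK. Qed.

(** Before the last index the derivatives exist everywhere; at the last one, [u_eq] and [fg] each
    remove a null set. *)
Let laplacian_v i : (i < m)%N -> {ae leb, forall z, B z ->
  (forall j, derivable (partial j (iter i laplacian u)) z (e_ j)) /\
  \sum_j partial j (partial j (iter i laplacian u)) z = v i.+1 z}.
Proof.
move=> im; have [im1|mi1] := ltnP i.+1 m.
  apply: aeW => z Bz; rewrite vE//; split => // j.
  have [C _] := Ck1_iter_laplacian oOm im u_C.
  have [d _] := C z (BOm Bz) [:: j]; apply: d => /=; lia.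
have mE : m = i.+1 by apply/eqP; rewrite eqn_leq mi1.
apply: filterS2 u_eq fg => z uz fz Bz; have [d l] := uz (BOm Bz).
rewrite mE in d l; split; first exact: d.
by rewrite /v mE ltnn -(fz Bz) -l.
Qed.

Let step i y : (i < m)%N -> enorm (y - x) <= m.-1%:R * eps ->
  ball_avg eps (v i) y - v i y = kavg eps (v i.+1) y.
Proof.
move=> im yx; have d0 : 0 < rho - m%:R * eps by rewrite subr_gt0.
have [M [L [tau [/andP[t0 td] wM pM pL]]]] := compact_C11_bounds compact_B ball_Om (iter_C im) d0.
(* As [y] is within [(m - 1) eps] of [x], its ball of radius [rho'] is still in [B]. *)
pose rho' := eps + (rho - m%:R * eps).
have sub z : enorm (z - y) < rho' -> B z.
  move=> zy; rewrite /B /eball/= (le_lt_trans (enorm_tri z y x))//.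
  by move: zy yx; rewrite /rho' mS mulrDl mul1r; lra.
have subK z : enorm (z - y) < rho' -> enorm (z - x) <= rho by move=> /sub/ltW.
have er : eps < rho' by rewrite /rho' ltrDl.
rewrite vE//; last by apply: sub; rewrite subrr enorm0 (lt_trans eps_gt0).
rewrite (@eq_ball_avg _ _ eps (v i) (iter i laplacian u)); last first.
  by move=> z zy; rewrite vE//; apply: sub; exact: lt_trans er.
have [mv [N vN]] := bv i.+1; have [Cw _] := iter_C im.
apply: (@ball_avg_laplacian R n _ _ y eps rho' tau L M N) => //.
- by move=> z /sub/BOm Oz; have [_ c] := Cw z Oz [::]; exact: c.
- by move=> z j /sub/BOm Oz; have [d _] := Cw z Oz [::]; exact: d.
- by move=> z j /sub/BOm Oz; have [_ c] := Cw z Oz [:: j]; exact: c.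
- by move=> z /subK; exact: wM.
- by move=> z j /subK; exact: pM.
- by rewrite /rho' addrAC subrr add0r.
- by move=> j z t zy; apply: pL; apply: subK; exact: lt_trans er.
by apply: filterS (laplacian_v im) => z H /sub; exact: H.
Qed.

Lemma avg_sub_pow_polylaplacian : avg_sub_pow eps m u x =
  \int[lebesgue_rV R m]_(r in cube m eps)
    (multi_avg r f x * \prod_(i < m) kern n eps (r ord0 i)).
Proof.
have [mg [M gM]] := bg.
rewrite (@eq_avg_sub_pow _ _ eps m u (v 0%N))//; last first.
  by move=> y yx; rewrite vE// /B /eball/= (le_lt_trans yx).
rewrite (avg_sub_pow_iter_kavg eps_gt0 bv (x := x) step).
rewrite {1}/v ltnn -(Rintegral_multi_avg eps_gt0 m x mg gM).
apply: eq_Rintegral => r; rewrite inE => rC.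
rewrite -(ae_eq_multi_avg mg fg m_gt0 rC)// subrr enorm0 subr_ge0 ltW//.
Qed.

End polylaplacian_identity.

(** * Compositions and moments of the kernel *)

Section cube_products.
Context {R : realType}.
Local Notation lam := (@lebesgue_measure R).
Local Notation leb m := (lebesgue_rV R m).
Variable eps : R.
Hypothesis eps_gt0 : 0 < eps.

Lemma measurable_prod_coord m (phi : 'I_m -> R -> R) :
  (forall i, measurable_fun setT (phi i)) ->
  measurable_fun setT (fun r : 'rV[R]_m => \prod_i phi i (r ord0 i)).
Proof.
move=> mphi; apply: measurable_prod => i _.
exact: (measurableT_comp (mphi i) (@measurable_rV_coord R m i)).
Qed.

Lemma prod_coord_bound m (phi : 'I_m -> R -> R) N r :
  (forall i t, 0 <= t <= eps -> `|phi i t| <= N) -> cube m eps r ->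
  `|\prod_i phi i (r ord0 i)| <= N ^+ m.
Proof.
move=> bphi rC; rewrite normr_prod -[in leRHS](card_ord m) -prodr_const.
by apply: ler_prod => i _; rewrite normr_ge0 bphi.
Qed.

Lemma Rintegral_cube_prod m (phi : 'I_m -> R -> R) N :
  (forall i, measurable_fun setT (phi i)) ->
  (forall i t, 0 <= t <= eps -> `|phi i t| <= N) ->
  \int[leb m]_(r in cube m eps) (\prod_i phi i (r ord0 i)) =
  \prod_i \int[lam]_(t in `[0, eps]) phi i t.
Proof.
elim: m phi => [|m ih] phi mphi bphi.
  rewrite big_ord0 (@eq_Rintegral _ _ R (leb 0) _ (cst 1)); last first.
    by move=> r _; rewrite big_ord0.
  rewrite Rintegral_cst; last exact: measurable_cube.
  by rewrite mul1r [X in fine X](lebesgue_cube eps_gt0 0).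
have mP := measurable_prod_coord mphi.
rewrite (Rintegral_cubeS eps_gt0 mP (fun r => prod_coord_bound bphi (r := r))) big_ord_recl.
have E t (r : 'rV[R]_m) : \prod_i phi i (rV_cons (t, r) ord0 i) =
    phi ord0 t * \prod_i phi (lift ord0 i) (r ord0 i).
  rewrite big_ord_recl mxE unlift_none; apply: (congr1 (GRing.mul _)).
  by apply: eq_bigr => i _; rewrite mxE liftK.
have mC := @measurable_cube R eps m.
have Coo : (leb m (cube m eps) < +oo)%E by rewrite lebesgue_cube// ltry.
have ih' := ih (fun i => phi (lift ord0 i)) (fun i => mphi _) (fun i => bphi _).
rewrite (@eq_Rintegral _ _ R lam _ (fun t => phi ord0 t *
    \prod_i \int[lam]_(t in `[0, eps]) phi (lift ord0 i) t)); last first.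
  move=> t _; rewrite -ih' -RintegralZl//; last first.
    apply: (bounded_Rintegrable (M := N ^+ m)) => //.
      apply: measurable_funTS; exact: (measurable_prod_coord (fun i => mphi (lift ord0 i))).
    by move=> r rC; exact: (prod_coord_bound (fun i => bphi (lift ord0 i)) rC).
  by apply: eq_Rintegral => r _; rewrite E.
rewrite RintegralZr//; apply: (bounded_Rintegrable (M := N)) => //=.
- by rewrite lebesgue_measure_itv/= lte_fin; case: ifP; rewrite ltry.
- by apply: measurable_funTS; exact: mphi.
by move=> t; rewrite in_itv/=; exact: bphi.
Qed.

(** The two powers in the kernel give [1 / (2j+2) - 1 / (n+2j+2)], divided by [n]; the [n] cancels
    and leaves a factor of [ccoef]. *)
Lemma Rintegral_kern_moment n j : (0 < n)%N ->
  \int[lam]_(t in `[0, eps]) ((t / eps) ^+ (2 * j) * kern n eps t) =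
  eps ^+ 2 * ((2 * j.+1) * (n + 2 * j.+1))%N%:R^-1.
Proof.
move=> n0; have e0 : eps != 0 by rewrite gt_eqF.
have intX k : lam.-integrable `[0, eps] (EFin \o (fun t : R => t ^+ k)).
  apply: continuous_compact_integrable; first exact: segment_compact.
  by apply: continuous_in_subspaceT => s _; exact: exprn_continuous.
have intZ c k : lam.-integrable `[0, eps] (EFin \o (fun t : R => c * t ^+ k)).
  by apply: (integrableZl _ _ (intX k)).
pose c : R := (n%:R * eps ^+ (2 * j))^-1; pose d : R := (n%:R * eps ^+ (2 * j + n))^-1.
rewrite (@eq_Rintegral _ _ R lam _ (fun t => c * t ^+ (2 * j).+1 - d * t ^+ (2 * j + n).+1)); last first.
  move=> t _; rewrite /kern /c /d !exprMn !exprVn !exprS !exprD.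
  by field; rewrite !expf_neq0// pnatr_eq0 -lt0n n0.
rewrite RintegralB// !RintegralZl// !Rintegral_exprn ?ltW// !expr0n/= !subr0.
rewrite /c /d !exprS !exprD !natrM !natrD.
have j0 : 0 <= j%:R :> R by []; have n1 : 0 < n%:R :> R by rewrite ltr0n.
by field; rewrite !expf_neq0// !gt_eqF//; lra.
Qed.

End cube_products.

(** * Combinatorics of compositions *)

Section compositions.
Context {R : realType}.

(** Lay [k] blocks of lengths [a i] end to end: [e p] is the rank of position [p] inside its block.
    It does not depend on [F], so one [e] serves several products. *)
Lemma prod_parts k (a : nat -> nat) : exists e : nat -> nat, forall F : nat -> nat -> R,
  \prod_(i < k) \prod_(j < a i) F ((\sum_(l < i) a l) + j)%N j =
  \prod_(p < (\sum_(l < k) a l)%N) F p (e p).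
Proof.
elim: k => [|k [e ih]]; first by exists id => F; rewrite !big_ord0.
pose s := (\sum_(l < k) a l)%N.
exists (fun p => if (p < s)%N then e p else p - s)%N => F.
rewrite !big_ord_recr/= ih -/s big_split_ord/=.
congr (_ * _); apply: eq_bigr => p _; first by rewrite ltn_ord.
by rewrite ltnNge leq_addr addKn.
Qed.

Lemma part_exponents m k (a : {ffun 'I_k -> 'I_m.+1}) : a \in compositions m k ->
  exists e : nat -> nat, forall F : nat -> nat -> R,
  \prod_(i < k) \prod_(j < a i) F (part_offset a i + j)%N j = \prod_(p < m) F p (e p).
Proof.
rewrite inE => /andP[_ /eqP sa].
pose b l := nth 0%N [seq val (a i) | i <- enum 'I_k] l.
have bE (i : 'I_k) : b i = a i by rewrite /b (nth_map i) ?size_enum_ord// nth_ord_enum.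
have [e He] := prod_parts k b; exists e => F; have := He F.
have -> : (\sum_(l < k) b l)%N = m by rewrite -[RHS]sa; apply: eq_bigr => i _; exact: bE.
move<-; apply: eq_bigr => i _; rewrite bE; apply: eq_bigr => j _; congr (F (_ + _)%N _).
rewrite /part_offset (eq_bigr (fun l : 'I_k => b l)) => [|l _]; last by rewrite bE.
by rewrite (big_ord_widen k b)// ltnW.
Qed.

Lemma entriesE m (r : 'rV[R]_m) (p : 'I_m) : (entries r)`_p = r ord0 p.
Proof. by rewrite /entries (nth_map p) ?size_enum_ord// nth_ord_enum. Qed.

Lemma bcoef_monomials m k : exists e : {ffun 'I_k -> 'I_m.+1} -> nat -> nat,
  (forall eps (r : 'rV[R]_m), bcoef k eps r =
    \sum_(a in compositions m k) \prod_(p < m) (r ord0 p / eps) ^+ (2 * e a p)) /\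
  (forall n, \sum_(a in compositions m k) \prod_(i < k) ccoef n (a i) =
    \sum_(a in compositions m k)
      \prod_(p < m) (((2 * (e a p).+1) * (n + 2 * (e a p).+1))%N%:R)^-1 :> R).
Proof.
have /choice[e He] : forall a : {ffun 'I_k -> 'I_m.+1}, exists e : nat -> nat,
    a \in compositions m k -> forall F : nat -> nat -> R,
    \prod_(i < k) \prod_(j < a i) F (part_offset a i + j)%N j = \prod_(p < m) F p (e p).
  move=> a; have [/part_exponents[e He]|_] := boolP (a \in compositions m k).
    by exists e.
  by exists id.
exists e; split => [eps r|n]; apply: eq_bigr => a aC.
  rewrite (He a aC (fun p j => ((entries r)`_p / eps) ^+ (2 * j))).
  by apply: eq_bigr => p _; rewrite entriesE.
rewrite -(He a aC (fun p j => (((2 * j.+1) * (n + 2 * j.+1))%N%:R)^-1)).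
by apply: eq_bigr => i _; rewrite /ccoef big_add1 big_mkord.
Qed.

(** The only composition of [m] into [m] parts is all ones, and then every exponent is 0. Hence the
    term [l = 0] of the expansion is exactly [f x]. *)
Lemma bcoef_full m eps (r : 'rV[R]_m) : bcoef m eps r = 1.
Proof.
have one1 (a : {ffun 'I_m -> 'I_m.+1}) : a \in compositions m m -> forall i, a i = 1%N :> nat.
  rewrite inE => /andP[/forallP a0 /eqP sa] i; apply/eqP.
  rewrite eqn_leq a0 andbT leqNgt; apply/negP => a1.
  have : (\sum_(j < m | j != i) 1 <= \sum_(j < m | j != i) a j)%N.
    by apply: leq_sum => j _; exact: a0.
  have : (\sum_(j < m) 1 = m)%N by rewrite sum1_card card_ord.
  move: sa a1; rewrite (bigD1 i)//= => sa a1; rewrite (bigD1 i)//=.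
  move: (\sum_(j < m | j != i) a j)%N (\sum_(j < m | j != i) 1)%N (nat_of_ord (a i)) sa a1.
  by move=> S T A; lia.
have ones (i : 'I_m) : [ffun _ : 'I_m => inord 1 : 'I_m.+1] i = 1%N :> nat.
  by rewrite ffunE inordK// ltnS (leq_ltn_trans (leq0n i)).
have onesC : [ffun _ : 'I_m => inord 1 : 'I_m.+1] \in compositions m m.
  rewrite inE; apply/andP; split; first by apply/forallP => l; rewrite ones.
  by rewrite (eq_bigr (fun=> 1%N)) ?sum1_card ?card_ord// => l _; rewrite ones.
rewrite /bcoef (big_pred1 [ffun=> inord 1]) => [|a] /=.
  apply: big1 => i _; apply: big1 => j _.
  by have := ltn_ord j; rewrite [X in (_ < X)%N](ones i); case: (val j).
apply/idP/eqP => [/one1 aE|->//].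
by apply/ffunP => i; apply/val_inj => /=; rewrite aE ones.
Qed.

Lemma bcoef_bound m k eps (r : 'rV[R]_m) : 0 < eps -> cube m eps r ->
  `|bcoef k eps r| <= #|compositions m k|%:R.
Proof.
move=> eps0 rC; have [e [-> _]] := bcoef_monomials m k.
rewrite (le_trans (ler_norm_sum _ _ _))// -sum1_card natr_sum.
apply: ler_sum => a _; rewrite normr_prod prodr_ile1// => p _; rewrite normr_ge0/=.
have /andP[p0 p1] := rC p.
by rewrite normrX exprn_ile1 ?normr_ge0// ger0_norm ?divr_ge0 ?(ltW eps0)// ler_pdivrMr// mul1r.
Qed.

(** Lowering every part by 1 injects the compositions into the tuples of naturals of sum [m - k],
    counted by [card_ord_partitions]. *)
Lemma card_compositions m k : (0 < k <= m)%N -> (#|compositions m k| <= 'C(m.-1, k.-1))%N.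
Proof.
case: k => // k /andP[_ km].
have -> : m.-1 = (k + (m - k.+1))%N by lia.
rewrite -pred_Sn -card_ord_partitions.
pose h (a : {ffun 'I_k.+1 -> 'I_m.+1}) : k.+1.-tuple 'I_(m - k.+1).+1 :=
  [tuple inord (a i).-1 | i < k.+1].
have a0 a i : a \in compositions m k.+1 -> (0 < a i)%N.
  by rewrite inE => /andP[/forallP/(_ i)].
have sum_pred (b : 'I_k.+1 -> nat) : (forall i, 0 < b i)%N -> (\sum_i b i = m)%N ->
    (\sum_i (b i).-1 = m - k.+1)%N.
  move=> b0 <-; rewrite -[X in (_ - X)%N](card_ord k.+1) -sum1_card -sumnB// => *.
  by apply: eq_bigr => i _; rewrite subn1.
have sa a : a \in compositions m k.+1 -> (\sum_(i < k.+1) (a i).-1 = m - k.+1)%N.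
  move=> aC; apply: sum_pred => [i|]; first exact: a0.
  by move: aC; rewrite inE => /andP[_ /eqP].
have hE a i : a \in compositions m k.+1 -> tnth (h a) i = (a i).-1 :> nat.
  move=> aC; rewrite tnth_mktuple inordK// ltnS -(sa a aC) (bigD1 i)//=.
  exact: leq_addr.
rewrite -(card_in_imset (f := h)); last first.
  move=> a b aC bC ab; apply/ffunP => i; apply/val_inj => /=.
  have := hE a i aC; rewrite ab hE// => E.
  by rewrite -(prednK (a0 a i aC)) -(prednK (a0 b i bC)) E.
apply: subset_leq_card; apply/fintype.subsetP => _ /imsetP[a aC ->]; rewrite inE big_tuple.
by rewrite (eq_bigr (fun i => (a i).-1)) ?sa// => i _; rewrite hE.
Qed.

End compositions.

(** * The remainder as a difference of integrals *)

Section remainder_integral.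
Context {R : realType}.
Local Notation lam := (@lebesgue_measure R).
Local Notation leb m := (lebesgue_rV R m).
Variables (m n : nat) (eps : R).
Hypotheses (n_gt0 : (0 < n)%N) (eps_gt0 : 0 < eps).
Local Notation K := (fun r : 'rV[R]_m => \prod_(i < m) kern n eps (r ord0 i)).

Let mC := @measurable_cube R eps m.
Let Coo : (leb m (cube m eps) < +oo)%E. Proof. by rewrite lebesgue_cube// ltry. Qed.
Let mK : measurable_fun setT K. Proof. exact: measurable_prod_kern. Qed.

Let phi (e : nat -> nat) (p : 'I_m) (t : R) := (t / eps) ^+ (2 * e p) * kern n eps t.

Let mphi e p : measurable_fun setT (phi e p).
Proof.
apply: measurable_funM; last exact: measurable_kern.
by apply: measurable_funX; exact: measurable_funM.
Qed.

Let phi_bound e p t : 0 <= t <= eps -> `|phi e p t| <= eps.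
Proof.
move=> /[dup] tI /andP[t0 te]; rewrite normrM -[leRHS]mul1r ler_pM ?kern_norm//.
by rewrite normrX exprn_ile1 ?normr_ge0// ger0_norm ?divr_ge0 ?(ltW eps_gt0)// ler_pdivrMr// mul1r.
Qed.

Let bcoef_kernE k : exists e : {ffun 'I_k -> 'I_m.+1} -> nat -> nat,
  (forall r, bcoef k eps r * K r =
    \sum_(a in compositions m k) \prod_(p < m) phi (e a) p (r ord0 p)) /\
  \sum_(a in compositions m k) \prod_(i < k) ccoef n (a i) =
    \sum_(a in compositions m k)
      \prod_(p < m) (((2 * (e a p).+1) * (n + 2 * (e a p).+1))%N%:R)^-1 :> R.
Proof.
have [e [be ce]] := @bcoef_monomials R m k; exists e; split => [r|]; last exact: ce.
by rewrite be mulr_suml; apply: eq_bigr => a _; rewrite -big_split.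
Qed.

Let integrable_phi e : (leb m).-integrable (cube m eps)
  (EFin \o (fun r : 'rV[R]_m => \prod_(p < m) phi e p (r ord0 p))).
Proof.
apply: (bounded_Rintegrable (M := eps ^+ m)) => //.
  by apply: measurable_funTS; exact: measurable_prod_coord (mphi e).
by move=> r rC; exact: (prod_coord_bound (phi_bound e) rC).
Qed.

Lemma integrable_bcoef_kern k :
  (leb m).-integrable (cube m eps) (EFin \o (fun r => bcoef k eps r * K r)).
Proof.
have [e [E _]] := bcoef_kernE k.
have -> : EFin \o (fun r => bcoef k eps r * K r) = fun r : 'rV[R]_m =>
    (\sum_(a in compositions m k) (\prod_(p < m) phi (e a) p (r ord0 p))%:E)%E.
  by apply/funext => r /=; rewrite E sumEFin.
by apply: integrable_sum => // a _; exact: integrable_phi.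
Qed.

Lemma Rintegral_bcoef_kern k : \int[leb m]_(r in cube m eps) (bcoef k eps r * K r) =
  eps ^+ (2 * m) * \sum_(a in compositions m k) \prod_(i < k) ccoef n (a i).
Proof.
have [e [E ->]] := bcoef_kernE k.
have -> : (fun r => bcoef k eps r * K r) = fun r : 'rV[R]_m =>
    \sum_(a <- enum (compositions m k)) \prod_(p < m) phi (e a) p (r ord0 p).
  by apply/funext => r; rewrite E big_enum.
rewrite Rintegral_sum//= big_enum/= mulr_sumr; apply: eq_bigr => a _.
rewrite (Rintegral_cube_prod eps_gt0 (mphi (e a)) (phi_bound (e a))).
rewrite (eq_bigr (fun p : 'I_m => eps ^+ 2 *
  (((2 * (e a p).+1) * (n + 2 * (e a p).+1))%N%:R)^-1)); last first.
  by move=> p _; rewrite -Rintegral_kern_moment.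
by rewrite big_split/= prodr_const card_ord -exprM.
Qed.

Lemma Rintegral_prod_kern : \int[leb m]_(r in cube m eps) K r =
  eps ^+ (2 * m) / (2 * (n%:R + 2)) ^+ m.
Proof.
transitivity (\int[leb m]_(r in cube m eps) \prod_(p < m) phi (fun=> 0%N) p (r ord0 p)).
  by apply: eq_Rintegral => r _; apply: eq_bigr => p _; rewrite /phi expr0 mul1r.
rewrite (Rintegral_cube_prod eps_gt0 (mphi _) (phi_bound _)).
rewrite (eq_bigr (fun=> eps ^+ 2 * (2 * (n%:R + 2))^-1)); last first.
  by move=> p _; rewrite /phi Rintegral_kern_moment// muln1 natrM natrD.
by rewrite prodr_const card_ord exprMn -exprM exprVn.
Qed.

Variables (f g : 'rV[R]_n -> R) (x : 'rV[R]_n).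
Hypothesis bg : bmeas g.
Hypothesis fg : forall r, cube m eps r -> multi_avg r f x = multi_avg r g x.

Let integrable_multi_avg :
  (leb m).-integrable (cube m eps) (EFin \o (fun r => multi_avg r f x * K r)).
Proof.
have [mg [M gM]] := bg; have M0 : 0 <= M by exact: le_trans (normr_ge0 _) (gM 0).
apply: (eq_integrable _ (EFin \o (fun r => multi_avg r g x * K r))) => //.
  by move=> r; rewrite inE => /fg /= ->.
apply: (bounded_Rintegrable (M := M * eps ^+ m)) => //.
  apply: measurable_funTS; apply: measurable_funM => //.
  exact: (measurableT_comp (measurable_multi_avg mg) (pair2_measurable x)).
by move=> r rC; rewrite normrM ler_pM ?multi_avg_bound ?prod_kern_bound.
Qed.

Let intb l : (leb m).-integrable (cube m eps)
  (EFin \o (fun r => avg_sub_pow eps l f x * (bcoef (m - l) eps r * K r))).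
Proof. exact: (integrableZl _ _ (integrable_bcoef_kern (m - l))). Qed.

Let integrable_expansion : (leb m).-integrable (cube m eps)
  (EFin \o (fun r => \sum_(l < m) avg_sub_pow eps l f x * (bcoef (m - l) eps r * K r))).
Proof.
have -> : EFin \o (fun r => \sum_(l < m) avg_sub_pow eps l f x * (bcoef (m - l) eps r * K r)) =
    fun r : 'rV[R]_m => (\sum_(l < m) (avg_sub_pow eps l f x * (bcoef (m - l) eps r * K r))%:E)%E.
  by apply/funext => r /=; rewrite sumEFin.
by apply: integrable_sum => // l _; exact: intb.
Qed.

Let integrandE r : (multi_avg r f x -
    \sum_(l < m) bcoef (m - l) eps r * avg_sub_pow eps l f x) * K r =
  multi_avg r f x * K r - \sum_(l < m) avg_sub_pow eps l f x * (bcoef (m - l) eps r * K r).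
Proof.
rewrite mulrBl mulr_suml; congr (_ - _).
by apply: eq_bigr => l _; ring.
Qed.

(** The values [avg_sub_pow eps l f x] are constant in [r], so only the integrals of [bcoef] against
    the kernel enter; [g] serves to make the other term integrable. *)
Lemma remainderE : remainder m f eps x =
  \int[leb m]_(r in cube m eps) (multi_avg r f x * K r) -
  eps ^+ (2 * m) * \sum_(l < m) ctilde n m l * avg_sub_pow eps l f x.
Proof.
rewrite /remainder; under eq_Rintegral do rewrite integrandE.
rewrite RintegralB//.
congr (_ - _); rewrite Rintegral_sum// mulr_sumr; apply: eq_bigr => l _.
rewrite RintegralZl//; last exact: integrable_bcoef_kern.
by rewrite Rintegral_bcoef_kern /ctilde; ring.
Qed.

Lemma integrable_remainder : (leb m).-integrable (cube m eps)
  (EFin \o (fun r => (multi_avg r f x -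
    \sum_(l < m) bcoef (m - l) eps r * avg_sub_pow eps l f x) * K r)).
Proof.
have -> : EFin \o (fun r => (multi_avg r f x -
    \sum_(l < m) bcoef (m - l) eps r * avg_sub_pow eps l f x) * K r) =
    fun r => ((multi_avg r f x * K r)%:E -
      (\sum_(l < m) avg_sub_pow eps l f x * (bcoef (m - l) eps r * K r))%:E)%E.
  by apply/funext => r /=; rewrite integrandE EFinB.
exact: (integrableB mC integrable_multi_avg integrable_expansion).
Qed.

End remainder_integral.

(** * The remainder *)

Section remainder_bound.
Context {R : realType}.
Local Notation leb m := (lebesgue_rV R m).
Variables (m n : nat) (eps : R).
Hypotheses (m_gt0 : (0 < m)%N) (n_gt0 : (0 < n)%N) (eps_gt0 : 0 < eps).
Local Notation K := (fun r : 'rV[R]_m => \prod_(i < m) kern n eps (r ord0 i)).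

Lemma bmeas_multi_avg k (r : 'rV[R]_k) (g : 'rV[R]_n -> R) : bmeas g -> bmeas (multi_avg r g).
Proof.
move=> [mg [M gM]]; split; first exact: measurable_multi_avg_fix.
by exists M => x; apply: multi_avg_bound => //; exact: le_trans (normr_ge0 _) (gM 0).
Qed.

Lemma bmeas_cst (c : R) : bmeas (cst c : 'rV[R]_n -> R).
Proof. by split; [exact: measurable_cst|exists `|c|]. Qed.

(** The radii are positive because an average reproduces the constant [c] only then; each average
    then preserves the bound. *)
Lemma multi_avg_sub_bound k (r : 'rV[R]_k) (g : 'rV[R]_n -> R) (c eta : R) x :
  bmeas g -> 0 <= eta -> (forall i, 0 < r ord0 i <= eps) ->
  (forall y, enorm (y - x) <= k%:R * eps -> `|g y - c| <= eta) ->
  `|multi_avg r g x - c| <= eta.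
Proof.
move=> bg eta0; elim: k r x => [|k ih] r x r0 gc.
  by rewrite /multi_avg /entries enum_ord0; apply: gc; rewrite subrr enorm0 mul0r.
have /andP[t0 te] := r0 ord0; set t := r ord0 ord0 in t0 te; set q := (rV_uncons r).2.
have q0 i : 0 < q ord0 i <= eps by rewrite mxE.
have -> : multi_avg r g = ball_avg t (multi_avg q g).
  by rewrite -multi_avg_cons -[r in LHS]rV_unconsK.
rewrite -{1}(ball_avg_cst c x t0) -(ball_avg_bmeasB t x (bmeas_multi_avg q bg) (bmeas_cst c)).
have [mh _] := bmeasB (bmeas_multi_avg q bg) (bmeas_cst c).
apply: ball_avg_bound => // y yx; apply: ih => // z zy; apply: gc.
by rewrite (le_trans (enorm_tri z y x))// -natr1 mulrDl mul1r lerD// (le_trans (ltW yx)).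
Qed.

Lemma sum_bin_pow2 k :
  1 + \sum_(l < k) 'C(k, l.+1)%:R * 2 ^+ l <= 3 ^+ k - 2 ^+ k + 1 :> R.
Proof.
have E3 : 3 ^+ k = \sum_(l < k.+1) 'C(k, l)%:R * 2 ^+ l :> R.
  rewrite (_ : 3 = 1 + 2) ?exprDn; last by rewrite -natr1 addrC.
  by apply: eq_bigr => l _; rewrite expr1n mul1r mulr_natl.
have E2 : 2 ^+ k = \sum_(l < k.+1) 'C(k, l)%:R :> R.
  rewrite (_ : 2 = 1 + 1)// exprDn; apply: eq_bigr => l _.
  by rewrite !expr1n mul1r.
rewrite E3 E2 -sumrB big_ord_recl bin0 expr0 mulr1 subrr add0r addrC lerD2r.
apply: ler_sum => l _; rewrite lift0 -[X in _ <= _ - X]mulr1 -mulrBr ler_wpM2l//.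
have : 1 <= 2 ^+ l :> R by rewrite exprn_ege1// ler1n.
by rewrite exprS; lra.
Qed.

Variables (f g : 'rV[R]_n -> R) (x : 'rV[R]_n) (eta : R).
Hypotheses (bg : bmeas g) (eta_ge0 : 0 <= eta).
Hypothesis fg : forall r, cube m eps r -> multi_avg r f x = multi_avg r g x.
Hypothesis fg_pow : forall l, (l < m)%N -> avg_sub_pow eps l f x = avg_sub_pow eps l g x.
Hypothesis g_osc : forall y, enorm (y - x) <= m%:R * eps -> `|g y - g x| <= eta.
Hypothesis g_avg : forall y, enorm (y - x) <= m.-1%:R * eps ->
  `|ball_avg eps g y - g y| <= eta.

Let C : R := 3 ^+ m.-1 - 2 ^+ m.-1 + 1.

(** The innermost [A - I] costs only [eta], by [g_avg]; each of the [l] others at most doubles the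
    bound. *)
Let pow_bound l : (l.+1 < m)%N -> `|avg_sub_pow eps l.+1 g x| <= 2 ^+ l * eta.
Proof.
move=> lm; rewrite avg_sub_powSr; apply: avg_sub_pow_bound => //.
  by apply: bmeasB => //; exact: bmeas_ball_avg.
move=> y yx; apply: g_avg; rewrite (le_trans yx)// ler_wpM2r ?(ltW eps_gt0)// ler_nat.
by lia.
Qed.

Let integrand_bound r : cube m eps r -> (forall i, 0 < r ord0 i) ->
  `|multi_avg r f x - \sum_(l < m) bcoef (m - l) eps r * avg_sub_pow eps l f x| <= C * eta.
Proof.
move=> rC r0; rewrite fg//.
have rI i : 0 < r ord0 i <= eps by have /andP[_ ->] := rC i; rewrite r0.
have mavg := multi_avg_sub_bound bg eta_ge0 rI g_osc.
(* The term [l = 0] has coefficient 1 and is paired with the multiple average; the others are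
   bounded one by one. *)
have -> : \sum_(l < m) bcoef (m - l) eps r * avg_sub_pow eps l f x =
    g x + \sum_(l < m.-1) bcoef (m - l.+1) eps r * avg_sub_pow eps l.+1 g x.
  have S (F : nat -> R) : \sum_(l < m) F l = F 0%N + \sum_(l < m.-1) F l.+1.
    by rewrite -[in LHS](prednK m_gt0) big_ord_recl.
  rewrite (S (fun l => bcoef (m - l) eps r * avg_sub_pow eps l f x)).
  rewrite subn0 bcoef_full mul1r fg_pow//; congr (_ + _).
  by apply: eq_bigr => l _; rewrite fg_pow//; have := ltn_ord l; lia.
rewrite opprD addrA (le_trans (ler_normB _ _))//.
apply: (@le_trans _ _ ((1 + \sum_(l < m.-1) 'C(m.-1, l.+1)%:R * 2 ^+ l) * eta)); last first.
  by rewrite ler_wpM2r// sum_bin_pow2.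
rewrite mulrDl mul1r lerD// (le_trans (ler_norm_sum _ _ _))// mulr_suml.
apply: ler_sum => l _; rewrite normrM -mulrA.
have lm : (l.+1 < m)%N by have := ltn_ord l; lia.
rewrite ler_pM ?pow_bound// (le_trans (bcoef_bound _ eps_gt0 rC))// ler_nat.
rewrite (leq_trans (card_compositions _))//; first by lia.
(* Symmetry of binomials: the [m - l - 1] parts give [C(m-1, m-l-2) = C(m-1, l+1)]. *)
by rewrite -(@bin_sub m.-1 l.+1)//; have -> : ((m - l.+1).-1 = m.-1 - l.+1)%N by lia.
Qed.

Let K_ge0 r : cube m eps r -> 0 <= K r.
Proof. by move=> rC; apply: prodr_ge0 => i _; exact: kern_ge0. Qed.

Lemma remainder_bound : `|remainder m f eps x| <=
  C / (2 * (n%:R + 2)) ^+ m * eta * eps ^+ (2 * m).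
Proof.
have mC := @measurable_cube R eps m.
have Coo : (leb m (cube m eps) < +oo)%E by rewrite lebesgue_cube// ltry.
have intF := integrable_remainder eps_gt0 bg fg.
rewrite (le_trans (le_normr_Rintegral mC intF))//.
have intK : (leb m).-integrable (cube m eps) (EFin \o K).
  apply: (bounded_Rintegrable (M := eps ^+ m)) => //; last by move=> r rC; exact: prod_kern_bound.
  by apply: measurable_funTS; exact: measurable_prod_kern.
apply: (@le_trans _ _ (\int[leb m]_(r in cube m eps) (C * eta * K r))).
  apply: le_Rintegral => //; [exact: integrable_norm|exact: (integrableZl _ _ intK)|].
  move=> r rC; rewrite normrM [`|K r|]ger0_norm ?K_ge0//.
  have [r0|] := pselect (forall i, 0 < r ord0 i); first by rewrite ler_wpM2r ?K_ge0 ?integrand_bound.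
  move=> /existsNP[i /negP]; rewrite -leNgt => ri; have /andP[ri0 _] := rC i.
  have ri00 : r ord0 i = 0 by apply/eqP; rewrite eq_le ri.
  have K0 : \prod_(j < m) kern n eps (r ord0 j) = 0.
    by rewrite (bigD1 i)//= ri00 /kern !mul0r.
  by rewrite K0 !mulr0.
rewrite RintegralZl// Rintegral_prod_kern//.
by rewrite le_eqVlt; apply/orP; left; apply/eqP; ring.
Qed.

End remainder_bound.

(** * Expansion and remainder estimate for [f] itself *)

Section oscillation.
Context {R : realType} {n m : nat}.
Local Notation leb := (lebesgue_rV R n).
Variables (Om : set 'rV[R]_n) (f : 'rV[R]_n -> R) (x : 'rV[R]_n) (eps rho : R).
Hypotheses (m_gt0 : (0 < m)%N) (n_gt0 : (0 < n)%N) (eps_gt0 : 0 < eps).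
Hypothesis f_Linfty : Linfty_loc Om f.
Hypothesis eps_rho : m%:R * eps < rho.
Hypothesis ball_Om : [set y | enorm (y - x) <= rho] `<=` Om.

(** The averages tolerate a null set, but [- I] reads the value at the centre, hence the pointwise
    hypothesis at [y]. *)
Lemma ae_eq_avg_sub_pow g l y : bmeas g ->
  {ae leb, forall y, enorm (y - x) < rho -> f y = g y} ->
  enorm (y - x) <= rho - l%:R * eps -> f y = g y ->
  avg_sub_pow eps l f y = avg_sub_pow eps l g y.
Proof.
move=> bg fg; elim: l y => [//|l ih] y yx fgy.
rewrite /avg_sub_pow !iterS -!/(avg_sub_pow _ _ _).
have yl : enorm (y - x) <= rho - l%:R * eps.
  by rewrite (le_trans yx)// -natr1 mulrDl mul1r; move: eps_gt0; lra.
rewrite ih//; congr (_ - _); have [mA _] := bmeas_avg_sub_pow eps l bg.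
apply: ae_eq_ball_avg => //; apply: filterS fg => z fgz zy.
have zx : enorm (z - x) <= rho - l%:R * eps.
  rewrite (le_trans (enorm_tri z y x))//; move: yx zy.
  by rewrite -natr1 mulrDl mul1r; lra.
apply: ih => //; apply: fgz; rewrite (le_lt_trans (enorm_tri z y x))//.
move: yx zy; rewrite -natr1 mulrDl mul1r.
have : 0 <= l%:R * eps by rewrite mulr_ge0 ?(ltW eps_gt0).
by lra.
Qed.

Let rho_gt0 : 0 < rho.
Proof. by rewrite (le_lt_trans _ eps_rho)// mulr_ge0 ?(ltW eps_gt0). Qed.

Lemma remainder_expansion u : open Om -> Ck1 Om (2 * m).-1 u ->
  {ae leb, forall y, Om y -> is_polylaplacian m u y (f y)} ->
  avg_sub_pow eps m u x =
    eps ^+ (2 * m) * (\sum_(l < m) ctilde n m l * avg_sub_pow eps l f x) +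
    remainder m f eps x.
Proof.
move=> oOm u_C u_eq; have [g [bg fg _ _]] := borel_representative f_Linfty rho_gt0 ball_Om.
rewrite (avg_sub_pow_polylaplacian m_gt0 n_gt0 eps_gt0 oOm u_C u_eq eps_rho ball_Om bg fg).
rewrite (remainderE n_gt0 eps_gt0 bg) 1?addrC ?subrK// => r rC.
have [mg _] := bg; apply: (ae_eq_multi_avg mg fg m_gt0 rC).
by rewrite subrr enorm0 subr_ge0 ltW.
Qed.

(** The estimate only compares a point with [x], or a point with the centre of an [eps]-ball
    containing it. Such pairs are at most [m eps] apart, which yields [omega (m eps)] rather than
    the value at the diameter. *)
Lemma remainder_oscillation eta : 0 <= eta ->
  (forall y z, enorm (y - x) <= m%:R * eps -> enorm (z - x) <= m%:R * eps ->
    enorm (y - z) <= m%:R * eps -> `|f y - f z| <= eta) ->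
  `|remainder m f eps x| <=
    (3 ^+ m.-1 - 2 ^+ m.-1 + 1) / (2 * (n%:R + 2)) ^+ m * eta * eps ^+ (2 * m).
Proof.
move=> eta0 f_osc; have [g [bg fg gx gE]] := borel_representative f_Linfty rho_gt0 ball_Om.
have meps : 0 <= m%:R * eps by rewrite mulr_ge0 ?(ltW eps_gt0).
have xx : enorm (x - x) <= m%:R * eps by rewrite subrr enorm0.
have g_osc y z : enorm (y - x) <= m%:R * eps -> enorm (z - x) <= m%:R * eps ->
    enorm (y - z) <= m%:R * eps -> `|g y - g z| <= eta.
  (* Each value of [g] is that of [f] at the same point or at [x]; replacing a point by [x] keeps
     the pair within [m eps]. *)
  move=> yx zx yz; have [->|[_ ->]] := gE y; have [->|[_ ->]] := gE z.
  - by rewrite subrr normr0.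
  - by rewrite f_osc// enormB.
  - exact: f_osc.
  - exact: f_osc.
have [mg _] := bg.
apply: (remainder_bound m_gt0 n_gt0 eps_gt0 bg eta0) => [r rC|l lm|y yx|y yx].
- apply: (ae_eq_multi_avg mg fg m_gt0 rC).
  by rewrite subrr enorm0 subr_ge0 ltW.
- apply: ae_eq_avg_sub_pow => //; rewrite subrr enorm0 subr_ge0 (le_trans _ (ltW eps_rho))//.
  by rewrite ler_wpM2r ?(ltW eps_gt0)// ler_nat ltnW.
- exact: g_osc.
have mS : m%:R = m.-1%:R + 1 :> R by rewrite natr1 prednK.
rewrite -[X in _ - X](ball_avg_cst (g y) y eps_gt0) -(ball_avg_bmeasB eps y bg (bmeas_cst n _)).
have [mh _] := bmeasB bg (bmeas_cst n (g y)).
apply: ball_avg_bound => // z zy.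
have le1m : eps <= m%:R * eps by rewrite ler_peMl ?(ltW eps_gt0)// ler1n.
apply: g_osc; last exact: le_trans (ltW zy) le1m.
  by rewrite (le_trans (enorm_tri z y x))// mS mulrDl mul1r addrC lerD// ltW.
by rewrite (le_trans yx)// ler_wpM2r ?(ltW eps_gt0)// ler_nat leq_pred.
Qed.

End oscillation.

(** * Remainders for continuous data *)

Section small_remainder.
Context {R : realType} {n m : nat}.
Variables (Om : set 'rV[R]_n) (f : 'rV[R]_n -> R).
Hypotheses (m_gt0 : (0 < m)%N) (n_gt0 : (0 < n)%N) (oOm : open Om).
Hypothesis f_Linfty : Linfty_loc Om f.

Let C : R := (3 ^+ m.-1 - 2 ^+ m.-1 + 1) / (2 * (n%:R + 2)) ^+ m.

Let C_ge0 : 0 <= C.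
Proof.
rewrite divr_ge0//.
by rewrite addr_ge0// subr_ge0 lerXn2r ?nnegrE// ler_nat.
Qed.

(** Continuity at [x] controls the oscillation around all nearby centres [y] too; with [y = x] this
    gives the pointwise claim, and by compactness the locally uniform one. *)
Lemma remainder_near x eta : Om x -> 0 < eta -> {for x, continuous f} ->
  exists2 d, 0 < d & forall y eps, enorm (y - x) < d -> 0 < eps -> m%:R * eps < d ->
    `|remainder m f eps y| <= eta * eps ^+ (2 * m).
Proof.
(* Two values near [x] differ by at most [2 eta'], and [C * 2 eta' = C / (C + 1) * eta]. *)
move=> Ox eta0 cf; pose eta' := eta / (2 * (C + 1)).
have eta'0 : 0 < eta' by rewrite divr_gt0// mulr_gt0// ltr_wpDl.
have near_x : \forall y \near x, Om y /\ `|f x - f y| < eta'.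
  apply: filterI; first by move: oOm; rewrite openE => /(_ x Ox).
  have /(cvgrPdist_lt (FF := nbhs_filter x)) : f @ x --> f x by exact: cf.
  exact.
have [d d0 dx] := nbhs_eball near_x.
(* The centre moves by [d / 3] and the averages reach another [d / 3], within [d] of [x]. *)
exists (d / 3); first by rewrite divr_gt0.
move=> y eps yx eps0 meps.
have sub z : enorm (z - y) <= d / 3 -> Om z /\ `|f x - f z| < eta'.
  move=> zy; apply: dx; rewrite /eball/= (le_lt_trans (enorm_tri z y x))//.
  by move: zy yx; lra.
have ball_Om : [set z | enorm (z - y) <= d / 3] `<=` Om by move=> z /sub[].
have e0 : 0 <= 2 * eta' by rewrite mulr_ge0// ltW.
rewrite (le_trans (remainder_oscillation m_gt0 n_gt0 eps0 f_Linfty meps ball_Om e0 _))//.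
  move=> z w zy wy _; have [_ fz] := sub z (le_trans zy (ltW meps)).
  have [_ fw] := sub w (le_trans wy (ltW meps)).
  rewrite (_ : f z - f w = (f x - f w) - (f x - f z)); last by ring.
  by rewrite (le_trans (ler_normB _ _))//; move: fz fw; lra.
rewrite -/C ler_wpM2r ?exprn_ge0 ?(ltW eps0)//.
have -> : C * (2 * eta') = C / (C + 1) * eta.
  by rewrite /eta'; field; rewrite gt_eqF// ltr_wpDl.
by rewrite ler_piMl ?(ltW eta0)// ler_pdivrMr ?ltr_wpDl// mul1r lerDl.
Qed.

Lemma remainder_little_o x : Om x -> {for x, continuous f} ->
  (fun eps : R => remainder m f eps x) =o_ (0^'+) (fun eps : R => eps ^+ (2 * m)).
Proof.
move=> Ox cf; apply/eqoP => eta eta0.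
have [d d0 H] := remainder_near Ox eta0 cf.
have m0 : 0 < m%:R :> R by rewrite ltr0n.
near=> eps; have eps0 : 0 < eps by near: eps; exact: nbhs_right_gt.
rewrite [`|eps ^+ _|]ger0_norm ?exprn_ge0 ?(ltW eps0)// H ?subrr ?enorm0//.
rewrite mulrC -ltr_pdivlMr//; near: eps; apply: nbhs_right_lt; exact: divr_gt0.
Unshelve. all: by end_near. Qed.

Lemma remainder_little_o_loc_unif : (forall x, Om x -> {for x, continuous f}) ->
  little_o_loc_unif Om (2 * m) (remainder m f).
Proof.
move=> cf K /compact_near_coveringP cK KOm eta eta0.
have m0 : 0 < m%:R :> R by rewrite ltr0n.
have : \forall eps \near (0 : R)^'+, K `<=` (fun y => 0 < eps ->
    `|remainder m f eps y| <= eta * eps ^+ (2 * m)).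
  apply: (cK _ _ (fun eps y => 0 < eps -> `|remainder m f eps y| <= eta * eps ^+ (2 * m))) => x Kx.
  have Ox := KOm x Kx; have [d d0 H] := remainder_near Ox eta0 (cf x Ox).
  exists (eball x d, [set eps : R | eps < d / m%:R]).
    split => /=; last by apply: nbhs_right_lt; exact: divr_gt0.
    have := @eball_open R n x d; rewrite openE; apply.
    by rewrite /eball/= subrr enorm0.
  move=> [y eps] [/= yx epsd] eps0; apply: H => //.
  by rewrite mulrC -ltr_pdivlMr.
move=> [d /= d0 H]; exists d => // eps /andP[eps0 epsd].
apply/ess_supP; apply: aeW => y; rewrite lee_fin patchE; case: ifPn; last first.
  by rewrite normr0 mulr_ge0 ?(ltW eta0)// exprn_ge0// ltW.
rewrite inE => Ky; apply: (H eps _ eps0 y Ky eps0).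
by rewrite /ball/= sub0r normrN gtr0_norm.
Qed.

End small_remainder.

Theorem theorem2p6 (R : realType) (m n : nat) (Om : set 'rV[R]_n)
    (u f : 'rV[R]_n -> R)
    (m_gt0 : (0 < m)%N) (n_ge2 : (2 <= n)%N) (oOm : open Om)
    (f_Linfty : Linfty_loc Om f)
    (u_C : Ck1 Om (2 * m).-1 u)
    (u_eq : {ae lebesgue_Rn n, forall x, Om x -> is_polylaplacian m u x (f x)}) :
  let admissible (x : 'rV[R]_n) (eps : R) : Prop :=
    0 < eps /\ (eps%:E < dist_boundary Om x / m%:R%:E)%E in
  let expansion (x : 'rV[R]_n) (eps : R) : Prop :=
    avg_sub_pow eps m u x =
      eps ^+ (2 * m) * (\sum_(l < m) ctilde n m l * avg_sub_pow eps l f x)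
      + remainder m f eps x in
  (forall x eps, Om x -> admissible x eps ->
     avg_sub_pow eps m u x =
     \int[lebesgue_Rn m]_(r in cube m eps)
       (multi_avg r f x * \prod_(i < m) kern n eps (r ord0 i)))
  /\ {ae lebesgue_Rn n, forall x, Om x ->
       forall eps, admissible x eps -> expansion x eps}
  /\ (forall x, Om x -> {for x, continuous f} ->
       (fun eps : R => remainder m f eps x) =o_ (0^'+)
       (fun eps : R => eps ^+ (2 * m)))
  /\ ((forall x, Om x -> {for x, continuous f}) ->
       (forall x eps, Om x -> admissible x eps -> expansion x eps) /\
       little_o_loc_unif Om (2 * m) (remainder m f))
  /\ (forall omega : R -> R,
       (forall t, 0 <= t -> 0 <= omega t) ->
       (forall s t, 0 <= s -> s <= t -> omega s <= omega t) ->
       omega t @[t --> 0^'+] --> 0 ->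
       (forall x y, Om x -> Om y -> `|f x - f y| <= omega (enorm (x - y))) ->
       forall x eps, Om x -> admissible x eps ->
         `|remainder m f eps x| <=
         (3 ^+ m.-1 - 2 ^+ m.-1 + 1) / (2 * (n%:R + 2)) ^+ m *
         omega (m%:R * eps) * eps ^+ (2 * m))
  /\ (forall alpha : R, 0 < alpha <= 1 ->
       (exists L : R, forall x y, Om x -> Om y ->
          `|f x - f y| <= L * enorm (x - y) `^ alpha) ->
       exists C : R, forall x eps, Om x -> admissible x eps ->
         `|remainder m f eps x| <= C * eps `^ ((2 * m)%:R + alpha)).
Proof.
move=> admissible expansion; have n_gt0 : (0 < n)%N by rewrite ltnW.
(* Valid at every point of [Om]; both the a.e. claim and the one for continuous [f] follow from
   it. *)
have expansionE x eps : Om x -> admissible x eps -> expansion x eps.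
  move=> Ox [eps0 /(closed_eball_sub oOm m_gt0 Ox)[rho eps_rho ball_Om]].
  exact: (remainder_expansion m_gt0 n_gt0 eps0 f_Linfty eps_rho ball_Om oOm u_C u_eq).
split; last split; last split; last split; last split.
- move=> x eps Ox [eps0 /(closed_eball_sub oOm m_gt0 Ox)[rho eps_rho ball_Om]].
  have rho0 : 0 < rho by rewrite (le_lt_trans _ eps_rho)// mulr_ge0 ?(ltW eps0).
  have [g [bg fg _ _]] := borel_representative f_Linfty rho0 ball_Om.
  exact: (avg_sub_pow_polylaplacian m_gt0 n_gt0 eps0 oOm u_C u_eq eps_rho ball_Om bg fg).
- by apply: aeW => x Ox eps; exact: expansionE.
- by move=> x; exact: (remainder_little_o m_gt0 n_gt0 oOm f_Linfty).
- move=> cf; split; first exact: expansionE.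
  exact: (remainder_little_o_loc_unif m_gt0 n_gt0 oOm f_Linfty).
- move=> omega omega0 omega_le _ f_omega x eps Ox.
  move=> [eps0 /(closed_eball_sub oOm m_gt0 Ox)[rho eps_rho ball_Om]].
  have meps : 0 <= m%:R * eps by rewrite mulr_ge0 ?(ltW eps0).
  apply: (remainder_oscillation m_gt0 n_gt0 eps0 f_Linfty eps_rho ball_Om (omega0 _ meps)).
  move=> y z yx zx yz; rewrite (le_trans (f_omega y z _ _))//.
  + by apply: ball_Om; exact: le_trans yx (ltW eps_rho).
  + by apply: ball_Om; exact: le_trans zx (ltW eps_rho).
  by apply: omega_le => //; exact: enorm_ge0.
move=> alpha /andP[alpha0 _] [L fL].
(* The factor [m^alpha] comes from [(m eps)^alpha]; [|L|] keeps the oscillation bound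
   nonnegative. *)
exists ((3 ^+ m.-1 - 2 ^+ m.-1 + 1) / (2 * (n%:R + 2)) ^+ m * (`|L| * m%:R `^ alpha)).
move=> x eps Ox [eps0 /(closed_eball_sub oOm m_gt0 Ox)[rho eps_rho ball_Om]].
have meps : 0 <= m%:R * eps by rewrite mulr_ge0 ?(ltW eps0).
have eta0 : 0 <= `|L| * (m%:R * eps) `^ alpha by rewrite mulr_ge0 ?powR_ge0.
rewrite (le_trans (remainder_oscillation m_gt0 n_gt0 eps0 f_Linfty eps_rho ball_Om eta0 _))//.
  move=> y z yx zx yz; rewrite (le_trans (fL y z _ _))//.
  + by apply: ball_Om; exact: le_trans yx (ltW eps_rho).
  + by apply: ball_Om; exact: le_trans zx (ltW eps_rho).
  rewrite (le_trans (ler_wpM2r (powR_ge0 _ _) (ler_norm L)))// ler_wpM2l//.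
  by rewrite ge0_ler_powR ?nnegrE ?enorm_ge0// ltW.
rewrite powRM ?(ltW eps0)// powRD ?(gt_eqF eps0) ?implybT// powR_mulrn ?(ltW eps0)//.
by rewrite le_eqVlt; apply/orP; left; apply/eqP; ring.
Qed.
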